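(* Let $\pi(d\theta)$ be a probability distribution on $\Theta$ that is the marginal of a distribution $\pi(d\theta,dx)$ on $\Theta\times S$, $S=S_1\times\dots\times S_K$, with density $\pi(\theta,x)$; let $\mathcal{M}(\theta,dx)$ be a Markov kernel with density $\mathcal{M}(\theta,x)$ that is product-form for each $\theta$, $\mathcal{M}(\theta,dx)=\prod_{k=1}^K\mathcal{M}_k(\theta,dx_k)$; and let $w(\theta,x):=\pi(\theta,x)/\mathcal{M}(\theta,x)$. Let $(\theta^{m,N})_{m=1}^\infty$ and $(\theta^{m,N}_\times)_{m=1}^\infty$ be the Grouped Independence Metropolis-Hastings (GIMH) chains generated with the same proposal $Q(\theta,d\tilde\theta)$ and using, respectively, the density estimates $$\pi^N(\theta)=\frac{1}{N}\sum_{n=1}^Nw(\theta,X^n)\qquad\text{and}\qquad\pi^N_\times(\theta)=\frac{1}{N^K}\sum_{\mathbf{n}\in[N]^K}w(\theta,X^{\mathbf{n}}).$$ If $\varphi$ belongs to $L^2_\pi$, then $$\lim_{M\to\infty}\mathrm{Var}\left(\frac{1}{\sqrt{M}}\sum_{m=1}^M\varphi(\theta^{m,N}_\times)\right)\leq\lim_{M\to\infty}\mathrm{Var}\left(\frac{1}{\sqrt{M}}\sum_{m=1}^M\varphi(\theta^{m,N})\right)\quad\forall N>0.$$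
   Context: $\Theta$ and $S_1,\dots,S_K$ are measurable spaces with reference measures, with respect to which (and their products) all densities are taken. $\pi(\theta)$ denotes the density of $\pi(d\theta)$, and $Q(\theta,d\tilde\theta)$ is a Markov kernel on $\Theta$ with density $Q(\theta,\tilde\theta)$. $[N]:=\{1,\dots,N\}$. In the density estimates, $X^1,\dots,X^N$ are i.i.d. samples from $\mathcal{M}(\theta,\cdot)$, $X^n=(X^n_1,\dots,X^n_K)$, and $X^{\mathbf{n}}:=(X^{n_1}_1,\dots,X^{n_K}_K)$ for $\mathbf{n}=(n_1,\dots,n_K)\in[N]^K$. $L^2_\pi$ is the space of square $\pi$-integrable real-valued functions on $\Theta$. GIMH is the Metropolis-Hastings algorithm targeting $\pi(d\theta)$ in which the intractable density values in the acceptance probability are replaced by estimates. Write $\hat\pi(\theta;X^1,\dots,X^N)$ for the estimate used (either $\pi^N(\theta)$ or $\pi^N_\times(\theta)$, computed from $X^1,\dots,X^N$). From the current state $\theta$ with associated samples $X^1,\dots,X^N$, the algorithm (1) draws $\tilde\theta\sim Q(\theta,\cdot)$ and, given $\tilde\theta$, i.i.d. samples $\tilde X^1,\dots,\tilde X^N$ from $\mathcal{M}(\tilde\theta,\cdot)$; (2) with probability $$1\wedge\frac{\hat\pi(\tilde\theta;\tilde X^1,\dots,\tilde X^N)\,Q(\tilde\theta,\theta)}{\hat\pi(\theta;X^1,\dots,X^N)\,Q(\theta,\tilde\theta)}$$ accepts the move, so that the new state is $\tilde\theta$ with associated samples $\tilde X^1,\dots,\tilde X^N$, and otherwise rejects it,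 keeping $\theta$ and $X^1,\dots,X^N$. The samples are thus recycled from one iteration to the next. $(\theta^{m,N})_{m=1}^\infty$ and $(\theta^{m,N}_\times)_{m=1}^\infty$ are the resulting sequences of $\theta$-states. *)

(* Defs.v *)
From HB Require Import structures.
From mathcomp Require Import all_boot all_order all_algebra.
From mathcomp Require Import all_classical all_reals all_analysis.

Set Implicit Arguments.
Unset Strict Implicit.
Unset Printing Implicit Defensive.
Import Order.TTheory GRing.Theory Num.Theory.
Import numFieldNormedType.Exports.

Local Open Scope classical_set_scope.
Local Open Scope ring_scope.
Local Open Scope ereal_scope.

Section finite_product.
Context (n : nat) (d : 'I_n -> measure_display)
  (S : forall k, measurableType (d k)).

Definition dprod : Type := forall k, S k.

HB.instance Definition _ := gen_eqMixin dprod.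
HB.instance Definition _ := gen_choiceMixin dprod.
HB.instance Definition _ := isPointed.Build dprod (fun k => point).

Definition dprod_cylinder : set (set dprod) :=
  [set B | exists k, exists2 A : set (S k), measurable A &
    B = [set x : dprod | A (x k)]].

Let dprod_set0 : <<s dprod_cylinder >> set0.
Proof. exact: sigma_algebra0. Qed.

Let dprod_setC A : <<s dprod_cylinder >> A -> <<s dprod_cylinder >> (~` A).
Proof. exact: sigma_algebraC. Qed.

Let dprod_bigcup (F : (set dprod)^nat) :
  (forall i, <<s dprod_cylinder >> (F i)) ->
  <<s dprod_cylinder >> (\bigcup_i (F i)).
Proof. exact: sigma_algebra_bigcup. Qed.

Fact dprod_display : measure_display. Proof. exact: default_measure_display. Qed.

HB.instance Definition _ := @isMeasurable.Build dprod_display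
  dprod <<s dprod_cylinder >> dprod_set0 dprod_setC dprod_bigcup.

End finite_product.

Lemma measurable_dproj n (d : 'I_n -> measure_display)
    (S : forall k, measurableType (d k)) (k : 'I_n) :
  measurable_fun [set: dprod S] (fun x : dprod S => x k).
Proof.
move=> _ A mA; rewrite setTI; apply: sub_sigma_algebra.
by exists k, A.
Qed.

Lemma measurable_dprodP n (d : 'I_n -> measure_display)
    (S : forall k, measurableType (d k)) d' (T : measurableType d')
    (f : T -> dprod S) :
  (forall k, measurable_fun [set: T] (fun t => f t k)) ->
  measurable_fun [set: T] f.
Proof.
move=> mf; apply: (@measurability _ _ _ _ _ _ (@dprod_cylinder n d S)) => //.
move=> _ [_ [k [A mA ->]] <-].
exact: mf.
Qed.

Section dcons.
Context (n : nat) (d : 'I_n.+1 -> measure_display)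
  (S : forall k, measurableType (d k)).

Let tl := fun k : 'I_n => S (lift ord0 k).

Definition dcons (x : S ord0 * dprod tl) : dprod S := fun k =>
  match unliftP ord0 k with
  | UnliftSome j e => ecast i (S i) (esym e) (x.2 j)
  | UnliftNone e => ecast i (S i) (esym e) x.1
  end.

Definition duncons (x : dprod S) : S ord0 * dprod tl :=
  (x ord0, fun k => x (lift ord0 k)).

Lemma dcons0 x : dcons x ord0 = x.1.
Proof.
rewrite /dcons; case: unliftP => [j e|e].
  by case/eqP: (neq_lift ord0 j).
by rewrite (eq_axiomK e).
Qed.

Lemma dconsS x j : dcons x (lift ord0 j) = x.2 j.
Proof.
rewrite /dcons; case: unliftP => [i e|e].
  have ji := lift_inj e; subst i.
  by rewrite (eq_axiomK e).
by case/eqP: (neq_lift ord0 j).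
Qed.

Lemma dconsK : cancel dcons duncons.
Proof.
move=> x; rewrite /duncons dcons0 [RHS]surjective_pairing; congr pair.
by apply: functional_extensionality_dep => k; rewrite dconsS.
Qed.

Lemma measurable_dcons : measurable_fun [set: S ord0 * dprod tl] dcons.
Proof.
apply: measurable_dprodP => k.
have [j ->|->] := unliftP ord0 k.
  rewrite (_ : dcons^~ _ = (fun t => t.2 j)); last by apply/funext => t; rewrite dconsS.
  exact: (measurableT_comp (@measurable_dproj _ _ tl j) measurable_snd).
rewrite (_ : dcons^~ _ = fst); last by apply/funext => t; rewrite dcons0.
exact: measurable_fst.
Qed.

Lemma measurable_duncons : measurable_fun [set: dprod S] duncons.
Proof.
apply: measurable_fun_pair; first exact: measurable_dproj.
by apply: measurable_dprodP => k; exact: measurable_dproj.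
Qed.

End dcons.

(* The first coordinate is integrated last:
   (nu_0 x ... x nu_n)(A) = \int nu_0(dx) (nu_1 x ... x nu_n)(A_x). *)
Fixpoint dprod_measure (R : realType) n : forall (d : 'I_n -> measure_display)
    (S : forall k, measurableType (d k)),
    (forall k, set (S k) -> \bar R) -> set (dprod S) -> \bar R :=
  match n with
  | 0 => fun d S _ => \d_(point : dprod S)
  | n'.+1 => fun d S nu => pushforward
      (nu ord0 \x dprod_measure (fun k => nu (lift ord0 k))) (@dcons n' d S)
  end.

Section dcons_measure.
Context (R : realType) (n : nat) (d : 'I_n.+1 -> measure_display)
  (S : forall k, measurableType (d k)).
Context (m1 : {sigma_finite_measure set (S ord0) -> \bar R}).
Context (m2 : {sigma_finite_measure set
  (dprod (fun k : 'I_n => S (lift ord0 k))) -> \bar R}).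

Let mu := pushforward (m1 \x m2) (@dcons n d S).

Let mdcons A : measurable A -> measurable (@dcons n d S @^-1` A).
Proof. by move=> mA; rewrite -[X in measurable X]setTI; exact: measurable_dcons. Qed.

Let mu0 : mu set0 = 0.
Proof. by rewrite /mu /pushforward preimage_set0 measure0. Qed.

Let mu_ge0 A : 0 <= mu A.
Proof. by rewrite /mu /pushforward. Qed.

Let mu_sigma_additive : semi_sigma_additive mu.
Proof.
move=> F mF tF mUF; rewrite /mu /pushforward preimage_bigcup.
apply: measure_semi_sigma_additive.
- by move=> k; exact: mdcons.
- apply/trivIsetP => i j _ _ ij; rewrite -preimage_setI.
  by move/trivIsetP : tF => /(_ _ _ _ _ ij) ->//; rewrite preimage_set0.
- by rewrite -preimage_bigcup; exact: mdcons.
Qed.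

HB.instance Definition _ := isMeasure.Build _ _ _ mu
  mu0 mu_ge0 mu_sigma_additive.

Let mu_sigma_finite : sigma_finite setT mu.
Proof.
have /sigma_finiteP[F [TF ndF Foo]] := sigma_finiteT m1.
have /sigma_finiteP[G [TG ndG Goo]] := sigma_finiteT m2.
exists (fun k => @duncons n d S @^-1` (F k `*` G k)).
  apply/esym; rewrite -subTset => x _.
  have [i _ Fx] : (\bigcup_i F i) (duncons x).1 by rewrite -TF.
  have [j _ Gx] : (\bigcup_j G j) (duncons x).2 by rewrite -TG.
  exists (maxn i j) => //; split.
  - by move: Fx; exact/subsetPset/ndF/leq_maxl.
  - by move: Gx; exact/subsetPset/ndG/leq_maxr.
move=> k; have [mF Fk] := Foo k; have [mG Gk] := Goo k; split.
  by rewrite -[X in measurable X]setTI; apply: measurable_duncons => //;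
    exact: measurableX.
rewrite /mu /pushforward -comp_preimage (_ : _ \o _ = id); last first.
  by apply/funext => x; exact: dconsK.
by rewrite preimage_id product_measure1E// lte_mul_pinfty// ge0_fin_numE.
Qed.

HB.instance Definition _ := Measure_isSigmaFinite.Build _ _ _ mu mu_sigma_finite.

Definition dcons_measure : {sigma_finite_measure set (dprod S) -> \bar R} := mu.

Lemma dcons_measureE (A : forall k, set (S k)) : (forall k, measurable (A k)) ->
  dcons_measure [set x | forall k, A k (x k)] =
  m1 (A ord0) * m2 [set x | forall k, A (lift ord0 k) (x k)].
Proof.
move=> mA; rewrite -product_measure1E//; last first.
  rewrite (_ : [set _ | _] = \bigcap_k
      [set x : dprod (fun k : 'I_n => S (lift ord0 k)) | A (lift ord0 k) (x k)]).
    apply: fin_bigcap_measurable => // k _.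
    rewrite -[X in measurable X]setTI.
    exact: (@measurable_dproj _ _ (fun k : 'I_n => S (lift ord0 k))).
  by apply/seteqP; split => [x Ax k _|x Ax k]; [exact: Ax|exact: (Ax k I)].
rewrite (_ : _ `*` _ = @dcons n d S @^-1` [set x | forall k, A k (x k)])//.
apply/seteqP; split => [x [/= Ax1 Ax2] k|x /= Ax].
  by have [j ->|->] := unliftP ord0 k; [rewrite dconsS|rewrite dcons0].
by split=> [|k]; [rewrite -dcons0|rewrite -dconsS]; exact: Ax.
Qed.

End dcons_measure.

Section dprod_measure_sigma_finite.
Context (R : realType).

Let dprod_measure_ex n (d : 'I_n -> measure_display)
    (S : forall k, measurableType (d k))
    (nu : forall k, {sigma_finite_measure set (S k) -> \bar R}) :
  exists2 mu : {sigma_finite_measure set (dprod S) -> \bar R},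
    dprod_measure (fun k => nu k) = mu &
    forall A : forall k, set (S k), (forall k, measurable (A k)) ->
      mu [set x | forall k, A k (x k)] = \prod_(k < n) nu k (A k).
Proof.
elim: n d S nu => [|n ih] d S nu.
  exists (\d_(point : dprod S) : {sigma_finite_measure set (dprod S) -> \bar R}) => // A mA.
  by rewrite big_ord0 /= diracE mem_set// => -[].
have [mu muE muR] := ih _ _ (fun k => nu (lift ord0 k)).
exists (dcons_measure (nu ord0) mu) => [/=|A mA]; first by rewrite muE.
by rewrite dcons_measureE// big_ord_recl (muR (fun k => A (lift ord0 k))).
Qed.

Context n (d : 'I_n -> measure_display) (S : forall k, measurableType (d k))
  (nu : forall k, {sigma_finite_measure set (S k) -> \bar R}).

Let mu := dprod_measure (fun k => nu k).

Let mu0 : mu set0 = 0.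
Proof. by rewrite /mu; have [m -> _] := dprod_measure_ex nu; exact: measure0. Qed.

Let mu_ge0 A : 0 <= mu A.
Proof. by rewrite /mu; have [m -> _] := dprod_measure_ex nu; exact: measure_ge0. Qed.

Let mu_sigma_additive : semi_sigma_additive mu.
Proof.
rewrite /mu; have [m -> _] := dprod_measure_ex nu.
exact: measure_semi_sigma_additive.
Qed.

HB.instance Definition _ := isMeasure.Build _ _ _ mu
  mu0 mu_ge0 mu_sigma_additive.

Let mu_sigma_finite : sigma_finite setT mu.
Proof.
by rewrite /mu; have [m -> _] := dprod_measure_ex nu; exact: sigma_finiteT.
Qed.

HB.instance Definition _ := Measure_isSigmaFinite.Build _ _ _ mu mu_sigma_finite.

Lemma dprod_measureE (A : forall k, set (S k)) : (forall k, measurable (A k)) ->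
  dprod_measure (fun k => nu k) [set x : dprod S | forall k, A k (x k)] =
  \prod_(k < n) nu k (A k).
Proof. by have [m -> mE] := dprod_measure_ex nu; exact: mE. Qed.

End dprod_measure_sigma_finite.

Section densities.
Context (R : realType) d1 d2 (T1 : measurableType d1) (T2 : measurableType d2).

Definition is_density (mu P : set T1 -> \bar R) (f : T1 -> R) :=
  [/\ measurable_fun [set: T1] f, forall x, (0 <= f x)%R &
      forall A, measurable A -> P A = \int[mu]_(x in A) (f x)%:E].

Definition is_kernel_density (mu : set T2 -> \bar R)
    (k : T1 -> set T2 -> \bar R) (f : T1 * T2 -> R) :=
  [/\ measurable_fun [set: T1 * T2] f, forall z, (0 <= f z)%R &
      forall x A, measurable A -> k x A = \int[mu]_(y in A) (f (x, y))%:E].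

End densities.

(* Z 0, Z 1, ... is a Markov chain with initial law mu0 and transition
   probabilities k. *)
Definition markov_chain (R : realType) d (Omega : measurableType d)
    dE (E : measurableType dE) (P : probability Omega R)
    (mu0 : set E -> \bar R) (k : E -> set E -> \bar R)
    (Z : nat -> Omega -> E) :=
  [/\ forall m, measurable_fun [set: Omega] (Z m),
      forall A, measurable A -> P (Z 0%N @^-1` A) = mu0 A &
      forall m (A : nat -> set E) B, (forall i, measurable (A i)) ->
        measurable B ->
        P (\bigcap_(i in `I_m.+1) (Z i @^-1` A i) `&` Z m.+1 @^-1` B) =
        \int[P]_(w in \bigcap_(i in `I_m.+1) (Z i @^-1` A i)) k (Z m w) B].

Section gimh.
Context (R : realType) dT (T : measurableType dT) dX (X : measurableType dX).
Context (N : nat).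

Definition samples : measurableType dprod_display := dprod (fun _ : 'I_N => X).

(* A GIMH state is a parameter together with the N samples that were used to
   estimate its density. *)
Definition gimh_state : measurableType (dT, dprod_display).-prod :=
  (T * samples)%type.

Definition iid_law (M : T -> set X -> \bar R) (t : T) : set samples -> \bar R :=
  dprod_measure (fun _ : 'I_N => M t).

(* With the convention r / 0 = 0, a proposal is rejected when the denominator
   vanishes; a chain started from [gimh_target] almost surely never meets this
   case. *)
Definition gimh_accept (q : T * T -> R) (est : T -> samples -> R)
    (z z' : gimh_state) : R :=
  (Num.min 1 (est z'.1 z'.2 * q (z'.1, z.1) /
    (est z.1 z.2 * q (z.1, z'.1))))%R.

Definition gimh_kernel (Q : T -> set T -> \bar R) (q : T * T -> R)
    (M : T -> set X -> \bar R) (est : T -> samples -> R)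
    (z : gimh_state) (A : set gimh_state) : \bar R :=
  \int[Q z.1]_t \int[iid_law M t]_x
    (let a := gimh_accept q est z (t, x) in
     a * \1_A (t, x) + (1 - a) * \1_A z)%R%:E.

(* The law est(t; x) lambda(dt) M(t, dx^1) ... M(t, dx^N), with respect to
   which [gimh_kernel] is reversible. *)
Definition gimh_target (lambda : set T -> \bar R) (M : T -> set X -> \bar R)
    (est : T -> samples -> R) (A : set gimh_state) : \bar R :=
  \int[lambda]_t \int[iid_law M t]_x (est t x * \1_A (t, x))%R%:E.

End gimh.

Section estimates.
Context (R : realType) dT (T : measurableType dT).
Context (K : nat) (dS : 'I_K -> measure_display)
  (S : forall k, measurableType (dS k)) (N : nat).

Definition weight (p m : T * dprod S -> R) (t : T) (x : dprod S) : R :=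
  (p (t, x) / m (t, x))%R.

Definition std_estimate (w : T -> dprod S -> R) (t : T)
    (x : samples (dprod S) N) : R :=
  (N%:R^-1 * \sum_(n < N) w t (x n))%R.

Definition pf_estimate (w : T -> dprod S -> R) (t : T)
    (x : samples (dprod S) N) : R :=
  ((N ^ K)%N%:R^-1 *
   \sum_(n : {ffun 'I_K -> 'I_N}) w t (fun k => x (n k) k))%R.

End estimates.

(* M |-> Var(M^{-1/2} (phi(theta_1) + ... + phi(theta_M))), where theta_{m+1}
   is the first component of Z m. *)
Definition scaled_variance (R : realType) d (Omega : measurableType d)
    (P : probability Omega R) (T X : Type) (phi : T -> R)
    (Z : nat -> Omega -> T * X) (M : nat) : \bar R :=
  'V_P[fun w => ((Num.sqrt M%:R)^-1 * \sum_(m < M) phi (Z m w).1)%R].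

(* Main.v *)
Require Import Defs.
From HB Require Import structures.
From mathcomp Require Import all_boot all_order all_algebra.
From mathcomp Require Import all_classical all_reals all_analysis.
From mathcomp Require Import measurable_realfun.
From mathcomp Require Import ring lra zify.

(** A GIMH chain is an ordinary Metropolis-Hastings chain on the space of pairs
    z = (t, x) of a parameter and N samples. With the reference measure
    mu(dt, dx) = lambda(dt) M(t, dx^1) ... M(t, dx^N), its proposal density is
    kap(z, z') = q(t, t') and its target density is the estimate e(t, x) itself
    ([gimh_chain_metropolis]). Two GIMH chains with the same proposal share mu
    and kap, and differ only in e.

    The product-form estimate is a mean of standard estimates of rearranged
    samples. For s in [N]^K let T_s replace the k-th coordinate of sample n by
    the k-th coordinate of sample n + s_k, modulo N. As M(t, .) is a product,
    T_s preserves mu ([coord_shift_invariant]); as every multi-index of [N]^K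
    is reached equally often, e_pf is the mean over s of e_std o T_s
    ([pf_estimate_mean]). The maps T_s do not move the parameter, so neither kap
    nor the observable f(t, x) = phi(t) sees them.

    Averaging a target density in this way cannot increase asymptotic variances
    ([averaging_reduces_variance]). For a reversible kernel k with invariant
    law pi, the asymptotic variance is determined by the autocovariances
    c_n = <f, k^n f>, hence by the behaviour as r -> 1 of
      sum_n r^n c_n = <f, (1 - r k)^-1 f>
                    = sup_g (2 <f, g> - <g, (1 - r k) g>).
    It thus suffices to turn each test function g for the averaged chain into a
    test function G for the original one that has the same pairing with f and no
    larger quadratic form ([resolvent_comparison]). The choice is the mean G of
    the functions g o T_s^-1. The pairings agree because T_s preserves mu and f.
    By detailed balance the quadratic form is
      (1 - r) <g, g> + r/2 int (g(z) - g(z'))^2 rho(z, z') mu(dz) mu(dz'),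
      rho(z, z') = min (e(z) kap(z, z'), e(z') kap(z', z))
    ([mh_qform]). Jensen's inequality, applied to both squares, bounds the form
    at G by that of g for the mean of rho over pairs of maps, and this mean is at
    most the rho of the averaged density because the minimum is concave
    ([mean_mh_flow_le]).

    The limits need some care because the variances may be infinite. Reversibility
    gives |c_{2k+1}| <= c_{2k} and c_{2k+2} <= c_{2k}, which is enough for the
    variances to converge in the extended reals ([midsum_cvg],
    [toeplitz_sum_cvg]) and for an Abelian argument to order the limits from the
    inequality between generating functions ([midsum_lim_le]). The resolvent is
    truncated to finitely many terms, so that only bounded functions occur, and
    square-integrable observables are reached by truncating their values
    ([variance_comparison]).

    Finally, phi(t) is square-integrable in stationarity because the parameter
    has law pi ([theta_law]): the mean of the estimate is at most the density of
    pi, and both integrate to one. *)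

Set Implicit Arguments.
Unset Strict Implicit.
Unset Printing Implicit Defensive.
Import Order.TTheory GRing.Theory Num.Theory.
Import numFieldNormedType.Exports.

Local Open Scope classical_set_scope.
Local Open Scope ring_scope.

(** * Autocovariance sequences *)

Section autocovariance_sequences.
Context {R : realType}.
Implicit Types c d : R^nat.

(** What remains of reversibility: for c_n = <f, k^n f> the even terms are the
    squared norms of k^i f, which do not increase, and the odd ones are the
    products <k^i f, k (k^i f)>. *)
Definition chain_like c :=
  forall k, `|c k.*2.+1| <= c k.*2 /\ c k.*2.+2 <= c k.*2.

(** Partial sums may oscillate for ever (take c_n = (-1)^n), but the midpoints of
    consecutive partial sums converge, possibly to +oo ([midsum_cvg]). *)
Definition midsum c n := series c n + c n / 2.

(** The argument of c is the distance between i and j, one of the two truncated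
    differences being zero. *)
Definition toeplitz_sum c n := \sum_(i < n) \sum_(j < n) c (i - j + (j - i))%N.

Lemma seriesD1 c n : series c n.+1 = series c n + c n.
Proof. by rewrite /series/= big_nat_recr. Qed.

(** The last row and column add 2 (c_0 + ... + c_n) - c_0. *)
Lemma toeplitz_sumE c n :
  toeplitz_sum c n = 2 * series (midsum c) n + series c n - n%:R * c 0%N.
Proof.
have key m : toeplitz_sum c m.+1 = toeplitz_sum c m + 2 * series c m.+1 - c 0%N.
  rewrite /toeplitz_sum big_ord_recr/=.
  under eq_bigr do rewrite big_ord_recr/=.
  rewrite big_split/= big_ord_recr/= subnn addn0.
  have h : \sum_(i < m) c (i - m + (m - i))%N = \sum_(i < m) c i.+1.
    rewrite (reindex_inj rev_ord_inj)/=; apply: eq_bigr => i _; congr c.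
    have := ltn_ord i; lia.
  have h' : \sum_(i < m) c (m - i + (i - m))%N = \sum_(i < m) c i.+1.
    by rewrite -h; apply: eq_bigr => i _; congr c; lia.
  rewrite h h' seriesEnat/= big_mkord big_ord_recl.
  by ring.
elim: n => [|n ih].
  by rewrite /toeplitz_sum big_ord0 /series /= !big_geq//; ring.
rewrite key ih (seriesD1 (midsum c)) (seriesD1 c) /midsum -natr1.
by field.
Qed.

Lemma chain_like_le0 c k : chain_like c -> 0 <= c k.*2 <= c 0%N.
Proof.
move=> cc; apply/andP; split; first by have [+ _] := cc k; apply: le_trans.
elim: k => [//|k ih]; rewrite doubleS; apply: le_trans ih.
by have [] := cc k.
Qed.

Lemma chain_like_norm c n : chain_like c -> `|c n| <= c 0%N.
Proof.
move=> cc; rewrite -(odd_double_half n); case: (odd n).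
  rewrite add1n; have [+ _] := cc n./2 => /le_trans; apply.
  by have /andP[] := chain_like_le0 n./2 cc.
by rewrite add0n; have /andP[h1 h2] := chain_like_le0 n./2 cc; rewrite ger0_norm.
Qed.

Lemma cvg_even_odd (U : topologicalType) (u : U^nat) (l : U) :
  (fun k => u k.*2) @ \oo --> l -> (fun k => u k.*2.+1) @ \oo --> l ->
  u @ \oo --> l.
Proof.
move=> ue uo A Al; have [m _ mA] := ue A Al; have [m' _ mA'] := uo A Al.
exists (m + m').*2.+1 => // n /= mn; rewrite -(odd_double_half n).
have n2 := odd_double_half n.
case: (odd n) n2 => n2; rewrite ?add1n ?add0n.
  by apply: mA' => /=; lia.
by apply: mA => /=; lia.
Qed.

(** Each even term dominates the odd one that follows it. *)
Lemma series_even_nd c : chain_like c -> nondecreasing_seq (fun k => series c k.*2).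
Proof.
move=> cc; apply/nondecreasing_seqP => k; rewrite doubleS !seriesD1.
by have [+ _] := cc k; rewrite ler_norml => /andP[+ _]; lra.
Qed.

Lemma series_even_ge0 c k : chain_like c -> 0 <= series c k.*2.
Proof.
move=> cc; have := series_even_nd cc (leq0n k).
by rewrite /series/= big_geq.
Qed.

(** The even partial sums are monotone; bounds from below in terms of them take
    care of divergent series. *)
Lemma series_midsum_ge c n : chain_like c ->
  series c n./2.*2 <= midsum c n /\ series c n./2.*2 <= series c n.
Proof.
move=> cc; rewrite /midsum -{2 3 5}(odd_double_half n).
have [c0 _] := cc n./2; have c0' := chain_like_le0 n./2 cc.
move: c0 c0'; rewrite ler_norml => /andP[c1 c2] /andP[c3 c4].
by case: (odd n); rewrite ?add1n ?add0n ?seriesD1; split; lra.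
Qed.

Lemma midsum_ge0 c n : chain_like c -> 0 <= midsum c n.
Proof.
move=> cc; have [+ _] := series_midsum_ge n cc; apply: le_trans.
exact: series_even_ge0.
Qed.

(** The even partial sums increase and c_{2k} decreases. If both converge, the
    midpoint at 2k + 1 has the limit of the midpoint at 2k, since it is the mean of
    two even partial sums plus c_{2k} / 2. *)
Lemma midsum_cvg c : chain_like c ->
  exists l : \bar R, (fun n => (midsum c n)%:E) @ \oo --> l.
Proof.
move=> cc; pose a k := series c k.*2.
have aS k : a k.+1 = a k + c k.*2 + c k.*2.+1.
  by rewrite /a doubleS !seriesD1.
have nda : nondecreasing_seq a by exact: series_even_nd.
have nic : nonincreasing_seq (fun k => c k.*2).
  apply/nonincreasing_seqP => k; rewrite doubleS.
  by have [] := cc k.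
have cb : cvgn (fun k => c k.*2).
  apply: nonincreasing_is_cvgn => //; exists 0 => _ [k _ <-].
  by have /andP[] := chain_like_le0 k cc.
have [ca|da] := pselect (cvgn a); last first.
  exists +oo%E; apply/cvgeryP; apply/cvgryPge => A.
  move/cvgryPge : (nondecreasing_dvgn_lt nda da) => /(_ A)[m _ mA].
  exists m.*2 => // n /= mn.
  have /mA/le_trans : (m <= n./2)%N by lia.
  by apply; have [] := series_midsum_ge n cc.
exists (limn a + limn (fun k => c k.*2) / 2)%:E.
apply: cvg_EFin; first exact: nearW.
apply: cvg_even_odd.
  by rewrite /midsum; apply: cvgD ca _; apply: cvgMr_tmp.
rewrite [X in X @ _ --> _](_ : _ =
    fun k => (a k + a k.+1) / 2 + c k.*2 / 2); last first.
  by apply/funext => k; rewrite /midsum aS /= seriesD1 -/(a k); field.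
apply: cvgD; last exact: cvgMr_tmp.
rewrite [X in _ --> X](_ : _ = (limn a + limn a) / 2); last by field.
apply: cvgMr_tmp; apply: cvgD => //.
by have := ca; rewrite -[X in X -> _]/(a @ \oo --> _) -cvg_shiftS.
Qed.

(** By [toeplitz_sumE] the normalised sum is twice a Cesaro mean of midpoints, up
    to c_0 and to a term [series c n / n], which vanishes in the limit if l is
    finite and is non-negative in any case. *)
Lemma toeplitz_sum_cvg c (l : \bar R) : chain_like c ->
  (fun n => (midsum c n)%:E) @ \oo --> l ->
  (fun n => (n%:R^-1 * toeplitz_sum c n)%:E) @ \oo --> (2%:E * l - (c 0%N)%:E)%E.
Proof.
move=> cc ml.
have ser_ge0 n : 0 <= series c n.
  by have [_] := series_midsum_ge n cc; apply: le_trans; exact: series_even_ge0.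
have mid_ge0 n : 0 <= midsum c n by exact: midsum_ge0.
have TE n : n.+1%:R^-1 * toeplitz_sum c n.+1 =
    2 * arithmetic_mean (midsum c) n + n.+1%:R^-1 * series c n.+1 - c 0%N.
  rewrite toeplitz_sumE /arithmetic_mean/=; field.
  by rewrite nat1r pnatr_eq0.
case: l ml => [l| |] ml.
- rewrite -EFinM -EFinB; apply: cvg_EFin; first exact: nearW.
  have {}ml : midsum c @ \oo --> l by exact: (fine_cvg ml).
  rewrite -cvg_shiftS (_ : [sequence _]_n = fun n => 2 * arithmetic_mean (midsum c) n +
      (n.+1%:R^-1 * midsum c n.+1 - n.+1%:R^-1 * (c n.+1 / 2)) - c 0%N); last first.
    by apply/funext => n /=; rewrite TE /midsum; ring.
  apply: cvgB; last exact: cvg_cst.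
  rewrite -[X in _ --> X]addr0; apply: cvgD.
    apply: cvgMl_tmp. exact: cesaro.
  rewrite -[X in _ --> X]subr0; apply: cvgB.
    rewrite -[X in _ --> X](mul0r l); apply: cvgM; first exact: cvg_harmonic.
    by rewrite (cvg_shiftS (midsum c)).
  apply/cvgr0Pnorm_le => e e0.
  have /cvgr0Pnorm_le /(_ e e0) : (fun n => n.+1%:R^-1 * c 0%N) @ \oo --> 0.
    by rewrite -[X in _ --> X](mul0r (c 0%N)); apply: cvgMr_tmp; exact: cvg_harmonic.
  apply: filterS => n; apply: le_trans; rewrite normrM [leRHS]normrM ler_wpM2l//.
  have := chain_like_norm n.+1 cc; have /andP[] := chain_like_le0 0 cc.
  move=> c0 _ cn.
  rewrite normrM (@ger0_norm _ 2^-1) ?invr_ge0// (ger0_norm c0).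
  by have := normr_ge0 (c n.+1); lra.
- rewrite gt0_muley// addye//; apply/cvgeryP; rewrite -cvg_shiftS; apply/cvgryPge => A.
  move/cvgeryP/cvgryPge : ml => /(_ (`|A| + `|c 0%N|))[m _ mA].
  exists m.*2 => // n /= mn; rewrite TE.
  have h : `|A| + `|c 0%N| <= 2 * arithmetic_mean (midsum c) n.
    rewrite /arithmetic_mean/= mulrCA ler_pdivlMl ?ltr0n//.
    rewrite seriesEnat/= (@big_cat_nat _ _ _ m)//=; last lia.
    have h0 : 0 <= \sum_(0 <= k < m) midsum c k by apply: sumr_ge0.
    have h1 : (`|A| + `|c 0%N|) *+ (n.+1 - m) <= \sum_(m <= k < n.+1) midsum c k.
      rewrite -sumr_const_nat; apply: ler_sum_nat => i /andP[im _].
      exact: mA.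
    have h2 : n.+1%:R <= 2 * (n.+1 - m)%:R :> R.
      by rewrite -natrM ler_nat; lia.
    have h3 : 0 <= `|A| + `|c 0%N| by rewrite addr_ge0.
    rewrite -mulr_natr in h1; nra.
  have h' : 0 <= n.+1%:R^-1 * series c n.+1 by rewrite mulr_ge0.
  by rewrite lerBrDr -[leLHS]addr0 lerD// (le_trans _ h)// lerD ?ler_norm.
- move/cvgeNyPle : ml => /(_ (-1))[m _ /(_ m (leqnn m))].
  by rewrite lee_fin => h; have := mid_ge0 m; lra.
Qed.

(** Each of the terms 1, r, ..., r^n of the geometric series is at least r^n. *)
Lemma natmul_expr_le (r : R) n : 0 <= r < 1 -> n.+1%:R * r ^+ n <= (1 - r)^-1.
Proof.
move=> /andP[r0 r1].
have : n.+1%:R * r ^+ n <= series (geometric 1 r) n.+1.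
  rewrite seriesEnat/= big_mkord mulr_natl -[X in _ *+ X](card_ord n.+1) -sumr_const.
  apply: ler_sum => i _; rewrite /= mul1r.
  by apply: ler_wiXn2l; [exact: r0|exact: ltW|rewrite -ltnS].
move=> /le_trans; apply; rewrite geometric_seriesE ?lt_eqF//= mul1r.
by rewrite ler_piMl ?invr_ge0 ?subr_ge0 ?(ltW r1)// gerBl exprn_ge0.
Qed.

(** With r = t^4 the sequence is ((n + 1) t^n)^2 t^(2n), and (n + 1) t^n is
    bounded. *)
Lemma cvg_sqr_expr (r : R) : 0 < r < 1 ->
  (fun n => n.+1%:R ^+ 2 * r ^+ n) @ \oo --> 0.
Proof.
move=> /andP[r0 r1]; pose s := Num.sqrt r; pose t := Num.sqrt s.
have s0 : 0 < s by rewrite sqrtr_gt0.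
have s2 : s ^+ 2 = r by rewrite sqr_sqrtr// ltW.
have t0 : 0 < t by rewrite sqrtr_gt0.
have t2 : t ^+ 2 = s by rewrite sqr_sqrtr// ltW.
have s1 : s < 1 by rewrite -(@expr_lt1 _ 2)// ?s2 ?ltW.
have t1 : t < 1 by rewrite -(@expr_lt1 _ 2)// ?t2 ?ltW.
apply: (@squeeze_cvgr _ _ _ _ (cst 0) (fun n => (1 - t)^-1 ^+ 2 * s ^+ n)).
- apply: nearW => n /=; apply/andP; split; first by rewrite mulr_ge0// exprn_ge0// ltW.
  have -> : r ^+ n = (t ^+ n) ^+ 2 * s ^+ n.
    by rewrite -exprM mulnC exprM t2 -exprMn -expr2 s2.
  rewrite mulrA -exprMn ler_wpM2r ?exprn_ge0 ?(ltW s0)//.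
  rewrite lerXn2r ?nnegrE ?invr_ge0 ?subr_ge0 ?(ltW t1)//.
    by rewrite mulr_ge0// exprn_ge0// ltW.
  by apply: natmul_expr_le; rewrite (ltW t0).
- exact: cvg_cst.
- rewrite -[X in _ --> X](mulr0 ((1 - t)^-1 ^+ 2)); apply: cvgMl_tmp.
  by apply: cvg_expr; rewrite ger0_norm// ltW.
Qed.

(** Summation by parts; (1 + r) / 2 in place of 1 accounts for the midpoints. *)
Lemma abel_sum_midsum d (r : R) n :
  (1 + r) / 2 * (\sum_(k < n) r ^+ k * d k) =
  (1 - r) * (\sum_(k < n) r ^+ k * midsum d k) + r ^+ n * series d n.
Proof.
elim: n => [|n ih]; first by rewrite !big_ord0 /series/= big_geq//; ring.
by rewrite !big_ord_recr/= mulrDr ih seriesD1 /midsum exprS; field.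
Qed.

Lemma norm_series_le d (B : R) n : (forall k, `|d k| <= B) ->
  `|series d n| <= n%:R * B.
Proof.
move=> dB; rewrite seriesEnat/= big_mkord (le_trans (ler_norm_sum _ _ _))//.
rewrite mulr_natl -[X in _ *+ X](card_ord n) -sumr_const.
exact: ler_sum.
Qed.

(** If e > 0, then by [abel_sum_midsum] the sums over k < n are, for r close to 1,
    bounded away from 0 as n -> oo, whereas for every r < 1 their upper bounds
    tend to 0. *)
Lemma eventual_midsum_bound_le0 d (B e : R) : (forall k, `|d k| <= B) ->
  (forall (r : R) n, 0 < r < 1 ->
    \sum_(k < n) r ^+ k * d k <= n.+1%:R ^+ 2 * r ^+ n * B) ->
  (\forall n \near \oo, e <= midsum d n) -> e <= 0.
Proof.
move=> dB dr [m _ me]; rewrite leNgt; apply/negP => e0.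
pose C : R := \sum_(k < m) `|midsum d k|.
have B0 : 0 <= B := le_trans (normr_ge0 _) (dB 0%N).
have key (r : R) n : 0 < r < 1 -> e * (r ^+ m - r ^+ (n + m)) <=
    (1 - r) * C + 2 * B * ((n + m).+1%:R ^+ 2 * r ^+ (n + m)).
  move=> r01; have /andP[r0 r1] := r01.
  have := abel_sum_midsum d r (n + m).
  have lb : (1 - r) * - C + e * (r ^+ m - r ^+ (n + m)) <=
    (1 - r) * (\sum_(k < n + m) r ^+ k * midsum d k).
    elim: n => [|n ih].
      rewrite add0n subrr mulr0 addr0 ler_wpM2l ?subr_ge0 ?(ltW r1)//.
      rewrite lerNl -sumrN; apply: ler_sum => i _.
      rewrite -mulrN (le_trans (ler_norm _))// normrM normrN.
      by rewrite ler_piMl// ger0_norm ?exprn_ge0 ?exprn_ile1// ltW.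
    rewrite addSn big_ord_recr/= mulrDr exprS.
    have : (1 - r) * (r ^+ (n + m) * e) <= (1 - r) * (r ^+ (n + m) * midsum d (n + m)).
      apply: ler_wpM2l; first by rewrite subr_ge0 ltW.
      by apply: ler_wpM2l; [rewrite exprn_ge0// ltW|apply: me; rewrite /= leq_addl].
    lra.
  have sB : - ((n + m).+1%:R ^+ 2 * r ^+ (n + m) * B) <= r ^+ (n + m) * series d (n + m).
    rewrite (mulrC _ (r ^+ _)) -mulrA -mulrN ler_wpM2l ?exprn_ge0 ?(ltW r0)//.
    rewrite lerNl (le_trans (ler_norm _))// normrN (le_trans (norm_series_le _ dB))//.
    by rewrite ler_wpM2r// -natrX ler_nat; nia.
  have ub : (1 + r) / 2 * (\sum_(k < n + m) r ^+ k * d k) <=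
      (n + m).+1%:R ^+ 2 * r ^+ (n + m) * B.
    have h := dr r (n + m)%N r01.
    apply: (@le_trans _ _ ((1 + r) / 2 * ((n + m).+1%:R ^+ 2 * r ^+ (n + m) * B))).
      by rewrite ler_wpM2l//; lra.
    by rewrite ler_piMl ?mulr_ge0 ?exprn_ge0//; lra.
  lra.
have {}key (r : R) : 0 < r < 1 -> e * r ^+ m <= (1 - r) * C.
  move=> r01; have /andP[r0 r1] := r01.
  have c1 : (fun n => r ^+ (n + m)) @ \oo --> 0.
    rewrite (cvg_shiftn m (fun n => r ^+ n)); apply: cvg_expr.
    by rewrite ger0_norm// ltW.
  have c2 : (fun n => (n + m).+1%:R ^+ 2 * r ^+ (n + m)) @ \oo --> 0.
    rewrite (cvg_shiftn m (fun n => n.+1%:R ^+ 2 * r ^+ n)).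
    exact: cvg_sqr_expr.
  have {}c1 : (fun n => e * (r ^+ m - r ^+ (n + m))) @ \oo --> e * (r ^+ m - 0).
    by apply: cvgMl_tmp; apply: cvgB => //; exact: cvg_cst.
  have {}c2 : (fun n => (1 - r) * C + 2 * B * ((n + m).+1%:R ^+ 2 * r ^+ (n + m)))
      @ \oo --> (1 - r) * C + 2 * B * 0.
    by apply: cvgD; [exact: cvg_cst|exact: cvgMl_tmp].
  have H : e * (r ^+ m - 0) <= (1 - r) * C + 2 * B * 0.
    by apply: (ler_cvg_to c1 c2); apply: nearW => n; exact: key.
  by move: H; rewrite subr0 mulr0 addr0.
pose r n : R := 1 - n.+2%:R^-1.
have cr : r @ \oo --> (1 : R).
  rewrite -[X in _ --> X]subr0; apply: cvgB; first exact: cvg_cst.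
  by have := @cvg_harmonic R; rewrite -cvg_shiftS.
have crm : (fun n => r n ^+ m) @ \oo --> (1 : R) ^+ m.
  elim: m {me C key} => [|i ih].
    by rewrite expr0; under eq_fun do rewrite expr0; exact: cvg_cst.
  by rewrite exprS; under eq_fun do rewrite exprS; exact: cvgM.
have c1 : (fun n => e * r n ^+ m) @ \oo --> e * 1 ^+ m by exact: cvgMl_tmp.
have c2 : (fun n => (1 - r n) * C) @ \oo --> (1 - 1) * C.
  by apply: cvgMr_tmp; apply: cvgB => //; exact: cvg_cst.
have : e * 1 ^+ m <= (1 - 1) * C.
  apply: (ler_cvg_to c1 c2); apply: nearW => n; apply: key.
  by rewrite /r subr_gt0 ltrBlDr ltrDl invr_gt0 ltr0n andbT invf_lt1 ?ltr1n.
by rewrite expr1n mulr1 subrr mul0r leNgt e0.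
Qed.

(** If l < l', the midpoints of c' - c are eventually above a positive number,
    against [eventual_midsum_bound_le0]. *)
Lemma midsum_lim_le c c' (l l' : \bar R) : chain_like c -> chain_like c' ->
  c' 0%N = c 0%N ->
  (forall (r : R) n, 0 < r < 1 -> \sum_(k < n) r ^+ k * c' k <=
    \sum_(k < n) r ^+ k * c k + n.+1%:R ^+ 2 * r ^+ n * c 0%N) ->
  (fun n => (midsum c n)%:E) @ \oo --> l ->
  (fun n => (midsum c' n)%:E) @ \oo --> l' -> (l' <= l)%E.
Proof.
move=> cc cc' c0 cr ml ml'.
have h e : (\forall n \near \oo, e <= midsum (fun k => c' k - c k) n) -> e <= 0.
  apply: (@eventual_midsum_bound_le0 _ (2 * c 0%N)) => [k|r n r01].
    rewrite (le_trans (ler_normB _ _))//.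
    have := chain_like_norm k cc; have := chain_like_norm k cc'; rewrite c0; lra.
  under eq_bigr do rewrite mulrBr.
  rewrite sumrB; have := cr r n r01.
  have := chain_like_norm 0 cc; have := normr_ge0 (c 0%N).
  have := @exprn_ge0 _ n r; have : 0 <= n.+1%:R ^+ 2 :> R by [].
  have /andP[/ltW r0 _] := r01.
  move=> n0 /(_ r0) rn c1 c2.
  have : 0 <= n.+1%:R ^+ 2 * r ^+ n * c 0%N by rewrite !mulr_ge0//; lra.
  lra.
have mB n : midsum (fun k => c' k - c k) n = midsum c' n - midsum c n.
  by rewrite /midsum /series/= sumrB; field.
have contra e : 0 < e -> ~ (\forall n \near \oo, e <= midsum c' n - midsum c n).
  move=> e0 H; have := h e; rewrite leNgt e0/= => /(_ _)/wrap[]//.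
  by apply: filterS H => n; rewrite mB.
case: l ml => [l| |] ml; case: l' ml' => [l'| |] ml'; rewrite ?leey ?leNye//.
- rewrite lee_fin leNgt; apply/negP => ll'.
  have ml1 : midsum c' @ \oo --> l' by exact: (fine_cvg ml').
  have ml2 : midsum c @ \oo --> l by exact: (fine_cvg ml).
  have e0 : 0 < (l' - l) / 2 by rewrite divr_gt0// subr_gt0.
  apply: (contra _ e0).
  have /cvgrPdist_le/(_ _ e0) : (fun n => midsum c' n - midsum c n) @ \oo --> l' - l.
    exact: cvgB.
  apply: filterS => n /=.
  rewrite ler_norml => /andP[_]; lra.
- exfalso; apply: (contra 1) => //.
  have : midsum c @ \oo --> l by exact: (fine_cvg ml).
  move=> /cvgrPdist_le/(_ 1 ltr01).
  move/cvgeyPge : ml' => /(_ (l + 2)); apply: filterS2 => n /=.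
  rewrite lee_fin ler_norml => h1 /andP[h2 h3]; lra.
- exfalso; have cl n : 0 <= midsum c n by exact: midsum_ge0.
  move/cvgeNyPle : ml => /(_ (-1))[m _ /(_ m (leqnn m))].
  by rewrite lee_fin => hm; have := cl m; lra.
- exfalso; have cl n : 0 <= midsum c n by exact: midsum_ge0.
  move/cvgeNyPle : ml => /(_ (-1))[m _ /(_ m (leqnn m))].
  by rewrite lee_fin => hm; have := cl m; lra.
Qed.

End autocovariance_sequences.

(** * Mixtures and densities of measures *)

Local Open Scope ereal_scope.

Section mixture.
Context d d' (Y : measurableType d) (Z : measurableType d') (R : realType).
Variables (m : {measure set Y -> \bar R}) (k : Y -> {measure set Z -> \bar R}).

(** Measurability of k is an argument because without it the integral need not be
    a measure. *)
Definition mixture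
  of (forall U, measurable U -> measurable_fun [set: Y] (k ^~ U)) :=
  fun A : set Z => \int[m]_y k y A.

Hypothesis mk : forall U, measurable U -> measurable_fun [set: Y] (k ^~ U).

Let mixture0 : mixture mk set0 = 0.
Proof. by apply: integral0_eq => y _; rewrite measure0. Qed.

Let mixture_ge0 A : 0 <= mixture mk A.
Proof. exact: integral_ge0. Qed.

Let mixture_sigma_additive : semi_sigma_additive (mixture mk).
Proof.
move=> F mF tF mUF; rewrite [X in _ --> X](_ : _ =
    \int[m]_y (\sum_(0 <= n <oo) k y (F n))); last first.
  apply: eq_integral => y _.
  by apply/esym/cvg_lim => //; exact: measure_semi_sigma_additive.
apply/cvg_closeP; split.
  by apply: is_cvg_nneseries => n _ _; exact: integral_ge0.
rewrite closeE// integral_nneseries// => n; exact: mk.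
Qed.

HB.instance Definition _ := isMeasure.Build _ _ _ (mixture mk)
  mixture0 mixture_ge0 mixture_sigma_additive.

Import HBNNSimple.

(** The hypothesis is the case of indicators; simple functions and monotone
    convergence give the general one. *)
Lemma integral_mixture (mu : {measure set Z -> \bar R})
    (muE : forall A, measurable A -> mu A = \int[m]_y k y A) (f : Z -> \bar R) :
  (forall z, 0 <= f z) -> measurable_fun [set: Z] f ->
  \int[mu]_z f z = \int[m]_y \int[k y]_z f z.
Proof.
move=> f0 mf; pose f_ := nnsfun_approx measurableT mf.
have f_f (nu : {measure set Z -> \bar R}) : \int[nu]_z f z = limn (fun n => \int[nu]_z (f_ n z)%:E).
  rewrite -monotone_convergence//.
  - apply: eq_integral => z _; apply/esym/cvg_lim => //.
    exact: cvg_nnsfun_approx.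
  - by move=> n; exact/measurable_EFinP.
  - by move=> n z _; rewrite lee_fin.
  - by move=> z _ a b ab; rewrite lee_fin; exact/lefP/nd_nnsfun_approx.
have mI (g : {nnsfun Z >-> R}) : measurable_fun [set: Y] (fun y => \int[k y]_z (g z)%:E).
  apply: measurable_fun_integral_kernel => //.
    by move=> z; rewrite lee_fin.
  exact/measurable_EFinP.
have sfE (g : {nnsfun Z >-> R}) :
    \int[mu]_z (g z)%:E = \int[m]_y \int[k y]_z (g z)%:E.
  rewrite integralT_nnsfun sintegralE.
  under [in RHS]eq_integral do rewrite integralT_nnsfun sintegralE.
  rewrite ge0_integral_fsum//.
  - apply: eq_fsbigr => r _.
    have [r0|r0] := ltP r 0%R.
      rewrite preimage_nnfun0// measure0 mule0 integral0_eq// => y _.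
      by rewrite measure0 mule0.
    by rewrite muE// ge0_integralZl//; exact: mk.
  - by move=> r; apply: measurable_funeM; exact: mk.
  - by move=> r y _; exact: nnsfun_mulemu_ge0.
rewrite f_f; under [in RHS]eq_integral do rewrite f_f.
rewrite monotone_convergence//.
- by congr (limn _); apply/funext => n; exact: sfE.
- by move=> n y _; apply: integral_ge0 => z _; rewrite lee_fin.
- move=> y _ a b ab; apply: ge0_le_integral => //.
  + by move=> z _; rewrite lee_fin.
  + exact/measurable_EFinP.
  + exact/measurable_EFinP.
  + by move=> z _; rewrite lee_fin; exact/lefP/nd_nnsfun_approx.
Qed.

End mixture.

(** Iterated integrals that agree on indicators agree on non-negative functions.
    Densities, images and conditional laws are all treated as instances. *)
Lemma eq_mixture d1 d2 d (Y1 : measurableType d1) (Y2 : measurableType d2)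
    (Z : measurableType d) (R : realType)
    (m1 : {measure set Y1 -> \bar R}) (m2 : {measure set Y2 -> \bar R})
    (k1 : Y1 -> {measure set Z -> \bar R}) (k2 : Y2 -> {measure set Z -> \bar R}) :
  (forall U, measurable U -> measurable_fun [set: Y1] (k1 ^~ U)) ->
  (forall U, measurable U -> measurable_fun [set: Y2] (k2 ^~ U)) ->
  (forall A, measurable A -> \int[m1]_y k1 y A = \int[m2]_y k2 y A) ->
  forall f, (forall z, 0 <= f z) -> measurable_fun [set: Z] f ->
  \int[m1]_y \int[k1 y]_z f z = \int[m2]_y \int[k2 y]_z f z.
Proof.
move=> mk1 mk2 k12 f f0 mf.
have E1 := @integral_mixture _ _ _ _ _ m1 k1 mk1 (mixture m1 mk1) (fun _ _ => erefl).
by rewrite -E1// (@integral_mixture _ _ _ _ _ m2 k2 mk2).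
Qed.

Section weighted_image.
Context d d' (Y : measurableType d) (Z : measurableType d') (R : realType).
Variables (g : Y -> R) (W : Y -> Z).
Hypotheses (mg : measurable_fun [set: Y] g) (g0 : forall y, (0 <= g y)%R).

Lemma measurable_mscale (k : Y -> {measure set Z -> \bar R}) :
  (forall U, measurable U -> measurable_fun [set: Y] (k ^~ U)) ->
  forall U, measurable U ->
  measurable_fun [set: Y] (fun y => mscale (NngNum (g0 y)) (k y) U).
Proof.
move=> mk U mU; rewrite /mscale/=; apply: emeasurable_funM; last exact: mk.
exact/measurable_EFinP.
Qed.

Hypothesis mW : measurable_fun [set: Y] W.

Lemma measurable_dirac_comp U : measurable U ->
  measurable_fun [set: Y] (fun y => \d_(W y) U : \bar R).
Proof.
by move=> mU; apply: (measurableT_comp (measurable_fun_dirac mU)).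
Qed.

Lemma integral_mscale_dirac (m : {measure set Y -> \bar R}) A : measurable A ->
  \int[m]_y mscale (NngNum (g0 y)) (\d_(W y)) A =
  \int[m]_(y in W @^-1` A) (g y)%:E.
Proof.
move=> mA; rewrite [RHS]integral_mkcond; apply: eq_integral => y _.
rewrite /mscale/= diracE patchE -[y \in _]/(W y \in A).
by case: ifPn => _; rewrite ?mule1 ?mule0.
Qed.

Lemma ge0_integral_mscale_dirac (f : Z -> \bar R) y :
  (forall z, 0 <= f z) -> measurable_fun [set: Z] f ->
  \int[mscale (NngNum (g0 y)) (\d_(W y))]_z f z = (g y)%:E * f (W y).
Proof.
move=> f0 mf; rewrite ge0_integral_mscale//= integral_dirac//.
by rewrite diracT mul1e.
Qed.

End weighted_image.

Lemma integral_one d (T : measurableType d) (R : realType)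
    (mu : {measure set T -> \bar R}) D :
  measurable D -> \int[mu]_(x in D) 1%:E = mu D.
Proof. by move=> mD; rewrite -[RHS]mul1e -integral_cst. Qed.

(** The image under W of the measure with density g is the mixture of the point
    masses of weight g y at W y. *)
Lemma eq_weighted_image d1 d2 d (Y1 : measurableType d1) (Y2 : measurableType d2)
    (Z : measurableType d) (R : realType)
    (m1 : {measure set Y1 -> \bar R}) (m2 : {measure set Y2 -> \bar R})
    (g1 : Y1 -> R) (g2 : Y2 -> R) (W1 : Y1 -> Z) (W2 : Y2 -> Z) :
  measurable_fun [set: Y1] g1 -> (forall y, (0 <= g1 y)%R) ->
  measurable_fun [set: Y2] g2 -> (forall y, (0 <= g2 y)%R) ->
  measurable_fun [set: Y1] W1 -> measurable_fun [set: Y2] W2 ->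
  (forall A, measurable A -> \int[m1]_(y in W1 @^-1` A) (g1 y)%:E =
                             \int[m2]_(y in W2 @^-1` A) (g2 y)%:E) ->
  forall f, (forall z, 0 <= f z) -> measurable_fun [set: Z] f ->
  \int[m1]_y ((g1 y)%:E * f (W1 y)) = \int[m2]_y ((g2 y)%:E * f (W2 y)).
Proof.
move=> mg1 g10 mg2 g20 mW1 mW2 E f f0 mf.
under eq_integral do rewrite -(ge0_integral_mscale_dirac W1 g10)//.
under [RHS]eq_integral do rewrite -(ge0_integral_mscale_dirac W2 g20)//.
apply: eq_mixture => //.
- by apply: measurable_mscale => // U mU; exact: measurable_dirac_comp.
- by apply: measurable_mscale => // U mU; exact: measurable_dirac_comp.
- by move=> A mA; rewrite !integral_mscale_dirac//; exact: E.
Qed.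

Lemma integral_density d (T : measurableType d) (R : realType)
    (mu nu : {measure set T -> \bar R}) (f : T -> R) :
  measurable_fun [set: T] f -> (forall x, (0 <= f x)%R) ->
  (forall A, measurable A -> nu A = \int[mu]_(x in A) (f x)%:E) ->
  forall g : T -> \bar R, (forall x, 0 <= g x) -> measurable_fun [set: T] g ->
  \int[nu]_x g x = \int[mu]_x ((f x)%:E * g x).
Proof.
move=> mf f0 nuE g g0 mg.
rewrite -(@eq_weighted_image _ _ _ _ _ _ R nu _ (cst 1%R) _ id)//.
- by apply: eq_integral => x _; rewrite mul1e.
- by move=> A mA; rewrite -nuE// integral_one.
Qed.

Section density_measure.
Context d (T : measurableType d) (R : realType).
Variables (mu : {measure set T -> \bar R}) (f : T -> R).
Hypotheses (mf : measurable_fun [set: T] f) (f0 : forall x, (0 <= f x)%R).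

Definition density_measure : {measure set T -> \bar R} :=
  mixture mu (measurable_mscale mf f0 (fun U mU =>
    measurable_dirac_comp (@measurable_id _ T setT) mU)).

Lemma density_measureE A : measurable A ->
  density_measure A = \int[mu]_(x in A) (f x)%:E.
Proof. by move=> mA; rewrite -(integral_mscale_dirac id f0). Qed.

Lemma ge0_integral_density_measure (g : T -> \bar R) :
  (forall x, 0 <= g x) -> measurable_fun [set: T] g ->
  \int[density_measure]_x g x = \int[mu]_x ((f x)%:E * g x).
Proof.
exact: (@integral_density _ _ _ mu density_measure _ mf f0 density_measureE).
Qed.

End density_measure.

Lemma ge0_integral_image d d' (Y : measurableType d) (Z : measurableType d')
    (R : realType) (m : {measure set Y -> \bar R}) (mu : {measure set Z -> \bar R})
    (W : Y -> Z) :
  measurable_fun [set: Y] W ->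
  (forall A, measurable A -> m (W @^-1` A) = mu A) ->
  forall f : Z -> \bar R, (forall z, 0 <= f z) -> measurable_fun [set: Z] f ->
  \int[m]_y f (W y) = \int[mu]_z f z.
Proof.
move=> mW mE f f0 mf.
transitivity (\int[m]_y ((cst 1%R y)%:E * f (W y))).
  by apply: eq_integral => y _; rewrite mul1e.
transitivity (\int[mu]_z ((cst 1%R z)%:E * f z)); last first.
  by apply: eq_integral => z _; rewrite mul1e.
apply: (@eq_weighted_image _ _ _ Y Z Z R m mu (cst 1%R) (cst 1%R) W id) => //.
move=> A mA; rewrite !integral_one// ?mE//.
by rewrite -[X in measurable X]setTI; exact: mW.
Qed.

(** * Bounded measurable functions *)

Section bounded_measurable.
Local Open Scope ring_scope.
Context d (T : measurableType d) (R : realType).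
Implicit Types f g : T -> R.

Definition bmfun f :=
  measurable_fun [set: T] f /\ exists C, forall x, `|f x| <= C.

Lemma bm_cst (r : R) : bmfun (fun=> r).
Proof. by split; [exact: measurable_cst|exists `|r|]. Qed.

Lemma bmD f g : bmfun f -> bmfun g -> bmfun (f + g).
Proof.
move=> [mf [C fC]] [mg [D gD]]; split; first exact: measurable_funD.
by exists (C + D) => x; rewrite (le_trans (ler_normD _ _))// lerD.
Qed.

Lemma bmM f g : bmfun f -> bmfun g -> bmfun (f \* g).
Proof.
move=> [mf [C fC]] [mg [D gD]]; split; first exact: measurable_funM.
by exists (C * D) => x; rewrite normrM ler_pM.
Qed.

Lemma bmZ (r : R) f : bmfun f -> bmfun (r *: f).
Proof. exact/bmM/bm_cst. Qed.

Lemma bmN f : bmfun f -> bmfun (- f).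
Proof. by move=> bf; rewrite -scaleN1r; exact: bmZ. Qed.

Lemma bmB f g : bmfun f -> bmfun g -> bmfun (f - g).
Proof. by move=> bf bg; apply: bmD => //; exact: bmN. Qed.

Lemma bm_sum (I : Type) (s : seq I) (P : pred I) (F : I -> T -> R) :
  (forall i, P i -> bmfun (F i)) -> bmfun (\sum_(i <- s | P i) F i).
Proof. by move=> bF; elim/big_ind: _ => //; [exact: bm_cst|exact: bmD]. Qed.

Lemma bm_comp d' (T' : measurableType d') (f : T' -> R) (h : T -> T') :
  measurable_fun [set: T] h ->
  measurable_fun [set: T'] f /\ (exists C, forall x, `|f x| <= C) ->
  bmfun (f \o h).
Proof.
by move=> mh [mf [C fC]]; split; [exact: measurableT_comp|exists C => x; exact: fC].
Qed.

(** A bounded function is a difference of two non-negative bounded functions, so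
    identities between integrals extend from the latter to the former. *)
Lemma bm_pos_ext (L : (T -> R) -> R) :
  (forall f g, bmfun f -> bmfun g -> L (f - g) = L f - L g) ->
  (forall f, bmfun f -> (forall x, 0 <= f x) -> L f = 0) ->
  forall f, bmfun f -> L f = 0.
Proof.
move=> LB L0 f bf; have [_ [C fC]] := bf.
have bC := bm_cst `|C|; have bfC := bmD bf bC.
rewrite -[f](addrK (fun=> `|C|)) LB// !L0 ?subr0// => x.
rewrite -[leRHS]/(f x + `|C|) -lerBlDr sub0r.
have := fC x; rewrite ler_norml => /andP[+ _]; apply: le_trans.
by rewrite lerN2 ler_norm.
Qed.

Lemma bm_integrable (mu : {measure set T -> \bar R}) f :
  (mu setT < +oo)%E -> bmfun f -> mu.-integrable setT (EFin \o f).
Proof.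
move=> muT [mf [C fC]]; apply: measurable_bounded_integrable => //.
exists C; split; first exact: num_real.
by move=> x Cx y _; exact: le_trans (fC y) (ltW Cx).
Qed.

Section integral.
Variable mu : {measure set T -> \bar R}.
Hypothesis muT : (mu setT < +oo)%E.

Lemma bm_RintegralD f g : bmfun f -> bmfun g ->
  \int[mu]_x (f + g) x = \int[mu]_x f x + \int[mu]_x g x.
Proof. by move=> bf bg; rewrite RintegralD//; exact: bm_integrable. Qed.

Lemma bm_RintegralB f g : bmfun f -> bmfun g ->
  \int[mu]_x (f - g) x = \int[mu]_x f x - \int[mu]_x g x.
Proof. by move=> bf bg; rewrite RintegralB//; exact: bm_integrable. Qed.

Lemma bm_RintegralZ r f : bmfun f ->
  \int[mu]_x (r *: f) x = r * \int[mu]_x f x.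
Proof. by move=> bf; rewrite RintegralZl//; exact: bm_integrable. Qed.

Lemma bm_le_Rintegral f g : bmfun f -> bmfun g -> (forall x, f x <= g x) ->
  \int[mu]_x f x <= \int[mu]_x g x.
Proof. by move=> bf bg fg; apply: le_Rintegral => //; exact: bm_integrable. Qed.

Lemma bm_EFin_Rintegral f : bmfun f ->
  (\int[mu]_x f x)%:E = (\int[mu]_x (f x)%:E)%E.
Proof.
by move=> bf; rewrite fineK//; apply: integrable_fin_num => //; exact: bm_integrable.
Qed.

Lemma bm_Rintegral_sum (I : Type) (s : seq I) (F : I -> T -> R) :
  (forall i, bmfun (F i)) ->
  \int[mu]_x (\sum_(i <- s) F i) x = \sum_(i <- s) \int[mu]_x F i x.
Proof.
move=> bF; elim: s => [|i s ih].
  by rewrite !big_nil /Rintegral integral0_eq.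
by rewrite !big_cons bm_RintegralD ?ih//; exact: bm_sum.
Qed.

Definition inner f g := \int[mu]_x (f x * g x).

Lemma innerC f g : inner f g = inner g f.
Proof. by apply: eq_Rintegral => x _; rewrite mulrC. Qed.

Lemma inner_ge0 f : 0 <= inner f f.
Proof. by apply: Rintegral_ge0 => x _; rewrite -expr2 sqr_ge0. Qed.

Lemma innerDl f g h : bmfun f -> bmfun g -> bmfun h ->
  inner (f + g) h = inner f h + inner g h.
Proof.
move=> bf bg bh; rewrite -(bm_RintegralD (bmM bf bh) (bmM bg bh)).
by apply: eq_Rintegral => x _; rewrite mulrDl.
Qed.

Lemma innerZl r f h : bmfun f -> bmfun h -> inner (r *: f) h = r * inner f h.
Proof.
move=> bf bh; rewrite -(bm_RintegralZ r (bmM bf bh)).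
by apply: eq_Rintegral => x _; rewrite -mulrA.
Qed.

Lemma innerBl f g h : bmfun f -> bmfun g -> bmfun h ->
  inner (f - g) h = inner f h - inner g h.
Proof.
move=> bf bg bh; rewrite -scaleN1r innerDl ?innerZl ?mulN1r//.
exact: bmZ.
Qed.

Lemma innerDr f g h : bmfun f -> bmfun g -> bmfun h ->
  inner h (f + g) = inner h f + inner h g.
Proof. by move=> *; rewrite !(innerC h) innerDl. Qed.

Lemma innerZr r f h : bmfun f -> bmfun h -> inner h (r *: f) = r * inner h f.
Proof. by move=> *; rewrite !(innerC h) innerZl. Qed.

Lemma innerBr f g h : bmfun f -> bmfun g -> bmfun h ->
  inner h (f - g) = inner h f - inner h g.
Proof. by move=> *; rewrite !(innerC h) innerBl. Qed.

Lemma inner_suml (I : Type) (s : seq I) (P : pred I) (F : I -> T -> R) h :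
  (forall i, P i -> bmfun (F i)) -> bmfun h ->
  inner (\sum_(i <- s | P i) F i) h = \sum_(i <- s | P i) inner (F i) h.
Proof.
move=> bF bh; elim: s => [|i s ih]; last first.
  rewrite !big_cons; case: ifPn => // Pi; rewrite innerDl ?ih//; first exact: bF.
  exact: bm_sum.
by rewrite !big_nil -[X in inner X h](scale0r h) innerZl// mul0r.
Qed.

Lemma inner_sumr (I : Type) (s : seq I) (P : pred I) (F : I -> T -> R) h :
  (forall i, P i -> bmfun (F i)) -> bmfun h ->
  inner h (\sum_(i <- s | P i) F i) = \sum_(i <- s | P i) inner h (F i).
Proof.
by move=> *; rewrite innerC inner_suml//; apply: eq_bigr => i _; rewrite innerC.
Qed.

(** Expand the inner squares of f + g and f - g. *)
Lemma inner_young f g : bmfun f -> bmfun g ->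
  2 * `|inner f g| <= inner f f + inner g g.
Proof.
move=> bf bg; have := inner_ge0 (f + g); have := inner_ge0 (f - g).
rewrite !(innerBl, innerDl, innerBr, innerDr)//; try exact: bmB; try exact: bmD.
rewrite (innerC g f) => h1 h2; have : `|inner f g| <= (inner f f + inner g g) / 2.
  by rewrite ler_norml; apply/andP; split; lra.
lra.
Qed.

End integral.

End bounded_measurable.

Local Close Scope ereal_scope.

(** * Reversible kernels on bounded functions *)

Section kernel_operator.
Context d (E : measurableType d) (R : realType) (k : R.-pker E ~> E).
Implicit Types f g : E -> R.

(** The action of k on functions. Bounded functions are used pointwise rather
    than as classes in L^2, which avoids quotients by null sets. *)
Definition kop f : E -> R := fun z => \int[k z]_y f y.

Let kT z : (k z setT < +oo)%E.
Proof. by rewrite prob_kernel ltry. Qed.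

Lemma kop_cst (r : R) : kop (fun=> r) = fun=> r.
Proof. by apply/funext => z; rewrite /kop Rintegral_cst//= prob_kernel mulr1. Qed.

Lemma kopD f g : bmfun f -> bmfun g -> kop (f + g) = kop f + kop g.
Proof. by move=> bf bg; apply/funext => z; exact: bm_RintegralD. Qed.

Lemma kopB f g : bmfun f -> bmfun g -> kop (f - g) = kop f - kop g.
Proof. by move=> bf bg; apply/funext => z; exact: bm_RintegralB. Qed.

Lemma kopZ (r : R) f : bmfun f -> kop (r *: f) = r *: kop f.
Proof. by move=> bf; apply/funext => z; exact: bm_RintegralZ. Qed.

Lemma le_kop f g z : bmfun f -> bmfun g -> (forall x, f x <= g x) ->
  kop f z <= kop g z.
Proof. exact: bm_le_Rintegral. Qed.

Lemma bm_kop f : bmfun f -> bmfun (kop f).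
Proof.
move=> bf; have [mf [C fC]] := bf; split; last first.
  exists C => z; rewrite ler_norml; apply/andP; split.
    rewrite -[leLHS](congr1 (@^~ z) (kop_cst (- C))); apply: le_kop => //.
      exact: bm_cst.
    by move=> x; have := fC x; rewrite ler_norml => /andP[].
  rewrite -[leRHS](congr1 (@^~ z) (kop_cst C)); apply: le_kop => //.
    exact: bm_cst.
  by move=> x; have := fC x; rewrite ler_norml => /andP[].
have bC := @bm_cst _ E R C.
rewrite (_ : kop f = kop (f + (fun=> C)) - (fun=> C)); last first.
  by rewrite kopD// kop_cst addrK.
apply: measurable_funB; last exact: measurable_cst.
apply: (measurableT_comp (fine_measurable measurableT)).
apply: measurable_fun_integral_kernel.
- by move=> U mU; exact: measurable_kernel.
- move=> z; rewrite lee_fin.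
  by have := fC z; rewrite ler_norml => /andP[h _]; rewrite -lerBlDr sub0r.
- by apply/measurable_EFinP; have [] := bmD bf bC.
Qed.

Lemma bm_iter_kop n f : bmfun f -> bmfun (iter n kop f).
Proof. by move=> bf; elim: n => [//|n ih] /=; exact: bm_kop. Qed.

Lemma kop_sum (I : Type) (s : seq I) (F : I -> E -> R) :
  (forall i, bmfun (F i)) ->
  kop (\sum_(i <- s) F i) = \sum_(i <- s) kop (F i).
Proof.
move=> bF; elim: s => [|i s ih].
  by rewrite !big_nil; exact: kop_cst.
by rewrite !big_cons kopD ?ih//; exact: bm_sum.
Qed.

(** Jensen's inequality, from the positivity of k applied to (f - kop f z)^2. *)
Lemma kop_sqr f z : bmfun f -> kop f z ^+ 2 <= kop (f \* f) z.
Proof.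
move=> bf; have bff := bmM bf bf.
have : 0 <= kop (f \* f - (2 * kop f z) *: f + (fun=> kop f z ^+ 2)) z.
  apply: Rintegral_ge0 => x _.
  rewrite -[leRHS]/(f x * f x - 2 * kop f z * f x + kop f z ^+ 2).
  rewrite (_ : _ + _ = (f x - kop f z) ^+ 2); last by ring.
  exact: sqr_ge0.
have b1 := bmZ (2 * kop f z) bf; have b2 := bmB bff b1.
have b3 := @bm_cst _ E R (kop f z ^+ 2).
rewrite (kopD b2 b3) (kopB bff b1) (kopZ _ bf) kop_cst.
rewrite -[X in 0 <= X]/(kop (f \* f) z - 2 * kop f z * kop f z + kop f z ^+ 2).
by rewrite -mulrA -expr2; lra.
Qed.

Section reversible.
Variable pi : probability E R.

Definition reversible := forall f g, bmfun f -> bmfun g ->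
  inner pi f (kop g) = inner pi (kop f) g.

Hypothesis rev : reversible.

Let piT : (pi setT < +oo)%E.
Proof. by rewrite probability_setT ltry. Qed.

Lemma Rintegral_kop f : bmfun f -> \int[pi]_x kop f x = \int[pi]_x f x.
Proof.
move=> bf; have := rev (@bm_cst _ E R 1) bf; rewrite kop_cst /inner.
by under eq_Rintegral do rewrite mul1r; under [RHS]eq_Rintegral do rewrite mul1r.
Qed.

(** Jensen's inequality and the invariance of pi. *)
Lemma inner_kop_le f : bmfun f -> inner pi (kop f) (kop f) <= inner pi f f.
Proof.
move=> bf; have bk := bm_kop bf; have bff := bmM bf bf.
rewrite /inner -(Rintegral_kop bff).
apply: bm_le_Rintegral => //; [exact: bmM|exact: bm_kop|].
by move=> z; rewrite -expr2; exact: kop_sqr.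
Qed.

Lemma norm_inner_kop f : bmfun f -> `|inner pi f (kop f)| <= inner pi f f.
Proof.
move=> bf; have := inner_young piT bf (bm_kop bf).
have := inner_kop_le bf; lra.
Qed.

Lemma inner_iter_kop i j f g : bmfun f -> bmfun g ->
  inner pi (iter i kop f) (iter j kop g) = inner pi f (iter (i + j) kop g).
Proof.
move=> bf bg; elim: i j => [//|i ih] j.
rewrite [iter i.+1 _ _]/= -rev; [|exact: bm_iter_kop|exact: bm_iter_kop].
by rewrite -iterS ih addSnnS.
Qed.

(** The autocovariance at lag n of the stationary chain, for a centred f. *)
Definition acv f n := inner pi f (iter n kop f).

Lemma acv_chain_like f : bmfun f -> chain_like (acv f).
Proof.
move=> bf i; have bi := bm_iter_kop i bf.
have e : acv f i.*2 = inner pi (iter i kop f) (iter i kop f).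
  by rewrite inner_iter_kop// addnn.
split.
  rewrite e /acv -addnn -addnS -inner_iter_kop//; exact: norm_inner_kop.
rewrite e -doubleS /acv -addnn -inner_iter_kop//; exact: inner_kop_le.
Qed.

(** A truncation of (1 - r k)^-1. Finite sums stay within bounded functions, at
    the cost of an error of order r ^+ n. *)
Definition resolvent (r : R) n f := \sum_(i < n) r ^+ i *: iter i kop f.

Lemma bm_resolvent r n f : bmfun f -> bmfun (resolvent r n f).
Proof. by move=> bf; apply: bm_sum => i _; exact/bmZ/bm_iter_kop. Qed.

Lemma resolventE r n f : bmfun f ->
  resolvent r n f - r *: kop (resolvent r n f) = f - r ^+ n *: iter n kop f.
Proof.
move=> bf; rewrite kop_sum => [|i]; last exact/bmZ/bm_iter_kop.
rewrite scaler_sumr.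
under [X in _ - X]eq_bigr => i _.
  rewrite kopZ; last exact: bm_iter_kop.
  by rewrite -iterS scalerA -exprS; over.
rewrite -sumrB; elim: n => [|n ih]; first by rewrite big_ord0 expr0 scale1r subrr.
by rewrite big_ord_recr/= ih addrA subrK.
Qed.

Lemma inner_resolvent r n f : bmfun f ->
  inner pi f (resolvent r n f) = \sum_(i < n) r ^+ i * acv f i.
Proof.
move=> bf; rewrite inner_sumr//; last by move=> i _; exact/bmZ/bm_iter_kop.
by apply: eq_bigr => i _; rewrite innerZr//; exact: bm_iter_kop.
Qed.

Lemma norm_inner_resolvent_iter r n m f : bmfun f -> 0 <= r <= 1 ->
  `|inner pi (resolvent r n f) (iter m kop f)| <= n%:R * acv f 0%N.
Proof.
move=> bf /andP[r0 r1]; rewrite inner_suml//; last 2 first.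
  by move=> i _; exact/bmZ/bm_iter_kop.
  exact: bm_iter_kop.
rewrite (le_trans (ler_norm_sum _ _ _))// mulr_natl -[X in _ *+ X](card_ord n) -sumr_const.
apply: ler_sum => i _; rewrite innerZl//; try exact: bm_iter_kop.
rewrite inner_iter_kop// normrM.
rewrite (le_trans _ (chain_like_norm (i + m) (acv_chain_like bf)))//.
by rewrite ler_piMl// ger0_norm ?exprn_ge0// exprn_ile1.
Qed.

Lemma inner_resolvent_le r n f : bmfun f -> 0 <= r <= 1 ->
  inner pi (resolvent r n f) (resolvent r n f) <= n%:R ^+ 2 * acv f 0%N.
Proof.
move=> bf r01; have /andP[r0 r1] := r01; have bh := bm_resolvent r n bf.
rewrite {1}/resolvent inner_suml//; last by move=> i _; exact/bmZ/bm_iter_kop.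
rewrite expr2 -mulrA mulr_natl -[X in _ *+ X](card_ord n) -sumr_const.
apply: ler_sum => i _; have bi := bm_iter_kop i bf.
rewrite innerZl// innerC (le_trans (ler_norm _))// normrM.
rewrite (le_trans _ (norm_inner_resolvent_iter n i bf r01))//.
by rewrite ler_piMl// ger0_norm ?exprn_ge0// exprn_ile1.
Qed.

Definition qform (r : R) g := inner pi g g - r * inner pi g (kop g).

(** |<g, k g>| <= <g, g>. *)
Lemma qform_ge0 r g : bmfun g -> 0 <= r <= 1 -> 0 <= qform r g.
Proof.
move=> bg /andP[r0 r1]; have := norm_inner_kop bg; have := inner_ge0 pi g.
rewrite /qform ler_norml => g0 /andP[h1 h2]; nra.
Qed.

(** The expansion of the square around h: it is a variational formula when h is an
    approximate resolvent of some f, for then h - r *: kop h is close to f. *)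
Lemma qformB r g h : bmfun g -> bmfun h ->
  qform r (g - h) =
    qform r g - 2 * inner pi g (h - r *: kop h) + inner pi h (h - r *: kop h).
Proof.
move=> bg bh; have bkg := bm_kop bg; have bkh := bm_kop bh.
have bd : bmfun (h - r *: kop h) by apply: bmB => //; exact: bmZ.
rewrite /qform kopB//.
rewrite !(innerBl, innerBr, innerZr)//; try (by apply: bmB); try exact: bmZ.
rewrite (innerC _ h g) (rev bh bg) (innerC _ (kop h) g).
(* With the inner products as variables, ring does not compare integrals up to
   conversion. *)
repeat match goal with |- context [inner ?m ?u ?v] => generalize (inner m u v) end.
by move=> *; ring.
Qed.

End reversible.

End kernel_operator.

(** * Comparison of truncated resolvents *)

Section resolvent_comparison.
Context d (E : measurableType d) (R : realType).
Variables (k1 k2 : R.-pker E ~> E) (pi1 pi2 : probability E R).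
Hypotheses (rev1 : reversible k1 pi1) (rev2 : reversible k2 pi2).
Variable f : E -> R.
Hypotheses (bf : bmfun f) (ff : inner pi1 f f = inner pi2 f f).
Hypothesis transfer : forall g, bmfun g -> exists G,
  [/\ bmfun G, inner pi1 G f = inner pi2 g f &
      forall r : R, 0 <= r <= 1 -> qform k1 pi1 r G <= qform k2 pi2 r g].

(** Up to truncation errors, 2 <G, f> - qform k1 r G is at most the sum for k1 for
    every G, and 2 <h2, f> - qform k2 r h2 is the sum for k2 if h2 is the
    truncated resolvent. For the G to which h2 is transferred, the former is at
    least the latter. The errors are r ^+ n times inner products of G, h1 and h2
    with n-fold images of f, which the last term bounds crudely. *)
Lemma resolvent_comparison (r : R) n : 0 <= r <= 1 ->
  \sum_(i < n) r ^+ i * acv k2 pi2 f i <=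
  \sum_(i < n) r ^+ i * acv k1 pi1 f i + n.+1%:R ^+ 2 * r ^+ n * acv k1 pi1 f 0%N.
Proof.
move=> r01; have /andP[r0 r1] := r01.
have piT (pi : probability E R) : (pi setT < +oo)%E by rewrite probability_setT ltry.
pose h1 := resolvent k1 r n f; pose h2 := resolvent k2 r n f.
have bh1 : bmfun h1 by exact: bm_resolvent.
have bh2 : bmfun h2 by exact: bm_resolvent.
have bn (k : R.-pker E ~> E) : bmfun (iter n (kop k) f) by exact: bm_iter_kop.
have [G [bG GfE Gq]] := transfer bh2.
have := qform_ge0 rev1 (bmB bG bh1) r01.
rewrite (qformB rev1)//.
rewrite /h1 (resolventE k1)// -/h1.
have bz (k : R.-pker E ~> E) : bmfun (r ^+ n *: iter n (kop k) f) by exact: bmZ.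
rewrite !(innerBr (piT _))// !(innerZr (piT _))// GfE.
rewrite [inner pi1 h1 f]innerC [inner pi2 h2 f]innerC !inner_resolvent//.
have q2 : qform k2 pi2 r h2 = \sum_(i < n) r ^+ i * acv k2 pi2 f i -
    r ^+ n * inner pi2 h2 (iter n (kop k2) f).
  have bk : bmfun (kop k2 h2) by exact: bm_kop.
  rewrite -inner_resolvent// -/h2 (innerC pi2 f) -(innerZr (piT pi2))//.
  rewrite -(innerBr (piT pi2))// -(resolventE k2)// -/h2.
  by rewrite (innerBr (piT pi2))//; [rewrite (innerZr (piT pi2))|exact: bmZ].
have := Gq _ r01; rewrite q2 => qG.
have c0E : acv k2 pi2 f 0%N = acv k1 pi1 f 0%N by rewrite /acv/= ff.
have a1 := norm_inner_resolvent_iter rev1 n n bf r01.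
have a2 := norm_inner_resolvent_iter rev2 n n bf r01.
have GG : inner pi1 G G <= n%:R ^+ 2 * acv k1 pi1 f 0%N.
  have := Gq 0; rewrite lexx ler01 /qform !mul0r !subr0 => /(_ isT)/le_trans; apply.
  by rewrite -c0E; exact: inner_resolvent_le.
have ii : inner pi1 (iter n (kop k1) f) (iter n (kop k1) f) <= acv k1 pi1 f 0%N.
  rewrite (inner_iter_kop rev1)// addnn.
  by have /andP[] := chain_like_le0 n (acv_chain_like rev1 bf).
have b := inner_young (piT pi1) bG (bn k1).
move: a1 a2 b; rewrite -/h1 -/h2 c0E.
set x1 := inner pi1 h1 _; set x2 := inner pi2 h2 _; set y := inner pi1 G (iter _ _ _).
set c0 := acv k1 pi1 f 0%N in GG ii *.
rewrite !ler_norml => /andP[x11 x12] /andP[x21 x22] b.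
have yb : 2 * y <= (n%:R ^+ 2 + 1) * c0.
  have := ler_norm y; lra.
have rn : 0 <= r ^+ n by rewrite exprn_ge0.
move=> q0.
have : r ^+ n * (2 * y - x1 - x2) <= r ^+ n * (n.+1%:R ^+ 2 * c0).
  by rewrite ler_wpM2l// -natr1; lra.
move: q0 qG; rewrite -/x2; lra.
Qed.

End resolvent_comparison.

(** * Autocovariances of stationary chains *)

Section conditional_law.
Context d d' (Omega : measurableType d) (E : measurableType d') (R : realType).
Variables (P : probability Omega R) (k : R.-pker E ~> E) (W U V : Omega -> E).
Hypotheses (mW : measurable_fun [set: Omega] W)
  (mU : measurable_fun [set: Omega] U) (mV : measurable_fun [set: Omega] V).
Hypothesis WUV : forall A B, measurable A -> measurable B ->
  P (W @^-1` A `&` V @^-1` B) = (\int[P]_(w in W @^-1` A) k (U w) B)%E.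

Let PT : (P setT < +oo)%E.
Proof. by rewrite probability_setT ltry. Qed.

Let mpre (X : Omega -> E) A : measurable_fun [set: Omega] X -> measurable A ->
  measurable (X @^-1` A).
Proof. by move=> mX mA; rewrite -[X in measurable X]setTI; exact: mX. Qed.

Let condlaw_set (f : E -> \bar R) A : (forall x, 0 <= f x)%E ->
  measurable_fun [set: E] f -> measurable A ->
  (\int[P]_(w in W @^-1` A) f (V w) =
   \int[P]_(w in W @^-1` A) \int[k (U w)]_y f y)%E.
Proof.
move=> f0 mf mA.
have mI : measurable_fun [set: Omega] (fun w => \1_A (W w) : R).
  exact: measurableT_comp (measurable_indic mA) mW.
have I0 w : 0 <= (\1_A (W w) : R) by [].
have mk B : measurable B -> measurable_fun [set: Omega] (fun w => k (U w) B).
  by move=> mB; apply: (measurableT_comp (measurable_kernel k _ mB) mU).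
have pI (h : Omega -> \bar R) : (\int[P]_(w in W @^-1` A) h w =
    \int[P]_w ((\1_A (W w))%:E * h w))%E.
  rewrite [LHS]integral_mkcond; apply: eq_integral => w _.
  rewrite patchE indicE -[w \in _]/(W w \in A).
  by case: ifPn => _; rewrite ?mul1e ?mul0e.
rewrite !pI.
under eq_integral => w _ do rewrite -(ge0_integral_mscale_dirac V I0)//.
have E2 w : (\int[mscale (NngNum (I0 w)) (k (U w))]_z f z =
    (\1_A (W w))%:E * \int[k (U w)]_z f z)%E by rewrite ge0_integral_mscale.
under [RHS]eq_integral do rewrite -E2.
apply: eq_mixture => //.
- by apply: measurable_mscale => // B mB; exact: measurable_dirac_comp.
- exact: measurable_mscale.
- move=> B mB; rewrite integral_mscale_dirac//.
  transitivity (P (W @^-1` A `&` V @^-1` B)); last by rewrite WUV// pI.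
  by apply: (integral_indic P (mpre mV mB) (mpre mW mA)).
Qed.

Let condlaw_ge0 (u f : E -> R) : bmfun u -> bmfun f ->
  (forall x, 0 <= u x) -> (forall x, 0 <= f x) ->
  \int[P]_w (u (W w) * f (V w)) = \int[P]_w (u (W w) * kop k f (U w)).
Proof.
move=> [mu _] bf u0 f0; have [mf _] := bf; have [mkf _] := bm_kop k bf.
have EE (g : E -> R) (X : Omega -> E) : (\int[P]_w (u (W w) * g (X w))%:E =
    \int[P]_w ((g (X w))%:E * (u (W w))%:E))%E.
  by apply: eq_integral => w _; rewrite -EFinM mulrC.
congr fine; rewrite !EE.
apply: (@eq_weighted_image _ _ _ _ _ E R P P (f \o V) (kop k f \o U) W W _ _ _ _ _ _ _
    (EFin \o u)) => //.
- exact: measurableT_comp.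
- by move=> w; exact: f0.
- exact: measurableT_comp.
- by move=> w; apply: Rintegral_ge0 => x _; exact: f0.
- move=> A mA; rewrite (condlaw_set (f := EFin \o f))//; last exact/measurable_EFinP.
  apply: eq_integral => w _; rewrite -bm_EFin_Rintegral//.
  by rewrite prob_kernel ltry.
- exact/measurable_EFinP.
Qed.

(** Given U, the law of V is k U when tested against functions of W. For W an
    arbitrary past state, U the present one and V the next one, this is as much
    of the Markov property as autocovariances require. *)
Lemma conditional_law (u f : E -> R) : bmfun u -> bmfun f ->
  \int[P]_w (u (W w) * f (V w)) = \int[P]_w (u (W w) * kop k f (U w)).
Proof.
move=> bu bf.
have split_pos (g : E -> R) : bmfun g -> exists C, 0 <= C /\ (forall x, 0 <= g x + C).
  move=> [_ [C gC]]; exists C; split=> [|x]; first exact: le_trans (gC point).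
  by have := gC x; rewrite ler_norml => /andP[h _]; rewrite -lerBlDr sub0r.
have [C [C0 uC]] := split_pos u bu; have [D [D0 fD]] := split_pos f bf.
have bC := @bm_cst _ E R C; have bD := @bm_cst _ E R D.
have bcomp (g : E -> R) (X : Omega -> E) : measurable_fun [set: Omega] X ->
  bmfun g -> bmfun (g \o X) by move=> mX bg; exact: bm_comp.
have e1 := condlaw_ge0 (bmD bu bC) (bmD bf bD) uC fD.
have e2 := condlaw_ge0 bC (bmD bf bD) (fun=> C0) fD.
(* u g is (u + C) (g + D) - C (g + D) - ((u + C) D - C D); the two terms
   that involve g have non-negative factors if g is f or kop k f. *)
have key (g : E -> R) (X : Omega -> E) : measurable_fun [set: Omega] X -> bmfun g ->
  \int[P]_w (u (W w) * g (X w)) =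
    \int[P]_w ((u + (fun=> C)) (W w) * (g + (fun=> D)) (X w))
  - \int[P]_w (C * (g + (fun=> D)) (X w))
  - (\int[P]_w ((u + (fun=> C)) (W w) * D) - \int[P]_w (C * D)).
  move=> mX bg.
  have b1 := bcomp _ _ mW (bmD bu bC); have b2 := bcomp _ _ mX (bmD bg bD).
  have bC' := @bm_cst _ Omega R C; have bD' := @bm_cst _ Omega R D.
  rewrite -(bm_RintegralB PT (bmM b1 b2) (bmM bC' b2)).
  rewrite -(bm_RintegralB PT (bmM b1 bD') (bmM bC' bD')).
  rewrite -bm_RintegralB//; try by apply: bmB; exact: bmM.
  apply: eq_Rintegral => w _.
  rewrite -[RHS]/((u (W w) + C) * (g (X w) + D) - C * (g (X w) + D)
    - ((u (W w) + C) * D - C * D)); ring.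
rewrite (key f V mV bf) (key (kop k f) U mU (bm_kop k bf)).
by rewrite kopD// kop_cst in e1 e2; rewrite e1 e2.
Qed.

End conditional_law.

Section square_integrable.
Context d (T : measurableType d) (R : realType).
Implicit Types f g : T -> R.

(** Measurability is recorded as well since that of the square does not imply
    it. *)
Definition sqint (mu : {measure set T -> \bar R}) f :=
  measurable_fun [set: T] f /\ mu.-integrable setT (fun x => (f x ^+ 2)%:E).

(** 2 |f g| <= f^2 + g^2. *)
Lemma sqint_mul mu f g : sqint mu f -> sqint mu g ->
  mu.-integrable setT (fun x => (f x * g x)%:E).
Proof.
move=> [mf f2] [mg g2]; have := integrableD measurableT f2 g2.
apply: le_integrable => //.
  by apply/measurable_EFinP; exact: measurable_funM.
move=> x _ /=; rewrite lee_fin [leRHS]ger0_norm ?addr_ge0 ?sqr_ge0//.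
rewrite ler_norml; apply/andP; split.
  have := sqr_ge0 (f x + g x); have := sqr_ge0 (f x); have := sqr_ge0 (g x); lra.
have := sqr_ge0 (f x - g x); have := sqr_ge0 (f x); have := sqr_ge0 (g x); lra.
Qed.

Lemma sqint_cst (mu : {measure set T -> \bar R}) (r : R) :
  (mu setT < +oo)%E -> sqint mu (fun=> r).
Proof.
move=> muT; split; first exact: measurable_cst.
exact: bm_integrable muT (@bm_cst _ T R (r ^+ 2)).
Qed.

Lemma sqint_integrable (mu : {measure set T -> \bar R}) f : (mu setT < +oo)%E -> sqint mu f ->
  mu.-integrable setT (EFin \o f).
Proof.
move=> muT sf; have := sqint_mul sf (sqint_cst 1 muT).
by apply: eq_integrable => // x _; rewrite mulr1.
Qed.

Lemma sqintB mu f g : sqint mu f -> sqint mu g -> sqint mu (f - g).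
Proof.
move=> sf sg; have [mf f2] := sf; have [mg g2] := sg.
split; first exact: measurable_funB.
have := integrableD measurableT f2 (integrableD measurableT g2
  (integrableZl measurableT (- 2) (sqint_mul sf sg))).
apply: eq_integrable => // x _.
by rewrite -EFinM -!EFinD; congr EFin; rewrite -[RHS]/((f x - g x) ^+ 2); ring.
Qed.

Definition trunc (n : nat) f x := Num.max (- n%:R) (Num.min (f x) n%:R).

Lemma trunc_norm n f x : `|trunc n f x| <= n%:R.
Proof.
rewrite /trunc ler_norml; apply/andP; split; first by rewrite le_max lexx.
by rewrite ge_max ge_min lexx orbT andbT; have := ler0n R n; lra.
Qed.

Lemma bm_trunc n f : measurable_fun [set: T] f -> bmfun (trunc n f).
Proof.
move=> mf; split; last by exists n%:R => x; exact: trunc_norm.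
by apply: measurable_maxr => //; exact: measurable_minr.
Qed.

Lemma norm_trunc_le n f x : `|trunc n f x| <= `|f x|.
Proof.
have n0 := ler0n R n; rewrite /trunc.
have [h|h] := leP (f x) n%:R; last first.
  rewrite max_r; last by lra.
  by rewrite ger0_norm// ger0_norm; lra.
have [h'|h'] := leP (- n%:R) (f x) => //.
by rewrite normrN ger0_norm// ltr0_norm; lra.
Qed.

Lemma cvg_trunc f x : (fun n => trunc n f x) @ \oo --> f x.
Proof.
apply: cvg_near_cst; near=> n; rewrite /trunc.
have fn : `|f x| <= n%:R by near: n; exact: nbhs_infty_ger.
move: fn; rewrite ler_norml => /andP[f1 f2].
by rewrite min_l// max_r.
Unshelve. all: by end_near. Qed.

End square_integrable.

Section stationary_chain.
Context d d' (Omega : measurableType d) (E : measurableType d') (R : realType).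
Variables (P : probability Omega R) (k : R.-pker E ~> E) (pi : probability E R).
Variable Z : nat -> Omega -> E.
Hypothesis rev : reversible k pi.
Hypothesis chainZ : markov_chain P pi (fun z => k z) Z.

Let PT : (P setT < +oo)%E.
Proof. by rewrite probability_setT ltry. Qed.

Let piT : (pi setT < +oo)%E.
Proof. by rewrite probability_setT ltry. Qed.

Lemma measurable_chain i : measurable_fun [set: Omega] (Z i).
Proof. by case: chainZ => mZ _ _; exact: mZ. Qed.

Let bmZi i (f : E -> R) : bmfun f -> bmfun (f \o Z i).
Proof. by apply: bm_comp; exact: measurable_chain. Qed.

(** The Markov property with no constraint on the states other than Z i and Z n. *)
Lemma chain_step i n (u f : E -> R) : (i <= n)%N -> bmfun u -> bmfun f ->
  \int[P]_w (u (Z i w) * f (Z n.+1 w)) = \int[P]_w (u (Z i w) * kop k f (Z n w)).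
Proof.
move=> ij bu bf; apply: conditional_law => //; try exact: measurable_chain.
move=> A B mA mB; have [_ _ mk] := chainZ.
pose A' j := if j == i then A else setT.
have := mk n A' B; rewrite (_ : \bigcap_(_ in _) _ = Z i @^-1` A); last first.
  apply/seteqP; split=> [w /(_ i)|w Aw j _].
    by rewrite /A' eqxx; apply; rewrite /= ltnS.
  by rewrite /A'; case: eqP => [->|].
by apply=> // j; rewrite /A'; case: ifP.
Qed.

Lemma chain_stationary i (f : E -> R) : bmfun f -> \int[P]_w f (Z i w) = \int[pi]_x f x.
Proof.
elim: i f => [|i ih] f bf; last first.
  have := chain_step (leqnn i) (@bm_cst _ E R 1) bf.
  under eq_Rintegral do rewrite mul1r.
  under [RHS]eq_Rintegral do rewrite mul1r.
  by rewrite ih ?Rintegral_kop//; exact: bm_kop.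
pose g : {mfun Omega >-> E} := mfun_Sub (mem_set (measurable_chain 0)).
have -> : \int[pi]_x f x = \int[distribution P g]_x f x.
  congr fine; apply: eq_measure_integral => A mA _.
  by have [_ /(_ _ mA) h _] := chainZ; exact/esym/h.
congr fine; rewrite integral_distribution//.
- by apply/measurable_EFinP; have [] := bf.
- by apply: (bm_integrable PT); exact: bmZi.
Qed.

Lemma chain_acv i n (u f : E -> R) : bmfun u -> bmfun f ->
  \int[P]_w (u (Z i w) * f (Z (i + n) w)) = inner pi u (iter n (kop k) f).
Proof.
move=> bu; elim: n f => [|n ih] f bf.
  by rewrite addn0; exact: (chain_stationary i (bmM bu bf)).
by rewrite addnS chain_step ?leq_addr// ih ?iterSr//; exact: bm_kop.
Qed.

Lemma chain_law i A : measurable A -> P (Z i @^-1` A) = pi A.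
Proof.
move=> mA; have bA : bmfun (\1_A : E -> R).
  split; first exact: measurable_indic.
  by exists 1 => x; rewrite indicE ger0_norm//; case: (_ \in _).
have h := congr1 EFin (chain_stationary i bA); move: h.
rewrite (bm_EFin_Rintegral piT bA) integral_indic// setIT => <-.
rewrite (bm_EFin_Rintegral PT (bmZi i bA)).
rewrite (integral_indic P measurableT (A := Z i @^-1` A)) ?setIT//.
by rewrite -[X in measurable X]setTI; exact: measurable_chain.
Qed.

Lemma ge0_integral_chain i (f : E -> \bar R) : (forall x, 0 <= f x)%E ->
  measurable_fun [set: E] f -> (\int[P]_w f (Z i w) = \int[pi]_x f x)%E.
Proof.
move=> f0 mf.
apply: ge0_integral_image => //; first exact: measurable_chain.
exact: chain_law.
Qed.

Section square_integrable_observable.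
Variable f : E -> R.
Hypothesis sf : sqint pi f.

Lemma sqint_chain i : sqint P (f \o Z i).
Proof.
have [mf /integrableP[mf2 f2]] := sf.
split; first exact: measurableT_comp (measurable_chain i).
apply/integrableP; split.
  exact: measurableT_comp mf2 (measurable_chain i).
rewrite (le_lt_trans _ f2)// (ge0_integral_chain i (f := fun x => `|(f x ^+ 2)%:E|%E))//.
exact: measurableT_comp.
Qed.

Lemma Rintegral_chain i : \int[P]_w f (Z i w) = \int[pi]_x f x.
Proof.
pose g : {mfun Omega >-> E} := mfun_Sub (mem_set (measurable_chain i)).
have -> : \int[pi]_x f x = \int[distribution P g]_x f x.
  by congr fine; apply: eq_measure_integral => A mA _; exact/esym/chain_law.
have [mf _] := sf; congr fine; rewrite integral_distribution//.
- exact/measurable_EFinP.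
- exact: sqint_integrable PT (sqint_chain i).
Qed.

Definition autocov n := \int[P]_w (f (Z 0 w) * f (Z n w)).

(** Dominated convergence. As the left side does not depend on i, the limit does
    not either, which gives stationarity of the covariances; and inequalities
    between autocovariances pass from bounded to square-integrable functions. *)
Lemma cvg_acv_trunc i n :
  (fun r => acv k pi (trunc r f) n) @ \oo -->
  \int[P]_w (f (Z i w) * f (Z (i + n) w)).
Proof.
have [mf _] := sf; have bt r := bm_trunc r mf.
have si := sqint_chain i; have sn := sqint_chain (i + n).
rewrite (_ : (fun r => _) = fun r => \int[P]_w (trunc r f (Z i w) * trunc r f (Z (i + n) w)));
  last by apply/funext => r; rewrite chain_acv.
have ifg := sqint_mul si sn.
apply: fine_cvg; rewrite fineK; last exact: integrable_fin_num ifg.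
have mt r j : measurable_fun [set: Omega] (fun w => trunc r f (Z j w)).
  by have [mt _] := bt r; exact: measurableT_comp (measurable_chain j).
have [] := @dominated_convergence _ _ _ P setT measurableT
  (fun r w => (trunc r f (Z i w) * trunc r f (Z (i + n) w))%:E)
  (fun w => (f (Z i w) * f (Z (i + n) w))%:E)
  (fun w => `|(f (Z i w) * f (Z (i + n) w))%:E|%E) => //.
- by move=> r; apply/measurable_EFinP; exact: measurable_funM.
- exact: measurable_int ifg.
- apply: aeW => w _; apply: cvg_EFin; first exact: nearW.
  by apply: cvgM; exact: cvg_trunc.
- exact: integrable_abse.
- apply: aeW => w r _; rewrite lee_fin !normrM.
  by rewrite ler_pM ?norm_trunc_le.
Qed.

Lemma autocov_shift i n :
  \int[P]_w (f (Z i w) * f (Z (i + n) w)) = autocov n.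
Proof. exact: norm_cvg_unique (@cvg_acv_trunc i n) (@cvg_acv_trunc 0 n). Qed.

Lemma autocov_chain_like : chain_like autocov.
Proof.
have [mf _] := sf; have bt r := bm_trunc r mf.
have c n : (fun r => acv k pi (trunc r f) n) @ \oo --> autocov n := @cvg_acv_trunc 0 n.
move=> i; split.
  apply: (ler_cvg_to (cvg_norm (c i.*2.+1)) (c i.*2)); apply: nearW => r.
  by have [] := acv_chain_like rev (bt r) i.
apply: (ler_cvg_to (c i.*2.+2) (c i.*2)); apply: nearW => r.
by have [] := acv_chain_like rev (bt r) i.
Qed.

Lemma autocov_sym i j :
  \int[P]_w (f (Z i w) * f (Z j w)) = autocov (i - j + (j - i))%N.
Proof.
have [ij|/ltnW ji] := leqP i j.
  by rewrite (eqP ij) add0n -(autocov_shift i) subnKC.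
rewrite (eqP ji) addn0 -(autocov_shift j) subnKC//.
by apply: eq_Rintegral => w _; rewrite mulrC.
Qed.

End square_integrable_observable.

(** Expand the square of the centred sum; by stationarity the covariance of two
    terms depends only on the distance of their indices. *)
Lemma scaled_varianceE (f : E -> R) n : sqint pi f ->
  ('V_P[fun w => ((Num.sqrt n%:R)^-1 * \sum_(i < n) f (Z i w))%R])%E =
  (n%:R^-1 * toeplitz_sum (autocov (f - (fun=> \int[pi]_x f x))) n)%:E.
Proof.
move=> sf; have [mf _] := sf.
pose c := \int[pi]_x f x; pose g : E -> R := f - (fun=> c).
have sc := sqint_cst c piT; have sg : sqint pi g by exact: sqintB.
have iZ i := sqint_integrable PT (sqint_chain sf i).
have EZ i : (\int[P]_w (f (Z i w))%:E = c%:E)%E.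
  have fZ := integrable_fin_num measurableT (iZ i).
  by rewrite -[LHS](fineK fZ); congr EFin; exact: Rintegral_chain.
set s := Num.sqrt n%:R.
have EX : ('E_P[fun w => (s^-1 * \sum_(i < n) f (Z i w))%R])%E = (s^-1 * (n%:R * c))%:E.
  rewrite unlock; under eq_integral do rewrite EFinM -sumEFin.
  rewrite integralZl//; last by apply: integrable_sum => // i _; exact: iZ.
  rewrite integral_sum//; last by move=> i; exact: iZ.
  under eq_bigr do rewrite EZ.
  by rewrite sumEFin sumr_const card_ord -EFinM mulr_natl.
have gg i j := sqint_mul (sqint_chain sg i) (sqint_chain sg j).
have Egg i j : (\int[P]_w (g (Z i w) * g (Z j w))%:E =
    (autocov g (i - j + (j - i))%N)%:E)%E.
  have := integrable_fin_num measurableT (gg i j) => /fineK <-.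
  by rewrite -(autocov_sym sg).
rewrite /variance covariance.unlock EX/= expectation.unlock.
transitivity (\int[P]_w ((n%:R^-1)%:E *
    \sum_(i < n) \sum_(j < n) (g (Z i w) * g (Z j w))%:E))%E.
  apply: eq_integral => w _.
  have gE : s^-1 * \sum_(i < n) f (Z i w) - s^-1 * (n%:R * c) =
      s^-1 * \sum_(i < n) g (Z i w).
    rewrite -mulrBr; congr (_ * _).
    rewrite [RHS](eq_bigr (fun i : 'I_n => f (Z i w) - c))//.
    by rewrite sumrB sumr_const card_ord mulr_natl.
  under [in RHS]eq_bigr do rewrite sumEFin.
  rewrite sumEFin -EFinM; congr EFin.
  rewrite -[LHS]/((s^-1 * \sum_(i < n) f (Z i w) - s^-1 * (n%:R * c)) *
    (s^-1 * \sum_(i < n) f (Z i w) - s^-1 * (n%:R * c))) gE.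
  rewrite mulrACA -invfM -expr2 sqr_sqrtr//; congr (_ * _).
  by rewrite mulr_suml; apply: eq_bigr => i _; rewrite mulr_sumr.
rewrite integralZl//; last first.
  by apply: integrable_sum => // i _; apply: integrable_sum => // j _; exact: gg.
rewrite EFinM; congr (_ * _)%E.
rewrite integral_sum//; last by move=> i; apply: integrable_sum => // j _; exact: gg.
rewrite /toeplitz_sum -sumEFin; apply: eq_bigr => i _.
rewrite integral_sum//; last by move=> j; exact: gg.
rewrite -sumEFin; apply: eq_bigr => j _.
exact: Egg.
Qed.

End stationary_chain.

(** * Comparison of asymptotic variances *)

Lemma cvg_sum_ord (R : realType) n (u : 'I_n -> R^nat) (l : 'I_n -> R) :
  (forall i, u i @ \oo --> l i) ->
  (fun j => \sum_(i < n) u i j) @ \oo --> \sum_(i < n) l i.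
Proof. by move=> ul; apply: cvg_big => //; exact: add_continuous. Qed.

Section variance_comparison.
Context dE (E : measurableType dE) (R : realType).
Variables (k1 k2 : R.-pker E ~> E) (pi1 pi2 : probability E R).
Hypotheses (rev1 : reversible k1 pi1) (rev2 : reversible k2 pi2).
Context d1 (Omega1 : measurableType d1) (P1 : probability Omega1 R).
Context d2 (Omega2 : measurableType d2) (P2 : probability Omega2 R).
Variables (Z1 : nat -> Omega1 -> E) (Z2 : nat -> Omega2 -> E).
Hypotheses (chain1 : markov_chain P1 pi1 (fun z => k1 z) Z1)
  (chain2 : markov_chain P2 pi2 (fun z => k2 z) Z2).
Variable f : E -> R.
Hypotheses (sf1 : sqint pi1 f) (sf2 : sqint pi2 f).
Hypothesis meanE : \int[pi1]_x f x = \int[pi2]_x f x.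
Hypothesis transfer : forall (c : R) n, let u := trunc n (f - (fun=> c)) in
  inner pi1 u u = inner pi2 u u /\
  forall g, bmfun g -> exists G, [/\ bmfun G, inner pi1 G u = inner pi2 g u &
    forall r : R, 0 <= r <= 1 -> qform k1 pi1 r G <= qform k2 pi2 r g].

(** Both variances are limits of Toeplitz sums of autocovariances, which are
    limits of those of the truncations of the centred f. For each truncation
    [resolvent_comparison] applies; its conclusion passes to the limit and
    [midsum_lim_le] turns it into an inequality of the variances. *)
Theorem variance_comparison :
  exists v vx : \bar R, [/\
    (fun M => 'V_P2[fun w => ((Num.sqrt M%:R)^-1 * \sum_(i < M) f (Z2 i w))%R])%E @ \oo --> vx,
    (fun M => 'V_P1[fun w => ((Num.sqrt M%:R)^-1 * \sum_(i < M) f (Z1 i w))%R])%E @ \oo --> v &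
    (vx <= v)%E].
Proof.
have piT (pi : probability E R) : (pi setT < +oo)%E by rewrite probability_setT ltry.
set c := \int[pi1]_x f x; pose g : E -> R := f - (fun=> c).
have sg1 : sqint pi1 g := sqintB sf1 (sqint_cst c (piT pi1)).
have sg2 : sqint pi2 g := sqintB sf2 (sqint_cst c (piT pi2)).
have bt n : bmfun (trunc n g) by apply: bm_trunc; have [] := sg1.
pose c1 := autocov P1 Z1 g; pose c2 := autocov P2 Z2 g.
have cc1 : chain_like c1 by exact: autocov_chain_like rev1 chain1 _ sg1.
have cc2 : chain_like c2 by exact: autocov_chain_like rev2 chain2 _ sg2.
have lim1 n : (fun r => acv k1 pi1 (trunc r g) n) @ \oo --> c1 n.
  exact: (cvg_acv_trunc rev1 chain1 sg1 (i := 0)).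
have lim2 n : (fun r => acv k2 pi2 (trunc r g) n) @ \oo --> c2 n.
  exact: (cvg_acv_trunc rev2 chain2 sg2 (i := 0)).
have c0 : c2 0%N = c1 0%N.
  have e : (fun r => acv k2 pi2 (trunc r g) 0%N) = fun r => acv k1 pi1 (trunc r g) 0%N.
    by apply/funext => r; have [e _] := transfer c r; rewrite /acv/= e.
  by have := lim2 0%N; rewrite e => /norm_cvg_unique; apply; exact: lim1.
have [l1 ml1] := midsum_cvg cc1; have [l2 ml2] := midsum_cvg cc2.
exists (2%:E * l1 - (c1 0%N)%:E)%E, (2%:E * l2 - (c2 0%N)%:E)%E; split.
- under eq_fun do rewrite (scaled_varianceE rev2 chain2 _ sf2) -meanE.
  exact: toeplitz_sum_cvg.
- under eq_fun do rewrite (scaled_varianceE rev1 chain1 _ sf1).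
  exact: toeplitz_sum_cvg.
rewrite c0 leeD2r// lee_pmul2l//.
apply: (midsum_lim_le cc1 cc2 c0 _ ml1 ml2) => r n /andP[r0 r1].
have r01 : 0 <= r <= 1 by rewrite !ltW.
have s1 : (fun j => \sum_(i < n) r ^+ i * acv k1 pi1 (trunc j g) i +
    n.+1%:R ^+ 2 * r ^+ n * acv k1 pi1 (trunc j g) 0%N) @ \oo -->
    \sum_(i < n) r ^+ i * c1 i + n.+1%:R ^+ 2 * r ^+ n * c1 0%N.
  apply: cvgD; last exact: cvgMl_tmp.
  by apply: cvg_sum_ord => i; exact: cvgMl_tmp.
have s2 : (fun j => \sum_(i < n) r ^+ i * acv k2 pi2 (trunc j g) i) @ \oo -->
    \sum_(i < n) r ^+ i * c2 i.
  by apply: cvg_sum_ord => i; exact: cvgMl_tmp.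
apply: (ler_cvg_to s2 s1); apply: nearW => j.
have [e tr] := transfer c j.
exact: (resolvent_comparison rev1 rev2 (bt j) e tr n r01).
Qed.

End variance_comparison.

(** * Metropolis-Hastings kernels *)

Lemma measurable_funV d (T : measurableType d) (R : realType) (f : T -> R) :
  measurable_fun [set: T] f -> (forall x, 0 <= f x) ->
  measurable_fun [set: T] (fun x => (f x)^-1).
Proof.
move=> mf f0; under eq_fun do rewrite -powR_inv1//.
exact: measurableT_comp (measurable_powR _) mf.
Qed.

Section metropolis_hastings.
Context d (E : measurableType d) (R : realType).
Variables (mu : {sigma_finite_measure set E -> \bar R}) (kap : E * E -> R).
Hypotheses (mkap : measurable_fun [set: E * E] kap) (kap0 : forall p, 0 <= kap p).
Hypothesis kap1 : forall z, (\int[mu]_y (kap (z, y))%:E = 1)%E.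
Variable e : E -> R.
Hypotheses (me : measurable_fun [set: E] e) (e0 : forall z, 0 <= e z).

Definition mh_accept (p : E * E) : R :=
  Num.min 1 (e p.2 * kap (p.2, p.1) / (e p.1 * kap p)).

(** The density of accepted moves in stationarity. *)
Definition mh_flow (p : E * E) : R :=
  Num.min (e p.1 * kap p) (e p.2 * kap (p.2, p.1)).

(** Only measurable sets are considered, outside of which the integral need not
    be the value of a kernel. *)
Definition is_mh (k : E -> set E -> \bar R) := forall z A, measurable A ->
  k z A = (\int[mu]_y (kap (z, y) * (mh_accept (z, y) * \1_A y
                                  + (1 - mh_accept (z, y)) * \1_A z))%:E)%E.

Lemma mh_accept01 p : 0 <= mh_accept p <= 1.
Proof.
by rewrite /mh_accept ge_min lexx andbT le_min ler01/= mulr_ge0 ?invr_ge0 ?mulr_ge0.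
Qed.

Let accept0 p : 0 <= mh_accept p. Proof. by case/andP: (mh_accept01 p). Qed.

Let reject0 p : 0 <= 1 - mh_accept p.
Proof. by rewrite subr_ge0; case/andP: (mh_accept01 p). Qed.

(** Since x / 0 = 0, this also holds where e p.1 * kap p vanishes. *)
Lemma mh_flowE p : e p.1 * kap p * mh_accept p = mh_flow p.
Proof.
rewrite /mh_accept /mh_flow; set a := e p.1 * kap p.
have [->|a_neq0] := eqVneq a 0; first by rewrite mul0r min_l// mulr_ge0.
have a_gt0 : 0 < a by rewrite lt0r a_neq0 mulr_ge0.
by rewrite minr_pMr ?(ltW a_gt0)// mulr1 [a * _]mulrC divfK.
Qed.

Lemma mh_flow0 p : 0 <= mh_flow p.
Proof. by rewrite le_min !mulr_ge0. Qed.

Lemma mh_flow_swap p : mh_flow (p.2, p.1) = mh_flow p.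
Proof. by rewrite /mh_flow minC -surjective_pairing. Qed.

Let mswap : measurable_fun [set: E * E] (fun p => kap (p.2, p.1)).
Proof. exact: (measurableT_comp mkap (@measurable_swap _ _ E E)). Qed.

Let mp1 : measurable_fun [set: E * E] (fun p => e p.1 * kap p).
Proof.
by apply: measurable_funM => //; exact: (measurableT_comp me measurable_fst).
Qed.

Let mp2 : measurable_fun [set: E * E] (fun p => e p.2 * kap (p.2, p.1)).
Proof.
by apply: measurable_funM => //; exact: (measurableT_comp me measurable_snd).
Qed.

Lemma measurable_mh_flow : measurable_fun [set: E * E] mh_flow.
Proof. exact: measurable_minr. Qed.

Lemma measurable_mh_accept : measurable_fun [set: E * E] mh_accept.
Proof.
apply: measurable_minr; first exact: measurable_cst.
apply: measurable_funM => //; apply: measurable_funV => // p.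
by rewrite mulr_ge0.
Qed.

Let w1 p := kap p * mh_accept p.
Let w2 p := kap p * (1 - mh_accept p).

Let mw1 : measurable_fun [set: E * E] w1.
Proof. by apply: measurable_funM => //; exact: measurable_mh_accept. Qed.

Let mw2 : measurable_fun [set: E * E] w2.
Proof.
apply: measurable_funM => //; apply: measurable_funB => //.
exact: measurable_mh_accept.
Qed.

Let w10 p : 0 <= w1 p. Proof. exact: mulr_ge0. Qed.
Let w20 p : 0 <= w2 p. Proof. exact: mulr_ge0. Qed.

Let mstep z y : {measure set E -> \bar R} :=
  measure_add (mscale (NngNum (w10 (z, y))) (\d_y))
              (mscale (NngNum (w20 (z, y))) (\d_z)).

Let mstepE z y A : mstep z y A =
  (kap (z, y) * (mh_accept (z, y) * \1_A y + (1 - mh_accept (z, y)) * \1_A z))%:E.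
Proof.
have -> : mstep z y A = ((w1 (z, y))%:E * \d_y A + (w2 (z, y))%:E * \d_z A)%E.
  exact: measure_addE.
rewrite !diracE -!EFinM -EFinD.
by congr EFin; rewrite /w1 /w2 !indicE; ring.
Qed.

Let mmstep U : measurable U -> measurable_fun [set: E * E] (fun p => mstep p.1 p.2 U).
Proof.
move=> mU; under eq_fun do rewrite mstepE.
have eta (F : E * E -> R) : (fun p => F (p.1, p.2)) = F by apply/funext => -[].
apply/measurable_EFinP; apply: measurable_funM; first by rewrite (eta kap).
have mI : measurable_fun [set: E] (\1_U : E -> R) by exact: measurable_indic.
have ma : measurable_fun [set: E * E] (fun p => mh_accept (p.1, p.2)).
  by rewrite (eta mh_accept); exact: measurable_mh_accept.
apply: measurable_funD; apply: measurable_funM => //.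
- exact: (measurableT_comp mI measurable_snd).
- exact: measurable_funB.
- exact: (measurableT_comp mI measurable_fst).
Qed.

Let mmstepz z U : measurable U -> measurable_fun [set: E] (fun y => mstep z y U).
Proof. by move=> mU; exact: (measurable_fun_pair2 z (mmstep mU)). Qed.

Lemma ge0_integral_mh (k : R.-pker E ~> E) (z : E) (g : E -> \bar R) :
  is_mh (fun z => k z) -> (forall x, 0 <= g x)%E -> measurable_fun [set: E] g ->
  (\int[k z]_x g x =
   \int[mu]_y ((w1 (z, y))%:E * g y + (w2 (z, y))%:E * g z))%E.
Proof.
move=> kmh g0 mg.
rewrite (@integral_mixture _ _ _ _ _ mu (mstep z) (mmstepz z) (k z) _ g)//.
  apply: eq_integral => y _; rewrite ge0_integral_measure_add//.
  rewrite !ge0_integral_mscale// !integral_dirac//.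
  by rewrite !diracT !mul1e.
by move=> A mA; rewrite kmh//; apply: eq_integral => y _; rewrite mstepE.
Qed.

Lemma mh_kernel_exists : exists k : R.-pker E ~> E, is_mh (fun z => k z).
Proof.
pose k0 z : {measure set E -> \bar R} := mixture mu (mmstepz z).
have mk : forall U, measurable U -> measurable_fun [set: E] (k0 ^~ U).
  move=> U mU.
  have := @measurable_fun_fubini_tonelli_F _ _ E E R mu
    (fun p => mstep p.1 p.2 U) (mmstep mU).
  by apply=> p; exact: measure_ge0.
have k1 z : k0 z setT = 1%E.
  rewrite -[RHS](kap1 z); apply: eq_integral => y _.
  by rewrite mstepE !indicE !in_setT !mulr1 addrC subrK mulr1.
pose K := @isKernel.Build _ _ E E R k0 mk.
pose kk : R.-ker E ~> E := HB.pack k0 K.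
pose Kp := @Kernel_isProbability.Build _ _ E E R kk k1.
pose kp : R.-pker E ~> E := HB.pack k0 K Kp.
exists kp => z A mA; apply: eq_integral => y _; exact: mstepE.
Qed.

Definition mh_reject (p : E * E) : R := e p.1 * kap p * (1 - mh_accept p).

Lemma mh_reject0 p : 0 <= mh_reject p.
Proof. by rewrite mulr_ge0// mulr_ge0. Qed.

Lemma measurable_mh_reject : measurable_fun [set: E * E] mh_reject.
Proof.
apply: measurable_funM => //; apply: measurable_funB => //.
exact: measurable_mh_accept.
Qed.

Definition flow_measure := density_measure (mu \x mu)%E measurable_mh_flow mh_flow0.

Definition reject_measure :=
  density_measure (mu \x mu)%E measurable_mh_reject mh_reject0.

Lemma flow_measure_swap (F : E * E -> \bar R) : (forall p, 0 <= F p)%E ->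
  measurable_fun [set: E * E] F ->
  (\int[flow_measure]_p F p = \int[flow_measure]_p F (p.2, p.1))%E.
Proof.
move=> F0 mF; have mFs : measurable_fun [set: E * E] (fun p => F (p.2, p.1)).
  exact: (measurableT_comp mF (@measurable_swap _ _ E E)).
have mr : measurable_fun [set: E * E] (fun p => (mh_flow p)%:E).
  by apply/measurable_EFinP; exact: measurable_mh_flow.
rewrite !ge0_integral_density_measure//.
have mG : measurable_fun [set: E * E] (fun p => (mh_flow p)%:E * F p)%E.
  exact: emeasurable_funM.
have G0 p : (0 <= (mh_flow p)%:E * F p)%E by rewrite mule_ge0// lee_fin mh_flow0.
rewrite (fubini_tonelli1 _ mG G0) (fubini_tonelli _ mG G0).
rewrite [RHS]fubini_tonelli1.
- apply: eq_integral => y _; apply: eq_integral => z _ /=.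
  congr (_%:E * _)%E; exact: (mh_flow_swap (_, _)).
- exact: emeasurable_funM.
- by move=> p; rewrite mule_ge0// lee_fin mh_flow0.
Qed.

Variables (k : R.-pker E ~> E) (pi : probability E R).
Hypothesis kmh : is_mh (fun z => k z).
Hypothesis piE : forall A, measurable A -> pi A = (\int[mu]_(z in A) (e z)%:E)%E.

(** In stationarity a step either moves, with density [mh_flow], or stays where it
    is, with density [mh_reject]. *)
Lemma ge0_inner_mh (f g : E -> R) :
  measurable_fun [set: E] f -> (forall x, 0 <= f x) ->
  measurable_fun [set: E] g -> (forall x, 0 <= g x) ->
  (\int[pi]_z ((f z)%:E * \int[k z]_y (g y)%:E) =
   \int[flow_measure]_p (f p.1 * g p.2)%:E +
   \int[reject_measure]_p (f p.1 * g p.1)%:E)%E.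
Proof.
move=> mf f0 mg g0.
have mfst (h : E -> R) : measurable_fun [set: E] h ->
    measurable_fun [set: E * E] (fun p => h p.1).
  by move=> mh; exact: (measurableT_comp mh measurable_fst).
have msnd (h : E -> R) : measurable_fun [set: E] h ->
    measurable_fun [set: E * E] (fun p => h p.2).
  by move=> mh; exact: (measurableT_comp mh measurable_snd).
have f1 := mfst _ mf; have g1 := mfst _ mg; have g2 := msnd _ mg.
have mff := measurable_funM f1 g1; have mfg := measurable_funM f1 g2.
rewrite (integral_density me e0 piE); first last.
- apply: emeasurable_funM; first exact/measurable_EFinP.
  apply: measurable_fun_integral_kernel => //.
  + by move=> U mU; exact: measurable_kernel.
  + exact/measurable_EFinP.
- move=> z; rewrite mule_ge0 ?lee_fin//; apply: integral_ge0 => y _.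
  by rewrite lee_fin.
rewrite !ge0_integral_density_measure; first last.
- exact/measurable_EFinP.
- by move=> p; rewrite lee_fin mulr_ge0.
- exact/measurable_EFinP.
- by move=> p; rewrite lee_fin mulr_ge0.
rewrite -ge0_integralD//; first last.
- by apply/measurable_EFinP; apply: measurable_funM => //; exact: measurable_mh_reject.
- by move=> p _; rewrite lee_fin mulr_ge0 ?mh_reject0 ?mulr_ge0.
- by apply/measurable_EFinP; apply: measurable_funM => //; exact: measurable_mh_flow.
- by move=> p _; rewrite lee_fin mulr_ge0 ?mh_flow0 ?mulr_ge0.
rewrite fubini_tonelli1; first last.
- by move=> p; rewrite lee_fin addr_ge0// mulr_ge0 ?mh_flow0 ?mh_reject0 ?mulr_ge0.
- apply/measurable_EFinP; apply: measurable_funD; apply: measurable_funM => //.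
  + exact: measurable_mh_flow.
  + exact: measurable_mh_reject.
apply: eq_integral => z _; rewrite /fubini_F.
rewrite (ge0_integral_mh z kmh); first last.
- exact/measurable_EFinP.
- by move=> x; rewrite lee_fin.
pose H y := w1 (z, y) * g y + w2 (z, y) * g z.
have mH : measurable_fun [set: E] H.
  apply: measurable_funD; apply: measurable_funM => //.
  - exact: (measurable_fun_pair2 z mw1).
  - exact: (measurable_fun_pair2 z mw2).
have H0 y : 0 <= H y by rewrite addr_ge0// mulr_ge0.
transitivity ((e z)%:E * ((f z)%:E * \int[mu]_y (H y)%:E))%E => //.
rewrite -ge0_integralZl//; last 3 first.
- exact/measurable_EFinP.
- by move=> y _; rewrite lee_fin.
- by rewrite lee_fin.
rewrite -ge0_integralZl//; [| | |by rewrite lee_fin].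
- apply: eq_integral => y _.
  rewrite -[LHS]/((e z * (f z * H y))%:E); congr EFin.
  rewrite /= -(mh_flowE (z, y)) /mh_reject /H /w1 /w2 /=; ring.
- by apply/measurable_EFinP; exact: measurable_funM.
- by move=> y _; rewrite lee_fin mulr_ge0.
Qed.

Lemma flow_reject_mass : (flow_measure setT + reject_measure setT = 1)%E.
Proof.
have m1 : measurable_fun [set: E] (fun=> 1 : R) by exact: measurable_cst.
have /= := ge0_inner_mh m1 (fun=> ler01) m1 (fun=> ler01).
under eq_integral do rewrite integral_one// prob_kernel mule1.
by rewrite !mulr1 !integral_one// => <-; exact: probability_setT.
Qed.

Lemma flow_measure_fin : (flow_measure setT < +oo)%E.
Proof.
by apply: (@le_lt_trans _ _ 1%E); [rewrite -flow_reject_mass leeDl|exact: ltry].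
Qed.

Lemma reject_measure_fin : (reject_measure setT < +oo)%E.
Proof.
by apply: (@le_lt_trans _ _ 1%E); [rewrite -flow_reject_mass leeDr|exact: ltry].
Qed.

Let bm1 (f : E -> R) : bmfun f -> bmfun (fun p : E * E => f p.1).
Proof. by move=> bf; exact: (bm_comp measurable_fst bf). Qed.

Let bm2 (f : E -> R) : bmfun f -> bmfun (fun p : E * E => f p.2).
Proof. by move=> bf; exact: (bm_comp measurable_snd bf). Qed.

Let piT : (pi setT < +oo)%E.
Proof. by rewrite probability_setT ltry. Qed.

Lemma inner_mh f g : bmfun f -> bmfun g ->
  inner pi f (kop k g) =
  inner flow_measure (fun p => f p.1) (fun p => g p.2) +
  inner reject_measure (fun p => f p.1) (fun p => g p.1).
Proof.
have flT := flow_measure_fin; have rjT := reject_measure_fin.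
pose B f g := inner pi f (kop k g) -
  (inner flow_measure (fun p => f p.1) (fun p => g p.2) +
   inner reject_measure (fun p => f p.1) (fun p => g p.1)).
suff B0 : forall f, bmfun f -> forall g, bmfun g -> B f g = 0.
  by move=> bf bg; apply/subr0_eq/(B0 f bf g bg).
have regroup (x x' y y' z z' : R) :
    x - x' - (y - y' + (z - z')) = x - (y + z) - (x' - (y' + z')) by ring.
have BBl g0 f1 f2 : bmfun g0 -> bmfun f1 -> bmfun f2 ->
    B (f1 - f2) g0 = B f1 g0 - B f2 g0.
  move=> bg b1 b2; rewrite /B innerBl//; last exact: bm_kop.
  rewrite (innerBl flT (bm1 b1) (bm1 b2) (bm2 bg)).
  rewrite (innerBl rjT (bm1 b1) (bm1 b2) (bm1 bg)); exact: regroup.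
have BBr f0 g1 g2 : bmfun f0 -> bmfun g1 -> bmfun g2 ->
    B f0 (g1 - g2) = B f0 g1 - B f0 g2.
  move=> bf b1 b2; rewrite /B kopB// innerBr//; [|exact: bm_kop|exact: bm_kop].
  rewrite (innerBr flT (bm2 b1) (bm2 b2) (bm1 bf)).
  rewrite (innerBr rjT (bm1 b1) (bm1 b2) (bm1 bf)); exact: regroup.
have B0 f0 g0 : bmfun f0 -> (forall x, 0 <= f0 x) ->
    bmfun g0 -> (forall x, 0 <= g0 x) -> B f0 g0 = 0.
  move=> bf pf bg pg; have [mf _] := bf; have [mg _] := bg.
  have := ge0_inner_mh mf pf mg pg.
  have -> : (\int[pi]_z ((f0 z)%:E * \int[k z]_y (g0 y)%:E) = (inner pi f0 (kop k g0))%:E)%E.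
    rewrite (bm_EFin_Rintegral piT (bmM bf (bm_kop k bg))).
    apply: eq_integral => z _; rewrite EFinM (bm_EFin_Rintegral _ bg)//.
    by rewrite prob_kernel ltry.
  rewrite -(bm_EFin_Rintegral flT (bmM (bm1 bf) (bm2 bg))).
  rewrite -(bm_EFin_Rintegral rjT (bmM (bm1 bf) (bm1 bg))).
  by rewrite -EFinD => -[]; rewrite /B => ->; rewrite subrr.
move=> f0 bf g0 bg; move: f0 bf; apply: bm_pos_ext => [f1 f2 b1 b2|f1 b1 p1].
  exact: BBl.
move: g0 bg; apply: bm_pos_ext => [g1 g2 b3 b4|g1 b3 p3]; first exact: BBr.
exact: B0.
Qed.

Lemma Rintegral_flow_swap (F : E * E -> R) : bmfun F ->
  \int[flow_measure]_p F p = \int[flow_measure]_p F (p.2, p.1).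
Proof.
have flT := flow_measure_fin.
have sw (G : E * E -> R) : bmfun G -> bmfun (fun p => G (p.2, p.1)).
  by move=> bG; exact: (bm_comp (@measurable_swap _ _ E E) bG).
move=> bF; apply/subr0_eq.
move: F bF; apply: bm_pos_ext => [F G bF bG|F bF F0].
  rewrite (bm_RintegralB flT bF bG) (bm_RintegralB flT (sw _ bF) (sw _ bG)); ring.
have [mF _] := bF; rewrite /Rintegral (flow_measure_swap (F := EFin \o F))//.
  by rewrite subrr.
exact/measurable_EFinP.
Qed.

(** The flow is symmetric, and rejected moves stay on the diagonal. *)
Lemma mh_reversible : reversible k pi.
Proof.
move=> f g bf bg; rewrite (innerC _ (kop k f)) !inner_mh//; congr (_ + _).
  rewrite /inner (Rintegral_flow_swap (bmM (bm1 bf) (bm2 bg))).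
  by apply: eq_Rintegral => p _ /=; rewrite mulrC.
by rewrite innerC.
Qed.

(** Rejected moves contribute equally to <g, g> and <g, k g>, so that the
    difference of the two is a Dirichlet form of the flow alone. *)
Lemma mh_qform (r : R) g : bmfun g ->
  qform k pi r g = (1 - r) * inner pi g g +
    r / 2 * \int[flow_measure]_p ((g p.1 - g p.2) ^+ 2).
Proof.
move=> bg; have flT := flow_measure_fin.
have gg : inner pi g g = inner flow_measure (fun p => g p.1) (fun p => g p.1) +
    inner reject_measure (fun p => g p.1) (fun p => g p.1).
  have := inner_mh (bmM bg bg) (@bm_cst _ E R 1); rewrite kop_cst.
  have i1 dX (X : measurableType dX) (m : {measure set X -> \bar R}) (u v : X -> R) :
      inner m (u \* v) (fun=> 1) = inner m u v.
    by apply: eq_Rintegral => x _; rewrite mulr1.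
  by rewrite i1 => ->; congr (_ + _); exact: i1.
have sw : inner flow_measure (fun p => g p.2) (fun p => g p.2) =
    inner flow_measure (fun p => g p.1) (fun p => g p.1).
  by rewrite [RHS](Rintegral_flow_swap (bmM (bm1 bg) (bm1 bg))).
have -> : \int[flow_measure]_p ((g p.1 - g p.2) ^+ 2) =
    inner flow_measure ((fun p => g p.1) - (fun p => g p.2))
                       ((fun p => g p.1) - (fun p => g p.2)).
  by apply: eq_Rintegral => p _; rewrite expr2.
have b1 := bm1 bg; have b2 := bm2 bg; have bd := bmB b1 b2.
rewrite (innerBl flT b1 b2 bd) (innerBr flT b1 b2 b1) (innerBr flT b1 b2 b2).
have alg (x y z : R) :
    x + y - r * (z + y) = (1 - r) * (x + y) + r / 2 * (x - z - (z - x)) by field.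
rewrite sw (innerC _ (fun p => g p.2)) /qform inner_mh// gg.
exact: alg.
Qed.

End metropolis_hastings.

Lemma mh_target_exists d (E : measurableType d) (R : realType)
    (mu : {measure set E -> \bar R}) (e : E -> R) :
  measurable_fun [set: E] e -> (forall z, 0 <= e z) ->
  (\int[mu]_z (e z)%:E = 1)%E ->
  exists pi : probability E R,
    forall A, measurable A -> pi A = (\int[mu]_(z in A) (e z)%:E)%E.
Proof.
move=> me e0 e1; pose pi := density_measure mu me e0.
have pi1 : pi setT = 1%E by rewrite density_measureE.
pose F : set E -> \bar R := pi.
pose Fm := @isMeasure.Build _ E R F (measure0 pi) (measure_ge0 pi)
  (@measure_semi_sigma_additive _ _ _ pi).
pose Fp := @Measure_isProbability.Build _ E R (HB.pack F Fm : {measure set E -> \bar R}) pi1.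
pose pp : probability E R := HB.pack F Fm Fp.
by exists pp => A mA; exact: density_measureE.
Qed.

(** * Averaging the target density *)

Section finite_means.
Context (R : realType) (J : finType).
Hypothesis J0 : (0 < #|J|)%N.

Let c : R := #|J|%:R^-1.

Let cJ : c * #|J|%:R = 1.
Proof. by rewrite mulVf// pnatr_eq0 -lt0n. Qed.

(** Jensen's inequality for the uniform mean, as positivity of the variance. *)
Lemma sqr_mean_le (a : J -> R) : (c * \sum_j a j) ^+ 2 <= c * \sum_j a j ^+ 2.
Proof.
set m := c * \sum_j a j.
have sa : \sum_j a j = #|J|%:R * m by rewrite /m mulrA [_ * c]mulrC cJ mul1r.
have : 0 <= \sum_j (a j - m) ^+ 2 by apply: sumr_ge0 => j _; exact: sqr_ge0.
have -> : \sum_j (a j - m) ^+ 2 = \sum_j a j ^+ 2 - #|J|%:R * m ^+ 2.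
  transitivity (\sum_j (a j ^+ 2 - 2 * m * a j + m ^+ 2)).
    by apply: eq_bigr => j _; ring.
  rewrite big_split/= sumrB -mulr_sumr sa sumr_const -mulr_natl; ring.
have c0 : 0 <= c by rewrite invr_ge0.
move=> h; rewrite -subr_ge0.
have -> : c * \sum_j a j ^+ 2 - m ^+ 2 = c * (\sum_j a j ^+ 2 - #|J|%:R * m ^+ 2).
  by rewrite mulrBr mulrA cJ mul1r.
exact: mulr_ge0.
Qed.

Lemma mean_const (x : R) : c * \sum_(j : J) x = x.
Proof. by rewrite sumr_const -mulr_natl mulrA cJ mul1r. Qed.

End finite_means.

Lemma mean_pair (R : realType) (J : finType) (a : J -> J -> R) :
  #|{: J * J}|%:R^-1 * \sum_(p : J * J) a p.1 p.2 =
  #|J|%:R^-1 * \sum_i (#|J|%:R^-1 * \sum_j a i j).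
Proof.
rewrite card_prod natrM invfM -mulrA; congr (_ * _).
rewrite -mulr_sumr; congr (_ * _).
by rewrite -(pair_bigA_idem _ a) //= addr0.
Qed.

Section averaging.
Context d (E : measurableType d) (R : realType).
Variables (mu : {sigma_finite_measure set E -> \bar R}) (kap : E * E -> R).
Hypotheses (mkap : measurable_fun [set: E * E] kap) (kap0 : forall p, 0 <= kap p).
Variables (I : finType) (T T' : I -> E -> E).
Hypothesis I0 : (0 < #|I|)%N.
Hypotheses (mT : forall i, measurable_fun [set: E] (T i))
  (mT' : forall i, measurable_fun [set: E] (T' i)).
Hypothesis TK : forall i, cancel (T i) (T' i).
Hypothesis Tmu : forall i A, measurable A -> mu (T i @^-1` A) = mu A.
Hypothesis Tkap : forall i j x y, kap (T i x, T j y) = kap (x, y).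
Variables e1 e2 : E -> R.
Hypotheses (me1 : measurable_fun [set: E] e1) (e10 : forall z, 0 <= e1 z).
Hypotheses (me2 : measurable_fun [set: E] e2) (e20 : forall z, 0 <= e2 z).
Hypothesis e2E : forall x, e2 x = #|I|%:R^-1 * \sum_i e1 (T i x).
Variables (k1 k2 : R.-pker E ~> E) (pi1 pi2 : probability E R).
Hypotheses (kmh1 : is_mh mu kap e1 (fun z => k1 z))
  (kmh2 : is_mh mu kap e2 (fun z => k2 z)).
Hypotheses
  (pi1E : forall A, measurable A -> pi1 A = (\int[mu]_(z in A) (e1 z)%:E)%E)
  (pi2E : forall A, measurable A -> pi2 A = (\int[mu]_(z in A) (e2 z)%:E)%E).

Let c : R := #|I|%:R^-1.
Let c0 : 0 <= c. Proof. by rewrite invr_ge0. Qed.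

Let pT (pi : probability E R) : (pi setT < +oo)%E.
Proof. by rewrite probability_setT ltry. Qed.

Lemma integral_shift i (F : E -> \bar R) : (forall x, 0 <= F x)%E ->
  measurable_fun [set: E] F -> (\int[mu]_x F (T i x) = \int[mu]_x F x)%E.
Proof. by move=> F0 mF; apply: ge0_integral_image => // A mA; exact: Tmu. Qed.

(** The averaged target is the mean of the images of the original one under the
    maps T' i. *)
Lemma ge0_integral_average (h : E -> \bar R) : (forall x, 0 <= h x)%E ->
  measurable_fun [set: E] h ->
  (\int[pi2]_x h x = c%:E * \sum_i \int[pi1]_x h (T' i x))%E.
Proof.
move=> h0 mh; rewrite (integral_density me2 e20 pi2E)//.
have m1 i : measurable_fun [set: E] (fun x => (e1 (T i x))%:E * h x)%E.
  by apply: emeasurable_funM => //; exact/measurable_EFinP/measurableT_comp.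
have E1 i : (\int[pi1]_x h (T' i x) = \int[mu]_x ((e1 (T i x))%:E * h x))%E.
  rewrite (integral_density me1 e10 pi1E (g := fun x => h (T' i x)))//; last first.
    exact: measurableT_comp.
  rewrite -(integral_shift i (F := fun x => ((e1 x)%:E * h (T' i x))%E)).
  - by apply: eq_integral => x _; rewrite TK.
  - by move=> x; rewrite mule_ge0 ?lee_fin.
  - apply: emeasurable_funM; first exact/measurable_EFinP.
    exact: measurableT_comp.
under eq_bigr do rewrite E1.
have p1 i x : (0 <= (e1 (T i x))%:E * h x)%E by rewrite mule_ge0 ?lee_fin.
rewrite -ge0_integral_sum//.
have mS : measurable_fun [set: E] (fun x => \sum_i ((e1 (T i x))%:E * h x)%E).
  exact: emeasurable_sum.
have S0 x : (0 <= \sum_i ((e1 (T i x))%:E * h x)%E)%E.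
  by apply: sume_ge0 => i _; exact: p1.
rewrite -ge0_integralZl//.
apply: eq_integral => x _; rewrite e2E -ge0_sume_distrl; last first.
  by move=> i _; rewrite lee_fin.
by rewrite sumEFin muleA -EFinM.
Qed.

Lemma Rintegral_average (h : E -> R) : bmfun h ->
  \int[pi2]_x h x = c * \sum_i \int[pi1]_x h (T' i x).
Proof.
have bs (u : E -> R) i : bmfun u -> bmfun (u \o T' i).
  by move=> bu; exact: (bm_comp (mT' i) bu).
move=> bh; apply/subr0_eq; move: h bh; apply: bm_pos_ext => [f g bf bg|f bf f0].
  rewrite (bm_RintegralB (pT pi2) bf bg).
  under eq_bigr => i _.
    rewrite (bm_RintegralB (pT pi1) (bs f i bf) (bs g i bg)); over.
  rewrite sumrB; ring.
have [mf _] := bf.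
apply/eqP; rewrite subr_eq0; apply/eqP/EFin_inj.
rewrite (bm_EFin_Rintegral (pT pi2) bf) EFinM -sumEFin.
under eq_bigr do rewrite (bm_EFin_Rintegral (pT pi1) (bs f _ bf)).
by apply: (ge0_integral_average (h := EFin \o f)) => //; exact/measurable_EFinP.
Qed.

(** Test functions for the averaged chain become test functions for the original
    chain by averaging over the inverses of the maps that average the density. *)
Definition average (g : E -> R) : E -> R := c *: \sum_i (g \o T' i).

Lemma averageE g x : average g x = c * \sum_i g (T' i x).
Proof. by rewrite /average fctE fct_sumE. Qed.

Let bmT' (g : E -> R) i : bmfun g -> bmfun (g \o T' i).
Proof. by move=> bg; exact: (bm_comp (mT' i) bg). Qed.

Lemma bm_average g : bmfun g -> bmfun (average g).
Proof. by move=> bg; apply: bmZ; apply: bm_sum => i _; exact: bmT'. Qed.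

Lemma inner_average g u : bmfun g -> bmfun u -> (forall i y, u (T' i y) = u y) ->
  inner pi1 (average g) u = inner pi2 g u.
Proof.
move=> bg bu uT; rewrite -[RHS]/(\int[pi2]_x (g \* u) x) (Rintegral_average (bmM bg bu)).
rewrite /average (innerZl (pT pi1))//; last by apply: bm_sum => i _; exact: bmT'.
rewrite (inner_suml (pT pi1))//; last by move=> i _; exact: bmT'.
congr (_ * _); apply: eq_bigr => i _; apply: eq_Rintegral => x _ /=.
by rewrite uT.
Qed.

(** Jensen's inequality. *)
Lemma average_contract g : bmfun g ->
  inner pi1 (average g) (average g) <= inner pi2 g g.
Proof.
move=> bg; rewrite -[leRHS]/(\int[pi2]_x (g \* g) x) (Rintegral_average (bmM bg bg)).
have -> : c * \sum_i \int[pi1]_x (g \* g) (T' i x) =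
    \int[pi1]_x average (g \* g) x.
  rewrite (bm_RintegralZ (pT pi1)); last first.
    by apply: bm_sum => i _; apply: bmT'; exact: bmM.
  rewrite (bm_Rintegral_sum (pT pi1))// => i; apply: bmT'; exact: bmM.
apply: (bm_le_Rintegral (pT pi1)) => [||x].
- by apply: bmM; exact: bm_average.
- by apply: bm_average; exact: bmM.
- by rewrite !averageE -expr2 (le_trans (sqr_mean_le I0 _)).
Qed.

(** Concavity of the minimum. The mean is over pairs because the two end points of
    a move are transformed independently: averaged over i alone, the first
    argument of the minimum becomes e2 x * kap (x, y), and over j alone the
    second becomes e2 y * kap (y, x). *)
Lemma mean_mh_flow_le x y :
  #|{: I * I}|%:R^-1 * \sum_(s : I * I) mh_flow kap e1 (T s.1 x, T s.2 y) <=
  mh_flow kap e2 (x, y).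
Proof.
rewrite (mean_pair (fun i j => mh_flow kap e1 (T i x, T j y))) /mh_flow/=.
rewrite le_min; apply/andP; split.
- have -> : e2 x * kap (x, y) = c * \sum_i (c * \sum_(j : I) (e1 (T i x) * kap (x, y))).
    rewrite e2E -mulrA mulr_suml; congr (_ * _).
    by apply: eq_bigr => i _; rewrite (mean_const I0).
  rewrite ler_wpM2l//; apply: ler_sum => i _; rewrite ler_wpM2l//.
  by apply: ler_sum => j _; rewrite !Tkap ge_min lexx.
- have -> : e2 y * kap (y, x) = c * \sum_(i : I) (c * \sum_j (e1 (T j y) * kap (y, x))).
    by rewrite (mean_const I0) -mulr_suml mulrA -e2E.
  rewrite ler_wpM2l//; apply: ler_sum => i _; rewrite ler_wpM2l//.
  by apply: ler_sum => j _; rewrite !Tkap ge_min lexx orbT.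
Qed.

Let mfl e := measurable_mh_flow mkap (e := e).

(** The change of variables given by the inverse pair (T' s.1, T' s.2), under
    which the product of mu by itself is invariant. *)
Lemma ge0_integral_flow_shift (s : I * I) (h : E * E -> \bar R) :
  (forall p, 0 <= h p)%E -> measurable_fun [set: E * E] h ->
  (\int[flow_measure mu mkap kap0 me1 e10]_p h (T' s.1 p.1, T' s.2 p.2) =
   \int[mu \x mu]_p ((mh_flow kap e1 (T s.1 p.1, T s.2 p.2))%:E * h p))%E.
Proof.
move=> h0 mh.
have mpair (U V : E -> E) : measurable_fun [set: E] U -> measurable_fun [set: E] V ->
    measurable_fun [set: E * E] (fun p => (U p.1, V p.2)).
  move=> mU mV; apply/measurable_fun_pair => /=.
    exact: (measurableT_comp mU measurable_fst).
  exact: (measurableT_comp mV measurable_snd).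
have mh' : measurable_fun [set: E * E] (fun p => h (T' s.1 p.1, T' s.2 p.2)).
  exact: (measurableT_comp mh (mpair _ _ (mT' s.1) (mT' s.2))).
rewrite ge0_integral_density_measure//.
pose G p := ((mh_flow kap e1 p)%:E * h (T' s.1 p.1, T' s.2 p.2))%E.
have mG : measurable_fun [set: E * E] G.
  by apply: emeasurable_funM => //; apply/measurable_EFinP; exact: mfl.
have G0 p : (0 <= G p)%E by rewrite mule_ge0// lee_fin mh_flow0.
pose G' p := ((mh_flow kap e1 (T s.1 p.1, T s.2 p.2))%:E * h p)%E.
have mG' : measurable_fun [set: E * E] G'.
  apply: emeasurable_funM => //; apply/measurable_EFinP.
  exact: (measurableT_comp (mfl me1) (mpair _ _ (mT s.1) (mT s.2))).
have G'0 p : (0 <= G' p)%E by rewrite mule_ge0// lee_fin mh_flow0.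
rewrite (fubini_tonelli1 G mG G0) (fubini_tonelli1 G' mG' G'0).
rewrite -(integral_shift s.1); first last.
- exact: measurable_fun_fubini_tonelli_F.
- by move=> x; apply: integral_ge0 => y _.
apply: eq_integral => x _; rewrite /fubini_F.
rewrite -(integral_shift s.2 (F := fun y => G (T s.1 x, y))); first last.
- exact: (measurable_fun_pair2 _ mG).
- by move=> y.
by apply: eq_integral => y _; rewrite /G /G'/= !TK.
Qed.

(** The increment of [average g] is the mean over pairs of maps of increments of
    g; Jensen's inequality and [mean_mh_flow_le] conclude. *)
Lemma average_dirichlet_le g : bmfun g ->
  \int[flow_measure mu mkap kap0 me1 e10]_p ((average g p.1 - average g p.2) ^+ 2) <=
  \int[flow_measure mu mkap kap0 me2 e20]_p ((g p.1 - g p.2) ^+ 2).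
Proof.
move=> bg.
have fl1 := flow_measure_fin mkap kap0 me1 e10 kmh1 pi1E.
have fl2 := flow_measure_fin mkap kap0 me2 e20 kmh2 pi2E.
have bm12 dX (X : measurableType dX) (u v : X -> E) :
    measurable_fun [set: X] u -> measurable_fun [set: X] v ->
    forall f : E -> R, bmfun f -> bmfun (fun p => (f (u p) - f (v p)) ^+ 2).
  move=> mu' mv f bf.
  have bd := bmB (bm_comp mu' bf) (bm_comp mv bf).
  rewrite (_ : (fun p => _) = ((f \o u) - (f \o v)) \* ((f \o u) - (f \o v))).
    exact: bmM.
  by apply/funext => p; rewrite expr2.
have bA := bm12 _ _ _ _ measurable_fst measurable_snd _ (bm_average bg).
have bh := bm12 _ _ _ _ measurable_fst measurable_snd _ bg.
have [mh _] := bh; have [mA _] := bA.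
pose h p := (((g p.1 - g p.2) ^+ 2)%:E : \bar R).
have h0 p : (0 <= h p)%E by rewrite lee_fin sqr_ge0.
have {}mh : measurable_fun [set: E * E] h by exact/measurable_EFinP.
pose Ts (s : I * I) (p : E * E) := (T' s.1 p.1, T' s.2 p.2).
have mhs s : measurable_fun [set: E * E] (fun p => h (Ts s p)).
  apply: (measurableT_comp mh); apply/measurable_fun_pair => /=.
    exact: (measurableT_comp (mT' s.1) measurable_fst).
  exact: (measurableT_comp (mT' s.2) measurable_snd).
have mrs s : measurable_fun [set: E * E]
    (fun p => ((mh_flow kap e1 (T s.1 p.1, T s.2 p.2))%:E * h p)%E).
  apply: emeasurable_funM => //; apply/measurable_EFinP.
  apply: (measurableT_comp (mfl me1)); apply/measurable_fun_pair => /=.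
    exact: (measurableT_comp (mT s.1) measurable_fst).
  exact: (measurableT_comp (mT s.2) measurable_snd).
have cK0 : 0 <= (#|{: I * I}|%:R^-1 : R) by rewrite invr_ge0.
have K0 : (0 < #|{: I * I}|)%N by rewrite card_prod muln_gt0 I0.
rewrite -lee_fin (bm_EFin_Rintegral fl1 bA) (bm_EFin_Rintegral fl2 bh).
apply: (@le_trans _ _ (\int[flow_measure mu mkap kap0 me1 e10]_p
    ((#|{: I * I}|%:R^-1)%:E * \sum_(s : I * I) h (Ts s p)))%E).
  apply: ge0_le_integral => //.
  - by move=> p _; rewrite lee_fin sqr_ge0.
  - exact/measurable_EFinP.
  - by apply: measurable_funeM; exact: emeasurable_sum.
  - move=> p _; rewrite sumEFin -EFinM lee_fin.
    apply: le_trans (sqr_mean_le K0 _); rewrite le_eqVlt; apply/orP; left; apply/eqP.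
    congr (_ ^+ 2); rewrite (mean_pair (fun i j => g (T' i p.1) - g (T' j p.2))).
    under eq_bigr do rewrite sumrB mulrBr (mean_const I0).
    by rewrite sumrB mulrBr (mean_const I0) !averageE.
have mSh : measurable_fun [set: E * E] (fun p => (\sum_(s : I * I) h (Ts s p))%E).
  exact: emeasurable_sum.
rewrite ge0_integralZl ?lee_fin//; last by move=> p _; rewrite sume_ge0.
rewrite ge0_integral_sum//.
under eq_bigr do rewrite (ge0_integral_flow_shift _ h0 mh).
rewrite -ge0_integral_sum//; last first.
  by move=> s p _; rewrite mule_ge0// lee_fin mh_flow0.
have mSr : measurable_fun [set: E * E] (fun p =>
    (\sum_(s : I * I) (mh_flow kap e1 (T s.1 p.1, T s.2 p.2))%:E * h p)%E).
  exact: emeasurable_sum.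
rewrite -ge0_integralZl ?lee_fin//; last first.
  by move=> p _; rewrite sume_ge0// => s _; rewrite mule_ge0// lee_fin mh_flow0.
rewrite ge0_integral_density_measure//.
apply: ge0_le_integral => //.
- move=> p _; rewrite mule_ge0 ?lee_fin// sume_ge0// => s _.
  by rewrite mule_ge0// lee_fin mh_flow0.
- by apply: measurable_funeM; exact: emeasurable_sum.
- by apply: emeasurable_funM => //; apply/measurable_EFinP; exact: mfl.
- move=> [x y] _; rewrite -ge0_sume_distrl; last first.
    by move=> s _; rewrite lee_fin mh_flow0.
  rewrite sumEFin muleA; apply: lee_wpmul2r => //.
  by rewrite -EFinM lee_fin; exact: mean_mh_flow_le.
Qed.

Context d1 (Omega1 : measurableType d1) (P1 : probability Omega1 R).
Context d2 (Omega2 : measurableType d2) (P2 : probability Omega2 R).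
Variables (Z1 : nat -> Omega1 -> E) (Z2 : nat -> Omega2 -> E).
Hypotheses (chain1 : markov_chain P1 pi1 (fun z => k1 z) Z1)
  (chain2 : markov_chain P2 pi2 (fun z => k2 z) Z2).

(** The transfer of test functions required by [variance_comparison] is
    [average]. *)
Theorem averaging_reduces_variance (f : E -> R) : sqint pi1 f ->
  (forall i x, f (T' i x) = f x) ->
  exists v vx : \bar R, [/\
    (fun M => 'V_P2[fun w => ((Num.sqrt M%:R)^-1 * \sum_(i < M) f (Z2 i w))%R])%E @ \oo --> vx,
    (fun M => 'V_P1[fun w => ((Num.sqrt M%:R)^-1 * \sum_(i < M) f (Z1 i w))%R])%E @ \oo --> v &
    (vx <= v)%E].
Proof.
move=> sf fT; have [mf if2] := sf.
have inv_integral (h : E -> \bar R) : (forall x, 0 <= h x)%E ->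
    measurable_fun [set: E] h -> (forall i x, h (T' i x) = h x) ->
    (\int[pi2]_x h x = \int[pi1]_x h x)%E.
  move=> h0 mh hT; rewrite ge0_integral_average//.
  under eq_bigr do under eq_integral do rewrite hT.
  rewrite ge0_sume_distrr; last by move=> i _; exact: integral_ge0.
  rewrite -ge0_sume_distrl; last by move=> i _; rewrite lee_fin.
  by rewrite sumEFin sumr_const -mulr_natr mulVf ?mul1e// pnatr_eq0 -lt0n.
have sf2 : sqint pi2 f.
  split=> //; move/integrableP : if2 => [m2 f2]; apply/integrableP; split => //.
  rewrite (inv_integral (fun x => `|(f x ^+ 2)%:E|%E))//.
    exact: measurableT_comp.
  by move=> i x; rewrite fT.
have rev1 := mh_reversible mkap kap0 me1 e10 kmh1 pi1E.
have rev2 := mh_reversible mkap kap0 me2 e20 kmh2 pi2E.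
have meanE : \int[pi1]_x f x = \int[pi2]_x f x.
  rewrite /Rintegral integralE [in RHS]integralE; congr (fine (_ - _)%E).
  - apply/esym/inv_integral => //.
      by apply: measurable_funepos; exact/measurable_EFinP.
    by move=> i x; rewrite !funeposE /= fT.
  - apply/esym/inv_integral => //.
      by apply: measurable_funeneg; exact/measurable_EFinP.
    by move=> i x; rewrite !funenegE /= fT.
apply: (variance_comparison rev1 rev2 chain1 chain2 sf sf2 meanE) => a n u.
have bu : bmfun u by apply: bm_trunc; exact: measurable_funB.
have uT i x : u (T' i x) = u x by rewrite /u /trunc -![(f - _) _]/(f _ - a) fT.
split.
  rewrite -[RHS]/(\int[pi2]_x (u \* u) x) (Rintegral_average (bmM bu bu)).
  rewrite -[LHS](mean_const I0); congr (_ * _); apply: eq_bigr => i _.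
  by apply: eq_Rintegral => x _ /=; rewrite uT.
move=> g bg; exists (average g); split.
- exact: bm_average.
- exact: inner_average.
move=> r /andP[r0 r1].
rewrite (mh_qform mkap kap0 me1 e10 kmh1 pi1E _ (bm_average bg)).
rewrite (mh_qform mkap kap0 me2 e20 kmh2 pi2E _ bg).
apply: lerD; first by rewrite ler_wpM2l ?subr_ge0// average_contract.
by rewrite ler_wpM2l ?divr_ge0// average_dirichlet_le.
Qed.

End averaging.

(** * Finite product laws *)

Section kernel_probability.
Context d d' (X : measurableType d) (Y : measurableType d') (R : realType).
Variables (k : R.-pker X ~> Y) (x : X).

(** A name to which the structure of a probability can be attached. *)
Definition kprob : set Y -> \bar R := k x.

HB.instance Definition _ := Measure.on kprob.

Let kprobT : kprob setT = 1%E. Proof. exact: prob_kernel. Qed.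

HB.instance Definition _ := @Measure_isProbability.Build _ Y R kprob kprobT.

End kernel_probability.

Section boxes.
Context n (d : 'I_n -> measure_display) (S : forall k, measurableType (d k)).
Variable G : forall k, set (set (S k)).
Hypotheses (mG : forall k, measurable = <<s @G k >>) (GT : forall k, @G k setT)
  (GI : forall k, setI_closed (@G k)).

(** The sides range over generators of the factors, so that the construction can
    be iterated: N samples with K coordinates each have boxes whose sides are
    boxes. *)
Definition boxes : set (set (dprod S)) :=
  [set B | exists A : forall k, set (S k),
    (forall k, @G k (A k)) /\ B = [set x | forall k, A k (x k)]].

Let G_measurable k A : @G k A -> measurable A.
Proof. by move=> GA; rewrite mG; exact: sub_sigma_algebra. Qed.

Lemma boxes_setI : setI_closed boxes.
Proof.
move=> _ _ [A [GA ->]] [B [GB ->]]; exists (fun k => A k `&` B k); split.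
  by move=> k; exact: GI.
by apply/seteqP; split=> [x [Ax Bx] k|x ABx]; [split|split=> k; have [] := ABx k].
Qed.

Lemma boxesT : boxes setT.
Proof. by exists (fun k => setT); split => //; apply/seteqP; split. Qed.

Lemma boxes_measurable B : boxes B -> measurable B.
Proof.
move=> [A [GA ->]].
rewrite (_ : [set _ | _] = \bigcap_k ((fun x : dprod S => x k) @^-1` (A k))); last first.
  by apply/seteqP; split => [x Ax k _|x Ax k]; [exact: Ax|exact: (Ax k I)].
apply: fin_bigcap_measurable => // k _.
rewrite -[X in measurable X]setTI.
by apply: (@measurable_dproj _ _ S k) => //; exact: G_measurable (GA k).
Qed.

(** Each G k generates its factor and contains the whole space, so cylinders with
    base in G k are boxes. *)
Lemma measurable_boxes : @measurable _ (dprod S) = <<s boxes >>.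
Proof.
apply/seteqP; split; last first.
  apply: smallest_sub; first exact: sigma_algebra_measurable.
  exact: boxes_measurable.
apply: smallest_sub; first exact: smallest_sigma_algebra.
move=> _ [k [A mA ->]].
pose pr : g_sigma_algebraType boxes -> S k := fun x => x k.
have mpr : measurable_fun setT pr.
  apply: (measurability (@G k)); first exact: mG.
  move=> _ [B GB <-]; apply: sub_sigma_algebra; rewrite setTI.
  exists (@dfwith _ (fun j => set (S j)) (fun j => setT) k B); split=> [j|].
    by case: dfwithP => [|i _].
  apply/seteqP; split=> [x Bx j|x /(_ k)]; last by rewrite dfwithin.
  by case: dfwithP.
by have := mpr measurableT A mA; rewrite setTI.
Qed.

End boxes.

Section dprod_prob.
Context (R : realType) n (d : 'I_n -> measure_display)
  (S : forall k, measurableType (d k)) (P_ : forall j, probability (S j) R).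

Definition dprod_prob : set (dprod S) -> \bar R := dprod_measure (fun j => P_ j).

HB.instance Definition _ := Measure.on dprod_prob.

Lemma dprod_probE (A : forall j, set (S j)) : (forall j, measurable (A j)) ->
  dprod_prob [set x | forall j, A j (x j)] = (\prod_(j < n) P_ j (A j))%E.
Proof. exact: dprod_measureE. Qed.

Let dprod_probT : dprod_prob setT = 1%E.
Proof.
have := dprod_probE (fun j => @measurableT _ (S j)).
rewrite big1 => [<-|j _]; last exact: probability_setT.
by congr dprod_prob; apply/seteqP; split.
Qed.

HB.instance Definition _ := @Measure_isProbability.Build _ _ R dprod_prob dprod_probT.

End dprod_prob.

Lemma measurable_sigma_algebra d (X : measurableType d) :
  @measurable _ X = <<s @measurable _ X >>.
Proof. by rewrite smallest_id//; exact: sigma_algebra_measurable. Qed.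

Lemma dprod_measurable_boxes n (d : 'I_n -> measure_display)
    (S : forall k, measurableType (d k)) :
  @measurable _ (dprod S) = <<s boxes (fun j => @measurable _ (S j)) >>.
Proof.
by apply: measurable_boxes => j //; exact: measurable_sigma_algebra.
Qed.

Lemma measurable_boxes_setI n (d : 'I_n -> measure_display)
    (S : forall k, measurableType (d k)) :
  setI_closed (boxes (fun j => @measurable _ (S j))).
Proof. by apply: boxes_setI => j A B; exact: measurableI. Qed.

Section dprod_kernel.
Context dT (T : measurableType dT) (R : realType).
Context n (d : 'I_n -> measure_display) (S : forall k, measurableType (d k)).
Variable k_ : forall j, R.-pker T ~> S j.

Let pk t : {measure set (dprod S) -> \bar R} := dprod_prob (fun j => kprob (k_ j) t).

Let pp t : probability (dprod S) R := dprod_prob (fun j => kprob (k_ j) t).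

Let pkT t : pk t setT = 1%E.
Proof. exact: (probability_setT (pp t)). Qed.

Let pkC t A : measurable A -> pk t (~` A) = (1 - pk t A)%E.
Proof. exact: (probability_setC (pp t)). Qed.

Let measurable_pk A : measurable A -> measurable_fun [set: T] (fun t => pk t A).
Proof.
rewrite dprod_measurable_boxes; move: A.
apply: dynkin_induction (@dprod_measurable_boxes _ _ S) _ _ _ _ _.
- exact: measurable_boxes_setI.
- by under eq_fun do rewrite pkT; exact: measurable_cst.
- move=> _ [A [mA ->]]; under eq_fun do rewrite [pk _ _]dprod_probE//.
  elim: (index_enum _) => [|j s ih].
    by under eq_fun do rewrite big_nil; exact: measurable_cst.
  under eq_fun do rewrite big_cons; apply: emeasurable_funM => //.
  exact: (measurable_kernel (k_ j)).
- move=> A mA mpA; under eq_fun do rewrite pkC//.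
  exact: emeasurable_funB.
- move=> F mF tF mpF.
  rewrite (_ : (fun t => _) = fun t => (\sum_(0 <= i <oo) pk t (F i))%E).
    exact: ge0_emeasurable_sum.
  by apply/funext => t; rewrite measure_semi_bigcup//; exact: bigcup_measurable.
Qed.

(** On boxes the product law is a product of measurable functions of the
    parameter; Dynkin's theorem extends measurability to all measurable sets. *)
Lemma dprod_kernel_exists : exists D : R.-pker T ~> dprod S,
  forall t, (D t : set (dprod S) -> \bar R) = dprod_measure (fun j => k_ j t).
Proof.
pose K := @isKernel.Build _ _ T (dprod S) R pk measurable_pk.
pose kk : R.-ker T ~> dprod S := HB.pack pk K.
pose Kp := @Kernel_isProbability.Build _ _ T (dprod S) R kk pkT.
pose kp : R.-pker T ~> dprod S := HB.pack pk K Kp.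
by exists kp.
Qed.

End dprod_kernel.

(** * Coordinate shifts of the samples *)

Section coordinate_shift.
Context (K : nat) (dS : 'I_K -> measure_display)
  (S : forall k, measurableType (dS k)) (N : nat).
Implicit Types (s : {ffun 'I_K -> 'I_N.+1}) (x : samples (dprod S) N.+1).

(** Addition in 'I_N.+1 is modulo N.+1. *)
Definition coord_shift s x : samples (dprod S) N.+1 := fun n k => x (n + s k) k.

Definition coord_unshift s x : samples (dprod S) N.+1 := fun n k => x (n - s k) k.

Lemma measurable_reindex (h : 'I_N.+1 -> 'I_K -> 'I_N.+1) :
  measurable_fun [set: samples (dprod S) N.+1]
    (fun x : samples (dprod S) N.+1 => (fun n k => x (h n k) k) : samples (dprod S) N.+1).
Proof.
apply: measurable_dprodP => n; apply: measurable_dprodP => k.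
have m1 : measurable_fun [set: dprod S] (fun y : dprod S => y k).
  exact: measurable_dproj.
have m2 : measurable_fun [set: samples (dprod S) N.+1]
    (fun x : samples (dprod S) N.+1 => x (h n k)).
  exact: (@measurable_dproj _ _ (fun _ : 'I_N.+1 => dprod S) (h n k)).
exact: (measurableT_comp m1 m2).
Qed.

Lemma measurable_coord_shift s : measurable_fun [set: samples (dprod S) N.+1] (coord_shift s).
Proof. exact: (@measurable_reindex (fun n k => n + s k)). Qed.

Lemma measurable_coord_unshift s :
  measurable_fun [set: samples (dprod S) N.+1] (coord_unshift s).
Proof. exact: (@measurable_reindex (fun n k => n - s k)). Qed.

Lemma coord_shiftK s : cancel (coord_shift s) (coord_unshift s).
Proof.
move=> x; apply/funext => n; apply: functional_extensionality_dep => k.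
by rewrite /coord_unshift /coord_shift subrK.
Qed.

Context (R : realType) (Pk : forall k, probability (S k) R)
  (P0 : probability (dprod S) R).
Hypothesis P0E : forall A, measurable A -> P0 A = dprod_measure (fun k => Pk k) A.

Let D : probability (samples (dprod S) N.+1) R := dprod_prob (fun _ : 'I_N.+1 => P0).

Let box (C : 'I_N.+1 -> forall k, set (S k)) : set (samples (dprod S) N.+1) :=
  [set x | forall n, [set y : dprod S | forall k, C n k (y k)] (x n)].

Let DE C : (forall n k, measurable (C n k)) ->
  D (box C) = (\prod_(n < N.+1) \prod_(k < K) Pk k (C n k))%E.
Proof.
move=> mC.
have mbox n : measurable [set y : dprod S | forall k, C n k (y k)].
  by apply: (@boxes_measurable _ _ S (fun k => @measurable _ (S k)));
    [move=> k; exact: measurable_sigma_algebra|exists (C n)].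
rewrite [LHS](dprod_probE (fun _ : 'I_N.+1 => P0) mbox).
apply: eq_bigr => n _; rewrite P0E//.
exact: (dprod_measureE (fun k => Pk k)).
Qed.

(** A box with sides C n k has as its mass the product over n and k of
    Pk k (C n k), and for each k the shift permutes the factors. As such boxes
    form a generating pi-system, they determine the law. *)
Lemma coord_shift_invariant s A : measurable A -> D (coord_shift s @^-1` A) = D A.
Proof.
pose sh : {mfun samples (dprod S) N.+1 >-> samples (dprod S) N.+1} :=
  mfun_Sub (mem_set (measurable_coord_shift s)).
pose G := boxes (fun _ : 'I_N.+1 => boxes (fun k => @measurable _ (S k))).
move=> mA; apply: (@measure_unique _ R _ G (fun=> setT) _ _ _ _ (distribution D sh) D) => //.
- apply: measurable_boxes => n.
  + exact: dprod_measurable_boxes.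
  + exact: boxesT.
- by apply: boxes_setI => n; exact: measurable_boxes_setI.
- move=> _; apply: boxesT => n; exact: boxesT.
- by rewrite bigcup_const.
- move=> _ [B [GB ->]].
  have [C CE] : exists C : 'I_N.+1 -> forall k, set (S k), forall n,
      (forall k, measurable (C n k)) /\ B n = [set y | forall k, C n k (y k)].
    exists (fun n => sval (cid (GB n))) => n.
    by case: cid.
  have mC n k : measurable (C n k) by have [+ _] := CE n.
  have -> : [set x : samples (dprod S) N.+1 | forall n, B n (x n)] = box C.
    by apply/seteqP; split=> x h n; have := h n; have [_ ->] := CE n.
  pose C' n k := C (n - s k) k.
  transitivity (D (box C')).
    congr (dprod_prob _ _); apply/seteqP; split=> x h n k.
      by have := h (n - s k) k; rewrite /= /coord_shift subrK.
    by have := h (n + s k) k; rewrite /C' addrK.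
  rewrite [LHS](DE (fun n k => mC (n - s k) k)) [RHS](DE mC).
  rewrite exchange_big [RHS]exchange_big; apply: eq_bigr => k _.
  rewrite (reindex_inj (addIr (s k))); apply: eq_bigr => n _.
  by rewrite /C' addrK.
- by move=> _; rewrite -[X in (X < _)%E]/(D setT) (probability_setT D) ltry.
Qed.

End coordinate_shift.

(** For each n the map s |-> (n + s k)_k is a bijection of the multi-indices. *)
Lemma pf_estimate_mean (R : realType) dT (T : measurableType dT) (K N : nat)
    (dS : 'I_K -> measure_display) (S : forall k, measurableType (dS k))
    (w : T -> dprod S -> R) (t : T) (x : samples (dprod S) N.+1) :
  pf_estimate w t x = #|{: {ffun 'I_K -> 'I_N.+1}}|%:R^-1 *
    \sum_(s : {ffun 'I_K -> 'I_N.+1}) std_estimate w t (coord_shift s x).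
Proof.
rewrite /pf_estimate /std_estimate card_ffun !card_ord; congr (_ * _).
rewrite -mulr_sumr exchange_big/=.
transitivity (N.+1%:R^-1 * \sum_(n < N.+1)
    \sum_(s : {ffun 'I_K -> 'I_N.+1}) w t (fun k => x (s k) k)).
  by rewrite sumr_const card_ord -[X in _ * X]mulr_natl mulrA mulVf ?mul1r// pnatr_eq0.
congr (_ * _); apply: eq_bigr => n _.
have inj : injective (fun s : {ffun 'I_K -> 'I_N.+1} => [ffun k => n + s k]).
  move=> s s' /ffunP ss'; apply/ffunP => k.
  by have := ss' k; rewrite !ffunE => /addrI.
rewrite (reindex_inj inj); apply: eq_bigr => s _; congr (w t _).
by apply: functional_extensionality_dep => k; rewrite ffunE.
Qed.

(** * GIMH as a Metropolis-Hastings chain *)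

Section state_measure.
Context dT dX (T : measurableType dT) (X : measurableType dX) (R : realType).
Variables (lambda : {sigma_finite_measure set T -> \bar R}) (D : R.-pker T ~> X).

Let E : measurableType (dT, dX).-prod%mdisp := (T * X)%type.

Let mpair t : measurable_fun [set: X] (fun x => (t, x) : E).
Proof. exact: measurable_pair1. Qed.

Let slice t : {measure set E -> \bar R} :=
  mixture (D t) (fun U mU => measurable_dirac_comp (mpair t) mU).

Let mslice U : measurable U -> measurable_fun [set: T] (fun t => slice t U).
Proof.
move=> mU.
apply: (measurable_fun_integral_finite_kernel (fun p => \d_p U : \bar R) D) => //.
exact: measurable_fun_dirac.
Qed.

Let mu := mixture lambda mslice.

Let mu_sigma_finite : sigma_finite setT mu.
Proof.
have /sigma_finiteP[F [TF ndF Foo]] := sigma_finiteT lambda.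
exists (fun k => F k `*` setT).
  apply/esym; rewrite -subTset => x _.
  have [i _ Fx] : (\bigcup_i F i) x.1 by rewrite -TF.
  by exists i.
move=> k; have [mF Fk] := Foo k; split; first exact: measurableX.
rewrite [mu _](_ : _ = lambda (F k))// /mu /mixture.
rewrite -[RHS]mul1e -integral_cst// [RHS]integral_mkcond; apply: eq_integral => t _.
rewrite patchE -[LHS]/(\int[D t]_x \d_(t, x) (F k `*` setT))%E.
under eq_integral do rewrite diracE.
case: ifPn => Ft; last first.
  apply: integral0_eq => x _; rewrite memNset// => -[Fx _].
  by rewrite notin_setE in Ft.
rewrite -[RHS](@prob_kernel _ _ _ _ _ D t) -integral_one//; apply: eq_integral => x _.
by rewrite mem_set//; split => //; rewrite inE in Ft.
Qed.

(** The mixture over lambda of the laws D t carried by the fibres. It is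
    sigma-finite because a strip over a set F has mass lambda F. *)
Lemma state_measure_exists :
  exists mu : {sigma_finite_measure set E -> \bar R},
  forall F : E -> \bar R, (forall z, 0 <= F z)%E ->
    measurable_fun [set: E] F ->
    (\int[mu]_z F z = \int[lambda]_t \int[D t]_x F (t, x))%E.
Proof.
(* The measure structure of mu is rebuilt from its fields, so that sigma-finiteness
   can be packed with it. *)
pose mm : {measure set E -> \bar R} := mu.
pose G : set E -> \bar R := mm.
pose Gm := @isMeasure.Build _ _ R G (measure0 mm) (measure_ge0 mm)
  (@measure_semi_sigma_additive _ _ _ mm).
pose Gs := @Measure_isSigmaFinite.Build _ _ R
  (HB.pack G Gm : {measure set E -> \bar R}) mu_sigma_finite.
pose nu : {sigma_finite_measure set E -> \bar R} := HB.pack G Gm Gs.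
exists nu => F F0 mF.
rewrite (@integral_mixture _ _ _ _ _ lambda slice mslice nu _ F)//.
apply: eq_integral => t _.
rewrite (@integral_mixture _ _ _ _ _ (D t) (fun x => \d_(t, x))
  (fun U mU => measurable_dirac_comp (mpair t) mU) (slice t) _ F)//.
by apply: eq_integral => x _; rewrite integral_dirac// diracT mul1e.
Qed.

End state_measure.

(** The values on non-measurable sets do not matter for a chain. *)
Lemma eq_markov_chain d (Omega : measurableType d) dE (E : measurableType dE)
    (R : realType) (P : probability Omega R)
    (pi pi' : set E -> \bar R) (k k' : E -> set E -> \bar R)
    (Z : nat -> Omega -> E) :
  (forall A, measurable A -> pi A = pi' A) ->
  (forall z A, measurable A -> k z A = k' z A) ->
  markov_chain P pi k Z -> markov_chain P pi' k' Z.
Proof.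
move=> pi_eq k_eq [mZ Z0 ZS]; split=> //.
  by move=> A mA; rewrite Z0// pi_eq.
by move=> m A B mA mB; rewrite ZS//; apply: eq_integral => w _; exact: k_eq.
Qed.

Section gimh_chain.
Context (R : realType) dT dX (T : measurableType dT) (X : measurableType dX).
Context (N : nat).
Variables (lambda : {sigma_finite_measure set T -> \bar R}).
Variables (Q : R.-pker T ~> T) (q : T * T -> R) (M : R.-pker T ~> X).
Hypothesis q_density : is_kernel_density lambda (fun t => Q t) q.
Local Notation E := (gimh_state T X N).
Variables (D : R.-pker T ~> samples X N) (mu : {sigma_finite_measure set E -> \bar R}).
Hypothesis DE : forall t, (D t : set _ -> \bar R) = iid_law (fun t => M t) t.
Hypothesis muE : forall F : E -> \bar R, (forall z, 0 <= F z)%E ->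
  measurable_fun [set: E] F ->
  (\int[mu]_z F z = \int[lambda]_t \int[D t]_x F (t, x))%E.

(** Proposed samples have density 1 with respect to the reference measure, as it
    is built from their law. *)
Definition proposal_density (p : E * E) : R := q (p.1.1, p.2.1).
Local Notation kap := proposal_density.

Lemma measurable_proposal_density : measurable_fun [set: E * E] kap.
Proof.
have [mq _ _] := q_density; apply: (measurableT_comp mq).
apply/measurable_fun_pair => /=.
- exact: (measurableT_comp measurable_fst measurable_fst).
- exact: (measurableT_comp measurable_fst measurable_snd).
Qed.

Lemma proposal_density0 p : 0 <= kap p.
Proof. by have [_ q0 _] := q_density; exact: q0. Qed.

Lemma proposal_density_proba z : (\int[mu]_y (kap (z, y))%:E = 1)%E.
Proof.
have [_ _ qE] := q_density; rewrite muE.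
- rewrite -[RHS](@prob_kernel _ _ _ _ _ Q z.1) qE//.
  apply: eq_integral => t _; rewrite /kap /= integral_cst//.
  by rewrite prob_kernel mule1.
- by move=> y; rewrite lee_fin; exact: proposal_density0.
- apply/measurable_EFinP.
  exact: (measurable_fun_pair2 z measurable_proposal_density).
Qed.

Variable est : T -> samples X N -> R.
Let e (z : E) := est z.1 z.2.
Hypotheses (me : measurable_fun [set: E] e) (e0 : forall z, 0 <= e z).

Lemma gimh_kernel_mh :
  is_mh mu kap e (gimh_kernel (fun t => Q t) q (fun t => M t) est).
Proof.
move=> z A mA; have [mq q0 qE] := q_density.
have mk := measurable_proposal_density; have k0 := proposal_density0.
pose F (y : E) := mh_accept kap e (z, y) * \1_A y + (1 - mh_accept kap e (z, y)) * \1_A z.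
have ma : measurable_fun [set: E] (fun y => mh_accept kap e (z, y)).
  exact: (measurable_fun_pair2 z (measurable_mh_accept mk k0 me e0)).
have F0 y : 0 <= F y.
  have /andP[a0 a1] := mh_accept01 k0 e0 (z, y).
  by rewrite addr_ge0// mulr_ge0// ?subr_ge0// indicE.
have mF : measurable_fun [set: E] F.
  apply: measurable_funD; apply: measurable_funM => //.
  exact: measurable_funB.
rewrite muE; first last.
- apply/measurable_EFinP; apply: measurable_funM => //.
  exact: (measurable_fun_pair2 z mk).
- by move=> y; rewrite lee_fin; exact: mulr_ge0 (k0 _) (F0 y).
have mDF : measurable_fun [set: T] (fun t => \int[D t]_x (F (t, x))%:E)%E.
  apply: (measurable_fun_integral_finite_kernel (fun y => (F y)%:E) D).
    by move=> y; rewrite lee_fin.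
  exact/measurable_EFinP.
transitivity (\int[Q z.1]_t \int[D t]_x (F (t, x))%:E)%E.
  by apply: eq_integral => t _; rewrite DE.
rewrite (@integral_density _ T R lambda (Q z.1) (fun t => q (z.1, t)) _ _ _ _ _ mDF)//.
- apply: eq_integral => t _.
  rewrite -ge0_integralZl ?lee_fin//.
  + apply/measurable_EFinP.
    exact: (measurable_fun_pair2 t mF).
  + by move=> x _; rewrite lee_fin.
- exact: (measurable_fun_pair2 z.1 mq).
- by move=> B mB; rewrite qE.
- by move=> t; apply: integral_ge0 => x _; rewrite lee_fin.
Qed.

Lemma gimh_target_density A : measurable A ->
  gimh_target lambda (fun t => M t) est A = (\int[mu]_(z in A) (e z)%:E)%E.
Proof.
move=> mA; rewrite [RHS]integral_mkcond.
rewrite (_ : _ \_ A = fun z => (e z * \1_A z)%:E); last first.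
  apply/funext => z; rewrite patchE indicE.
  by case: ifPn => _; rewrite ?mulr1 ?mulr0.
rewrite muE; first last.
- by apply/measurable_EFinP; apply: measurable_funM => //; exact: measurable_indic.
- by move=> z; rewrite lee_fin mulr_ge0// indicE.
by apply: eq_integral => t _; rewrite DE.
Qed.

(** The estimate is a probability density for mu because its integral is the mass
    of the law of the initial state. *)
Lemma gimh_chain_metropolis d (Omega : measurableType d) (P : probability Omega R)
    (Z : nat -> Omega -> E) :
  markov_chain P (gimh_target lambda (fun t => M t) est)
    (gimh_kernel (fun t => Q t) q (fun t => M t) est) Z ->
  exists k : R.-pker E ~> E, exists pi : probability E R,
    [/\ is_mh mu kap e (fun z => k z),
        forall A, measurable A -> pi A = (\int[mu]_(z in A) (e z)%:E)%E &
        markov_chain P pi (fun z => k z) Z].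
Proof.
move=> chain; have [_ Z0 _] := chain.
have [k kmh] := mh_kernel_exists measurable_proposal_density proposal_density0
  proposal_density_proba me e0.
have e1 : (\int[mu]_z (e z)%:E = 1)%E.
  by rewrite -gimh_target_density// -Z0// preimage_setT probability_setT.
have [pi piE] := mh_target_exists me e0 e1.
exists k, pi; split => //; apply: eq_markov_chain chain.
- by move=> A mA; rewrite piE// gimh_target_density.
- by move=> z A mA; rewrite kmh// gimh_kernel_mh.
Qed.

End gimh_chain.

(** * Density estimates and the law of the parameter *)

Section estimates.
Context (R : realType) dT (T : measurableType dT) (K : nat)
  (dS : 'I_K -> measure_display) (S : forall k, measurableType (dS k)) (N : nat).
Local Notation E := (gimh_state T (dprod S) N).
Variable w : T -> dprod S -> R.
Hypothesis mw : measurable_fun [set: T * dprod S] (fun p => w p.1 p.2).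
Hypothesis w0 : forall t x, 0 <= w t x.

Let mwc (h : samples (dprod S) N -> dprod S) :
  measurable_fun [set: samples (dprod S) N] h ->
  measurable_fun [set: E] (fun z => w z.1 (h z.2)).
Proof.
move=> mh; apply: (@measurableT_comp _ _ _ E _ _ (fun p => w p.1 p.2) _
  (fun z => (z.1, h z.2))) => //.
apply/measurable_fun_pair => //=.
exact: (measurableT_comp mh measurable_snd).
Qed.

Let mproj n : measurable_fun [set: samples (dprod S) N] (fun x => x n).
Proof. exact: (@measurable_dproj _ _ (fun _ : 'I_N => dprod S) n). Qed.

Lemma measurable_std_estimate :
  measurable_fun [set: E] (fun z => std_estimate w z.1 z.2).
Proof.
apply: measurable_funM => //; apply: measurable_sum => n.
exact: (mwc (mproj n)).
Qed.

Lemma measurable_pf_estimate :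
  measurable_fun [set: E] (fun z => pf_estimate w z.1 z.2).
Proof.
apply: measurable_funM => //; apply: measurable_sum => n.
apply: (@mwc (fun x => (fun k => x (n k) k) : dprod S)).
apply: measurable_dprodP => k.
exact: (measurableT_comp (@measurable_dproj _ _ S k) (mproj (n k))).
Qed.

Lemma std_estimate0 (z : E) : 0 <= std_estimate w z.1 z.2.
Proof. by rewrite mulr_ge0 ?invr_ge0// sumr_ge0. Qed.

Lemma pf_estimate0 (z : E) : 0 <= pf_estimate w z.1 z.2.
Proof. by rewrite mulr_ge0 ?invr_ge0// sumr_ge0. Qed.

End estimates.

Lemma coordinate_law (R : realType) d (X : measurableType d) (P : probability X R)
    N (n : 'I_N) (A : set X) : measurable A ->
  dprod_measure (fun _ : 'I_N => (P : set X -> \bar R)) ((fun x => x n) @^-1` A) = P A.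
Proof.
move=> mA; pose B (j : 'I_N) := if j == n then A else setT.
have mB j : measurable (B j) by rewrite /B; case: ifP.
rewrite [X in dprod_measure _ X](_ : _ = [set x : samples X N | forall j, B j (x j)]).
  rewrite [LHS](dprod_measureE (fun _ : 'I_N => P) mB).
  rewrite (bigD1 n)//= {1}/B eqxx big1 ?mule1// => j /negPf jn.
  by rewrite /B jn probability_setT.
apply/seteqP; split=> [x Ax j|x /(_ n)]; last by rewrite /B eqxx.
by rewrite /B; case: ifPn => // /eqP ->.
Qed.

(** Each of the samples has law P: the estimate is unbiased. *)
Lemma integral_std_estimate (R : realType) dT (T : measurableType dT) (K : nat)
  (dS : 'I_K -> measure_display) (S : forall k, measurableType (dS k)) (N : nat)
  (w : T -> dprod S -> R) (P : probability (dprod S) R)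
  (D : {measure set (samples (dprod S) N) -> \bar R}) t :
  (0 < N)%N -> (D : set _ -> \bar R) = dprod_measure (fun _ : 'I_N => (P : set _ -> \bar R)) ->
  measurable_fun [set: dprod S] (w t) -> (forall x, 0 <= w t x) ->
  (\int[D]_x (std_estimate w t x)%:E = \int[P]_x (w t x)%:E)%E.
Proof.
move=> N_gt0 DE mw w0.
have mn n : measurable_fun [set: samples (dprod S) N] (fun x => x n).
  exact: (@measurable_dproj _ _ (fun _ : 'I_N => dprod S) n).
have mwn n : measurable_fun [set: samples (dprod S) N] (fun x => w t (x n)).
  exact: (measurableT_comp mw (mn n)).
under eq_integral do rewrite /std_estimate EFinM.
rewrite ge0_integralZl//; first last.
- by move=> x _; rewrite lee_fin sumr_ge0.
- by apply/measurable_EFinP; exact: measurable_sum.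
under eq_integral do rewrite -sumEFin.
rewrite ge0_integral_sum//; last 2 first.
- by move=> n; exact/measurable_EFinP.
- by move=> n x _; rewrite lee_fin.
rewrite (eq_bigr (fun=> 1%:E * \int[P]_x (w t x)%:E)%E) => [|n _].
  rewrite -ge0_sume_distrl; last by move=> i _; rewrite lee_fin.
  by rewrite sumEFin sumr_const card_ord muleA -EFinM mulVf ?mul1e// pnatr_eq0 -lt0n.
rewrite mul1e.
apply: (ge0_integral_image (mn n) _ (f := fun x => (w t x)%:E)) => //.
- by move=> A mA; rewrite DE coordinate_law.
- exact/measurable_EFinP.
Qed.

(** Take complements. *)
Lemma probability_le_eq d (X : measurableType d) (R : realType) (P P' : probability X R) :
  (forall A, measurable A -> (P A <= P' A)%E) -> forall A, measurable A -> P A = P' A.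
Proof.
move=> PP' A mA; apply/eqP; rewrite eq_le PP'//=.
have flip (a b : \bar R) : a \is a fin_num -> b \is a fin_num ->
    (1 - a <= 1 - b -> b <= a)%E.
  by case: a => // x; case: b => // y _ _; rewrite -!EFinB !lee_fin; lra.
apply: flip; [exact: fin_num_measure|exact: fin_num_measure|].
by rewrite -!probability_setC//; exact/PP'/measurableC.
Qed.

Section weights.
Context (R : realType) dT (T : measurableType dT) (K : nat)
  (dS : 'I_K -> measure_display) (S : forall k, measurableType (dS k)).
Variables (p m : T * dprod S -> R).
Hypotheses (mp : measurable_fun [set: T * dprod S] p) (p0 : forall z, 0 <= p z).
Hypotheses (mm : measurable_fun [set: T * dprod S] m) (m0 : forall z, 0 <= m z).

Lemma weight0 t x : 0 <= weight p m t x.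
Proof. by rewrite divr_ge0. Qed.

Lemma measurable_weight :
  measurable_fun [set: T * dprod S] (fun z => weight p m z.1 z.2).
Proof.
rewrite (_ : (fun z => _) = fun z => p z * (m z)^-1); last first.
  by apply/funext => -[].
by apply: measurable_funM => //; exact: measurable_funV.
Qed.

End weights.

Section parameter_law.
Context (R : realType) dT (T : measurableType dT) (K : nat)
  (dS : 'I_K -> measure_display) (S : forall k, measurableType (dS k)).
Variables (lambda : {sigma_finite_measure set T -> \bar R})
  (nu : {sigma_finite_measure set (dprod S) -> \bar R}).
Variables (pi : probability T R) (piTS : probability (T * dprod S)%type R)
  (p : T * dprod S -> R).
Hypothesis p_density : is_density (lambda \x nu)%E piTS p.
Hypothesis pi_marginal : forall A : set T, measurable A ->
  pi A = piTS (A `*` [set: dprod S]).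
Variables (M : R.-pker T ~> dprod S) (m : T * dprod S -> R).
Hypothesis m_density : is_kernel_density nu (fun t => M t) m.
Variables (N : nat) (N_gt0 : (0 < N)%N).
Local Notation E := (gimh_state T (dprod S) N).
Variables (D : R.-pker T ~> samples (dprod S) N)
  (mu : {sigma_finite_measure set E -> \bar R}).
Hypothesis DE : forall t, (D t : set _ -> \bar R) = iid_law (fun t => M t) t.
Hypothesis muE : forall F : E -> \bar R, (forall z, 0 <= F z)%E ->
  measurable_fun [set: E] F ->
  (\int[mu]_z F z = \int[lambda]_t \int[D t]_x F (t, x))%E.
Local Notation w := (weight p m).
Variable pi1 : probability E R.
Hypothesis pi1E : forall A, measurable A ->
  pi1 A = (\int[mu]_(z in A) (std_estimate w z.1 z.2)%:E)%E.

(** The inequality can be strict, for the weight is 0 where m vanishes, whatever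
    the value of p. *)
Lemma integral_weight_le t :
  (\int[D t]_x (std_estimate w t x)%:E <= \int[nu]_x (p (t, x))%:E)%E.
Proof.
have [mp p0 _] := p_density; have [mm m0 mE] := m_density.
have mw : measurable_fun [set: dprod S] (w t).
  exact: (measurable_fun_pair2 t (measurable_weight mp mm m0)).
have w0 := weight0 p0 m0.
have mmt : measurable_fun [set: dprod S] (fun x => m (t, x)).
  exact: (measurable_fun_pair2 t mm).
rewrite (@integral_std_estimate _ _ _ _ _ _ _ w (kprob M t) (D t) t N_gt0 (DE t) mw (w0 t)).
rewrite (integral_density mmt (fun x => m0 (t, x)) (mE t))//; first last.
- exact/measurable_EFinP.
- by move=> x; rewrite lee_fin.
apply: ge0_le_integral => //.
- by move=> x _; rewrite lee_fin mulr_ge0.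
- by apply/measurable_EFinP; exact: measurable_funM.
- by apply/measurable_EFinP; exact: (measurable_fun_pair2 t mp).
- move=> x _; rewrite lee_fin /weight.
  have [->|mtx] := eqVneq (m (t, x)) 0; first by rewrite mul0r.
  by rewrite mulrCA divff// mulr1.
Qed.

(** Integrating [integral_weight_le] shows that the law of the parameter is at most
    pi; two probabilities so ordered are equal. *)
Lemma theta_law B : measurable B -> pi1 (fst @^-1` B) = pi B.
Proof.
have [mp p0 pE] := p_density; have [mm m0 _] := m_density.
have mw := measurable_weight mp mm m0; have w0 := weight0 p0 m0.
pose theta : {mfun E >-> T} := mfun_Sub (mem_set (@measurable_fst _ _ T (samples (dprod S) N))).
move: B; apply: (@probability_le_eq _ _ _ (distribution pi1 theta) pi) => B mB.
have mB' : measurable (fst @^-1` B : set E).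
  by rewrite -[X in measurable X]setTI; exact: measurable_fst.
rewrite -[leLHS]/(pi1 (fst @^-1` B)) pi1E// pi_marginal//.
rewrite pE; last exact: measurableX.
rewrite [leLHS]integral_mkcond [leRHS]integral_mkcond.
have me := @measurable_std_estimate _ _ _ _ _ _ N _ mw.
have e0 := @std_estimate0 _ _ _ _ _ _ N _ w0.
have meB : measurable_fun [set: E]
    ((fun z => (std_estimate w z.1 z.2)%:E) \_ (fst @^-1` B)).
  by apply/(measurable_restrictT _ mB')/measurable_funTS/measurable_EFinP.
rewrite muE; first last.
- exact: meB.
- by move=> z; rewrite erestrict_ge0// => y; rewrite lee_fin.
have mBT : measurable (B `*` [set: dprod S]) by exact: measurableX.
have mpB : measurable_fun [set: T * dprod S] ((EFin \o p) \_ (B `*` setT)).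
  by apply/(measurable_restrictT _ mBT)/measurable_funTS/measurable_EFinP.
have pB0 z : (0 <= ((EFin \o p) \_ (B `*` setT)) z)%E.
  by rewrite erestrict_ge0// => y; rewrite lee_fin.
rewrite (fubini_tonelli1 _ mpB pB0).
apply: ge0_le_integral => //.
- move=> t _; apply: integral_ge0 => x _.
  by rewrite erestrict_ge0// => y; rewrite lee_fin.
- apply: (measurable_fun_integral_finite_kernel _ D).
    by move=> z; rewrite erestrict_ge0// => y; rewrite lee_fin.
  exact: meB.
- exact: measurable_fun_fubini_tonelli_F.
- move=> t _; rewrite /fubini_F.
  have [tB|tB] := boolP (t \in B).
    rewrite (eq_integral (fun x => (std_estimate w t x)%:E)) => [|x _]; last first.
      by rewrite patchE mem_set//= ; rewrite inE in tB.
    rewrite [leRHS](eq_integral (fun x => (p (t, x))%:E)) => [|x _].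
      exact: integral_weight_le.
    by rewrite patchE mem_set//; split => //; rewrite inE in tB.
  rewrite integral0_eq => [|x _]; first by apply: integral_ge0 => x _.
  by rewrite patchE memNset//=; rewrite notin_setE in tB.
Qed.

Lemma sqint_theta (phi : T -> R) : phi \in Lfun pi 2%:E ->
  sqint pi1 (fun z => phi z.1).
Proof.
move=> phi2.
have mphi : measurable_fun [set: T] phi.
  by move: phi2; rewrite inE => /andP[]; rewrite inE.
have := Lfun2_integrable_sqr phi2 => /integrableP[_ i2].
have mphi1 : measurable_fun [set: E] (fun z => phi z.1).
  exact: (measurableT_comp mphi measurable_fst).
split=> //; apply/integrableP; split.
  by apply/measurable_EFinP; exact: measurable_funX.
rewrite (ge0_integral_image measurable_fst theta_law
  (f := fun t => `|(phi t ^+ 2)%:E|%E))//.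
by apply: measurableT_comp => //; apply/measurable_EFinP; exact: measurable_funX.
Qed.

End parameter_law.

(** * Comparison of the two estimates *)

Lemma state_measure_invariant dT dX (T : measurableType dT) (X : measurableType dX)
    (R : realType) (lambda : {measure set T -> \bar R}) (D : R.-pker T ~> X)
    (mu : {measure set (T * X)%type -> \bar R}) (h : X -> X) :
  (forall F : T * X -> \bar R, (forall z, 0 <= F z)%E ->
    measurable_fun [set: T * X] F ->
    (\int[mu]_z F z = \int[lambda]_t \int[D t]_x F (t, x))%E) ->
  measurable_fun [set: X] h ->
  (forall t A, measurable A -> D t (h @^-1` A) = D t A) ->
  forall A, measurable A ->
  mu ((fun z => (z.1, h z.2)) @^-1` A) = mu A.
Proof.
move=> muE mh Dh A mA.
have mH : measurable_fun [set: T * X] (fun z => (z.1, h z.2)).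
  by apply/measurable_fun_pair => //=; exact: (measurableT_comp mh measurable_snd).
have mI B : measurable B -> measurable_fun [set: T * X] (\1_B : T * X -> R).
  by move=> mB; exact: measurable_indic.
have muI B : measurable B -> (mu B = \int[lambda]_t \int[D t]_x (\1_B (t, x))%:E)%E.
  move=> mB; rewrite -(muE (fun z => (\1_B z)%:E)).
  - by rewrite integral_indic// setIT.
  - by move=> z; rewrite lee_fin indicE.
  - by apply/measurable_EFinP; exact: mI.
have mA' : measurable ((fun z => (z.1, h z.2)) @^-1` A).
  by rewrite -[X in measurable X]setTI; exact: mH.
rewrite (muI _ mA') (muI _ mA).
apply: eq_integral => t _.
apply: (@ge0_integral_image _ _ _ _ _ (D t) (D t) _ mh (Dh t)
  (fun x => (\1_A (t, x))%:E)).
- by move=> x; rewrite lee_fin indicE.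
- by apply/measurable_EFinP; exact: (measurable_fun_pair2 t (mI A mA)).
Qed.

Local Open Scope ereal_scope.

Theorem corollary5 (R : realType)
  (* parameter space, sample space S_1 x ... x S_K, reference measures *)
  (dT : measure_display) (T : measurableType dT)
  (lambda : {sigma_finite_measure set T -> \bar R})
  (K : nat) (K_gt0 : (0 < K)%N) (dS : 'I_K -> measure_display)
  (S : forall k : 'I_K, measurableType (dS k))
  (nu : forall k : 'I_K, {sigma_finite_measure set (S k) -> \bar R})
  (* target and its marginal *)
  (pi : probability T R)
  (piTS : probability (T * dprod S)%type R) (p : T * dprod S -> R)
  (p_density : is_density (lambda \x dprod_measure (fun k => nu k)) piTS p)
  (pi_marginal : forall A : set T, measurable A ->
    pi A = piTS (A `*` [set: dprod S]))
  (* product-form sampling kernel *)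
  (M : R.-pker T ~> dprod S) (Mk : forall k : 'I_K, R.-pker T ~> S k)
  (M_product : forall (t : T) (A : set (dprod S)), measurable A ->
    M t A = dprod_measure (fun k => Mk k t) A)
  (m : T * dprod S -> R)
  (m_density : is_kernel_density (dprod_measure (fun k => nu k)) (fun t => M t) m)
  (* proposal *)
  (Q : R.-pker T ~> T) (q : T * T -> R)
  (q_density : is_kernel_density lambda (fun t => Q t) q)
  (phi : T -> R) (phi_L2 : phi \in Lfun pi 2%:E)
  (N : nat) (N_gt0 : (0 < N)%N)
  (* GIMH chain using the standard estimates *)
  (dO : measure_display) (Omega : measurableType dO) (P : probability Omega R)
  (Z : nat -> Omega -> gimh_state T (dprod S) N)
  (Z_gimh : markov_chain P
    (gimh_target lambda (fun t => M t) (std_estimate (weight p m)))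
    (gimh_kernel (fun t => Q t) q (fun t => M t) (std_estimate (weight p m))) Z)
  (* GIMH chain using the product-form estimates *)
  (dO' : measure_display) (Omega' : measurableType dO')
  (P' : probability Omega' R)
  (Z' : nat -> Omega' -> gimh_state T (dprod S) N)
  (Z'_gimh : markov_chain P'
    (gimh_target lambda (fun t => M t) (pf_estimate (weight p m)))
    (gimh_kernel (fun t => Q t) q (fun t => M t) (pf_estimate (weight p m))) Z') :
  exists v vx : \bar R,
    [/\ scaled_variance P' phi Z' @ \oo --> vx,
        scaled_variance P phi Z @ \oo --> v & vx <= v].
Proof.
case: N N_gt0 Z Z_gimh Z' Z'_gimh => // N' _ Z1 chain1 Z2 chain2.
set w := weight p m in chain1 chain2.
have [mp p0 _] := p_density; have [mm m0 _] := m_density.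
have mw := measurable_weight mp mm m0; have w0 := weight0 p0 m0.
have [D DE] := dprod_kernel_exists (fun _ : 'I_N'.+1 => M).
have [mu muE] := state_measure_exists lambda D.
have me1 := @measurable_std_estimate _ _ _ _ _ _ N'.+1 _ mw.
have me2 := @measurable_pf_estimate _ _ _ _ _ _ N'.+1 _ mw.
have e10 := @std_estimate0 _ _ _ _ _ _ N'.+1 _ w0.
have e20 := @pf_estimate0 _ _ _ _ _ _ N'.+1 _ w0.
have [k1 [pi1 [kmh1 pi1E ch1]]] := gimh_chain_metropolis q_density DE muE me1 e10 chain1.
have [k2 [pi2 [kmh2 pi2E ch2]]] := gimh_chain_metropolis q_density DE muE me2 e20 chain2.
pose move_samples (h : samples (dprod S) N'.+1 -> samples (dprod S) N'.+1)
  (z : gimh_state T (dprod S) N'.+1) : gimh_state T (dprod S) N'.+1 := (z.1, h z.2).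
have mmove h : measurable_fun setT h -> measurable_fun setT (move_samples h).
  by move=> mh; apply/measurable_fun_pair => //=;
    exact: (measurableT_comp mh measurable_snd).
apply: (averaging_reduces_variance (measurable_proposal_density q_density)
  (proposal_density0 q_density)
  (T := fun s => move_samples (coord_shift s))
  (T' := fun s => move_samples (coord_unshift s))
  _ _ _ _ _ _ me1 e10 me2 e20 _ kmh1 kmh2 pi1E pi2E ch1 ch2
  (f := fun z => phi z.1)).
- by rewrite card_ffun !card_ord expn_gt0.
- by move=> s; apply: mmove; exact: measurable_coord_shift.
- by move=> s; apply: mmove; exact: measurable_coord_unshift.
- by move=> s [t x]; rewrite /move_samples /= coord_shiftK.
- move=> s; apply: (state_measure_invariant muE (measurable_coord_shift s)).
  move=> t A mA; rewrite !DE.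
  exact: (coord_shift_invariant (Pk := fun k => kprob (Mk k) t)
    (P0 := kprob M t) (M_product t) s mA).
- by [].
- by move=> z; rewrite pf_estimate_mean.
- exact: (sqint_theta p_density pi_marginal m_density _ DE muE pi1E phi_L2).
- by [].
Qed.
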